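(* Let $\Omega\subset\mathbb{C}$ be a domain, $\Xi$ a regular partition of $\Omega$ with a regular generalized $\epsilon$-neighbourhood, and $f$ a bounded $\epsilon$-extendable cochain on $\Xi$ such that: (1) $\frac12\sum_{(U,V)\in\Xi^2}\frac1{2\pi}\int_{\partial\Xi}|\delta_{U,V}f(\tau)|\,|d\tau|<\infty$; (2) for each $U,V\in\Xi$ there is some $\epsilon>0$ such that $|\delta_{U,V}f|$ is bounded on $U_\epsilon\cap V_\epsilon$; (3) each singular point of $\partial\Xi$ has a neighbourhood $X$ such that for all $W\in\Xi$, $f_W$ is bounded on $X\cap W_\epsilon$. Suppose $\Omega$ is biholomorphic with the right half-plane $\mathbb{C}^+$ through $\rho:\mathbb{C}^+\to\Omega$, the boundary of $\Omega$ corresponding to the imaginary axis. Suppose $f$ and $\mathfrak{C}(f)$ are bounded on $\Omega$. Then $$\sup_\Omega|f|\le\sup_{\partial\Omega}|f-\mathfrak{C}(f)|+\sup_\Omega|\mathfrak{C}(f)|\le\sup_{\partial\Omega}|f|+2\sup_\Omega|\mathfrak{C}(f)|.$$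
   Context: Partition. A collection $\Xi$ of open subsets of $\Omega$ is a partition of $\Omega$ if its elements are pairwise disjoint, $\bigcup_{U\in\Xi}\overline U=\Omega$ (closures in $\Omega$), every point of $\Omega$ has a neighbourhood meeting only finitely many elements of $\Xi$, and each element has piecewise analytic boundary. $\partial\Xi$ is the union of the boundaries $\partial U$ (in $\Omega$), $U\in\Xi$. A point $x\in\partial\Xi$ is regular if some open $A\ni x$ in $\Omega$ has $\partial\Xi\cap A$ homeomorphic to a line; otherwise it is singular. $\Xi$ is regular if: singular points are isolated; every singular point $s$ has at least one line of regular points going into it, and these lines have finite variation in argument (if $\gamma:[0,1]\to\mathbb{C}$ parametrizes such a line with $\gamma(1)=s$, then a continuous branch of $\arg(\gamma(t)-s)$ remains bounded as $t\to1$); and there are $d>0$ and a positive integer $n$ such that any ball of radius $d$ contains at most $n$ finite lines of regular points. Neighbourhoods. A generalized $\epsilon$-neighbourhood of $\Xi$ consists of $\epsilon_0>0$ and, for each $\epsilon\in(0,\epsilon_0)$ and $U\in\Xi$, an open $U_\epsilon$ such that $\overline U\subset U_\epsilon$ (closure in $\Omega$) and $U_\epsilon\subset U_{\epsilon'}$ if $\epsilon<\epsilon'$. Put $d_U(\epsilon',\epsilon)=\sup\{r\ge0:\forall u\in U_{\epsilon'},\ B(u,2r)\subset U_\epsilon\}$ and $d_\Xi(\epsilon',\epsilon)=\inf_{U\in\Xi}d_U(\epsilon',\epsilon)$. It is regular if $d_\Xi(\epsilon',\epsilon)>0$ for $\epsilon>\epsilon'>0$ as long as $\epsilon$ is small enough.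 Cochain. An ($\epsilon$-extendable) cochain $f$ consists of $\epsilon>0$ and, for each $U\in\Xi$, an analytic function $f_U$ on $U_\epsilon$. Suprema of $|f|$ are over all components; $f$ is bounded if the $|f_U|$ are bounded by a common constant. Coboundary. $\delta_{U,V}f=f_U-f_V$, $(U,V)\in\Xi^2$, on $\partial U\cap\partial V$ (and on $U_\epsilon\cap V_\epsilon$), with $\partial U\cap\partial V$ oriented so that $U$ is on the left and $V$ on the right. In integrals over $\partial\Xi$, $\delta_{U,V}f$ is integrated over $\partial U\cap\partial V$; integrals of $|\delta_{U,V}f|$ are with respect to arc length. Cauchy–Heine transform. $\displaystyle\mathfrak{C}(f)(\zeta)=\frac12\sum_{(U,V)\in\Xi^2}\frac1{2\pi i}\int_{\partial\Xi}\frac{\delta_{U,V}f(\tau)}{\tau-\zeta}\,d\tau$ (integrated over the regular points of $\partial\Xi$; if a singular point is approached, the integral up to distance $\eta$ from it is assumed to converge as $\eta\to0$), regarded as a cochain on $\Xi$: on each $U\in\Xi$ it is given by this integral and by its analytic continuation from $U$ to the boundary. *)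

(* Defs.v *)
From HB Require Import structures.
From mathcomp Require Import all_boot all_order all_algebra.
From mathcomp Require Import all_classical all_reals all_analysis.
From mathcomp Require Import complex.

Set Implicit Arguments.
Unset Strict Implicit.
Unset Printing Implicit Defensive.

Import Order.TTheory GRing.Theory Num.Theory.
Import numFieldNormedType.Exports.

Local Open Scope classical_set_scope.
Local Open Scope ring_scope.

(* The complex plane [R[i]], with the topology of its norm, as a normed module
   over itself: [derivable g z 1] is complex differentiability at [z]. *)
#[warnings="-redundant-canonical-projection"]
HB.instance Definition _ (R : realType) := NormedModule.copy R[i] R[i]^o.

Section Complex.
Variable R : realType.
Local Notation C := R[i].
Local Notation mu := (@lebesgue_measure R).

(* The real-valued modulus: [`|z|] lives in [R[i]]. *)
Definition cmod (z : C) : R := ComplexField.Normc.normc z.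

Definition disc (c : C) (r : R) : set C := [set z | cmod (z - c) < r].

Definition holomorphic_on (A : set C) (g : C -> C) : Prop :=
  forall z, A z -> derivable g z 1.

Definition cintegral (D : set R) (h : R -> C) : C :=
  Complex (\int[mu]_(t in D) complex.Re (h t))
          (\int[mu]_(t in D) complex.Im (h t)).

(* Unordered sums, meaningful for absolutely summable families. *)
Definition rsum (T : choiceType) (D : set T) (a : T -> R) : R :=
  fine (\esum_(i in D) (Num.max (a i) 0)%:E) -
  fine (\esum_(i in D) (Num.max (- a i) 0)%:E).

Definition csum (T : choiceType) (D : set T) (a : T -> C) : C :=
  Complex (rsum D (fun i => complex.Re (a i)))
          (rsum D (fun i => complex.Im (a i))).

Definition homeomorphic_to_line (S : set C) : Prop :=
  exists (phi : R -> C) (psi : C -> R),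
    [/\ continuous phi, range phi = S, cancel phi psi
      & {within S, continuous psi}].

(* [arcs] cuts [S] into analytic arcs, locally finitely many off [E].  An
   analytic arc is [t |-> G t%:C], [0 <= t <= 1], for [G] holomorphic near the
   segment [0, 1].  The pieces may thus accumulate at the points of [E], and
   analyticity may fail there. *)
Record piecewise_analytic (S E : set C) (arcs : set (C -> C)) : Prop := {
  arc_holomorphic : forall G, arcs G -> exists O : set C,
    [/\ open O, forall t, t \in `[0, 1] -> O t%:C%C & holomorphic_on O G];
  arc_injective : forall G, arcs G ->
    {in `[0, 1] &, injective (fun t : R => G t%:C%C)};
  arc_sub : forall G t, arcs G -> t \in `[0, 1] -> S (G t%:C%C);
  arc_disjoint : forall G H s t, arcs G -> arcs H -> G <> H ->
    s \in `]0, 1[ -> t \in `[0, 1] -> G s%:C%C <> H t%:C%C;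
  arc_cover : forall x, S x -> ~ E x ->
    exists G t, [/\ arcs G, t \in `[0, 1] & G t%:C%C = x];
  arc_locally_finite : forall x, S x -> ~ E x ->
    exists2 A : set C, nbhs x A &
      finite_set [set G | arcs G /\
                          exists2 t, t \in `[0, 1] & A (G t%:C%C)]
}.

End Complex.

Section Partition.
Variables (R : realType) (Omega : set R[i]) (Xi : set (set R[i])).
Local Notation C := R[i].

Definition boundary (U : set C) : set C :=
  Omega `&` (closure U `\` interior U).

Definition dXi : set C := \bigcup_(U in Xi) boundary U.

Definition regular_points : set C :=
  [set x | dXi x /\ exists A : set C,
    [/\ open A, A `<=` Omega, A x & homeomorphic_to_line (dXi `&` A)]].

Definition singular_points : set C := dXi `\` regular_points.

(* [arcs U] is a choice of the analytic pieces of the boundary of [U]; they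
   serve to parametrize the integrals over [dXi]. *)
Record is_partition (arcs : set C -> set (C -> C)) : Prop := {
  element_open : forall U, Xi U -> open U /\ U `<=` Omega;
  element_disjoint : forall U V, Xi U -> Xi V -> U <> V -> U `&` V = set0;
  element_cover : \bigcup_(U in Xi) (Omega `&` closure U) = Omega;
  element_locally_finite : forall x, Omega x -> exists2 A : set C, nbhs x A &
    finite_set [set U | Xi U /\ U `&` A !=set0];
  element_boundary : forall U, Xi U ->
    piecewise_analytic (boundary U) singular_points (arcs U)
}.

Definition regular_line (L : set C) : Prop :=
  homeomorphic_to_line L /\
  exists2 x, regular_points x & L = connected_component regular_points x.

(* [g] on [0, 1[ parametrizes the end of a line of regular points. *)
Definition line_into (s : C) (g : R -> C) : Prop :=
  [/\ {within `[0, 1], continuous g}, g 1 = s,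
      {in `[0, 1[ &, injective g} &
      forall t, t \in `[0, 1[ -> regular_points (g t)].

Definition finite_variation_arg (s : C) (g : R -> C) : Prop :=
  exists (theta : R -> R) (M : R),
    [/\ {within `[0, 1[, continuous theta},
        forall t, t \in `[0, 1[ ->
          g t - s = (cmod (g t - s))%:C%C
                    * Complex (cos (theta t)) (sin (theta t)) &
        \forall t \near 1^'-, `|theta t| <= M].

Record is_regular_partition : Prop := {
  singular_isolated : singular_points `<=` isolated singular_points;
  singular_line : forall s, singular_points s -> exists g, line_into s g;
  singular_arg : forall s g, singular_points s -> line_into s g ->
    finite_variation_arg s g;
  (* a line contained in a ball is finite *)
  lines_in_balls : exists (d : R) (n : nat), [/\ 0 < d, (0 < n)%N &
    forall c : C, ([set L | regular_line L /\ L `<=` disc c d] #<= `I_n)%card]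
}.

Record generalized_neighbourhood (eps0 : R) (N : R -> set C -> set C) : Prop := {
  nbhd_pos : 0 < eps0;
  nbhd_open : forall e U, 0 < e < eps0 -> Xi U ->
    [/\ open (N e U), N e U `<=` Omega & Omega `&` closure U `<=` N e U];
  nbhd_mono : forall e e' U, 0 < e -> e < e' -> e' < eps0 -> Xi U ->
    N e U `<=` N e' U
}.

(* Everything lives in [Omega], so the balls are those of [Omega]. *)
Definition nbhd_dist_elt (N : R -> set C -> set C) (e' e : R) (U : set C)
    : \bar R :=
  ereal_sup [set r%:E | r in [set r : R | 0 <= r /\
    forall u, N e' U u -> Omega `&` disc u (2 * r) `<=` N e U]].

Definition nbhd_dist (N : R -> set C -> set C) (e' e : R) : \bar R :=
  ereal_inf [set nbhd_dist_elt N e' e U | U in Xi].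

Definition regular_neighbourhood (eps0 : R) (N : R -> set C -> set C) : Prop :=
  exists2 e1, 0 < e1 <= eps0 &
    forall e' e, 0 < e' -> e' < e -> e < e1 -> (0 < nbhd_dist N e' e)%E.

Definition is_cochain (eps0 : R) (N : R -> set C -> set C) (eps : R)
    (f : set C -> C -> C) : Prop :=
  0 < eps < eps0 /\ forall U, Xi U -> holomorphic_on (N eps U) (f U).

Definition bounded_cochain (N : R -> set C -> set C) (eps : R)
    (f : set C -> C -> C) : Prop :=
  exists M : R, forall U z, Xi U -> N eps U z -> cmod (f U z) <= M.

Definition coboundary (f : set C -> C -> C) (U V : set C) (z : C) : C :=
  f U z - f V z.

(* [|g|] at a point of [Omega]: all the components living there, an element
   [U] carrying the component [g U] on its closure. *)
Definition cochain_abs (g : set C -> C -> C) (z : C) : \bar R :=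
  ereal_sup [set (cmod (g U z))%:E | U in [set U | Xi U /\ closure U z]].

Definition sup_domain (g : set C -> C -> C) : \bar R :=
  ereal_sup [set cochain_abs g z | z in Omega].

(* Components are defined in [Omega] only: [|g|] at a point of the boundary of
   [Omega] in the plane is its upper limit from within [Omega]. *)
Definition sup_boundary (g : set C -> C -> C) : \bar R :=
  ereal_sup [set limf_esup (cochain_abs g) (within Omega (nbhs xi))
            | xi in closure Omega `\` Omega].

Section Integrals.
Variable arcs : set C -> set (C -> C).
Local Notation mu := (@lebesgue_measure R).

(* Parameters of the regular points of [boundary U] and [boundary V] on the
   arc [G]. *)
Definition common_params (U V : set C) (G : C -> C) : set R :=
  [set t | 0 < t < 1 /\
    (regular_points `&` boundary U `&` boundary V) (G t%:C%C)].

Definition on_left (G : C -> C) (t : R) (U : set C) : Prop :=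
  \forall s \near 0^'+, U (G t%:C%C + Complex 0 s * derive1 G t%:C%C).

Definition on_right (G : C -> C) (t : R) (U : set C) : Prop :=
  \forall s \near 0^'+, U (G t%:C%C - Complex 0 s * derive1 G t%:C%C).

(* [1] if [G] runs with [U] on its left and [V] on its right, [-1] if it runs
   the other way. *)
Definition orientation (G : C -> C) (t : R) (U V : set C) : C :=
  if `[< on_left G t U /\ on_right G t V >] then 1
  else if `[< on_left G t V /\ on_right G t U >] then -1
  else 0.

Definition contour_integral (U V : set C) (g : C -> C) : C :=
  csum (arcs U) (fun G => cintegral (common_params U V G) (fun t =>
    orientation G t U V * g (G t%:C%C) * derive1 G t%:C%C)).

Definition arclength_integral (U V : set C) (h : C -> R) : \bar R :=
  \esum_(G in arcs U)
    (\int[mu]_(t in common_params U V G)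
      (h (G t%:C%C) * cmod (derive1 G t%:C%C))%:E)%E.

Definition cauchy_heine_mass (f : set C -> C -> C) : \bar R :=
  (2^-1%:E * \esum_(p in Xi `*` Xi)
    ((2 * pi)^-1%:E *
     arclength_integral p.1 p.2 (fun tau => cmod (coboundary f p.1 p.2 tau))))%E.

Definition cauchy_heine_integral (f : set C -> C -> C) (zeta : C) : C :=
  2^-1 * csum (Xi `*` Xi) (fun p : set C * set C =>
    (Complex 0 (2 * pi))^-1 *
    contour_integral p.1 p.2
      (fun tau => coboundary f p.1 p.2 tau / (tau - zeta))).

Definition analytic_continuation (U : set C) (g : C -> C) (z : C) : C :=
  xget 0 [set v | exists (A : set C) (h : C -> C),
    [/\ open A, A z, holomorphic_on A h, {in A `&` U, h =1 g} & v = h z]].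

Definition cauchy_heine (f : set C -> C -> C) (U : set C) (z : C) : C :=
  if z \in U then cauchy_heine_integral f z
  else analytic_continuation U (cauchy_heine_integral f) z.

End Integrals.

End Partition.

Section HalfPlane.
Variable R : realType.
Local Notation C := R[i].

Definition half_plane : set C := [set w | 0 < complex.Re w].
Definition closed_half_plane : set C := [set w | 0 <= complex.Re w].
Definition imaginary_axis : set C := [set w | complex.Re w = 0].

Definition biholomorphic (A B : set C) (rho : C -> C) : Prop :=
  [/\ holomorphic_on A rho, rho @` A `<=` B &
      exists sigma : C -> C, [/\ holomorphic_on B sigma, sigma @` B `<=` A,
        {in A, cancel rho sigma} & {in B, cancel sigma rho}]].

(* Boundary correspondence: [rho] extends continuously to the closed half-plane
   and carries the imaginary axis onto the boundary of [Omega] in the plane. *)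
Definition boundary_on_imaginary_axis (Omega : set C) (rho : C -> C) : Prop :=
  {within closed_half_plane, continuous rho} /\
  rho @` imaginary_axis = closure Omega `\` Omega.

End HalfPlane.

(* Main.v *)
Require Import Defs.
From mathcomp Require Import all_boot all_order all_algebra.
From mathcomp Require Import all_classical all_reals all_analysis.
From mathcomp Require Import complex measurable_realfun ring lra.
Set Implicit Arguments.
Unset Strict Implicit.
Unset Printing Implicit Defensive.
Import Order.TTheory GRing.Theory Num.Theory.
Import numFieldNormedType.Exports.
Local Open Scope classical_set_scope.
Local Open Scope ring_scope.
Local Notation Re := complex.Re.
Local Notation Im := complex.Im.

(** Let [CH] denote the Cauchy-Heine integral.  The point is that the functions
    [f U - CH], one on each element [U] of the partition, are restrictions of a
    single bounded holomorphic function [H] on [Omega]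
    ([cauchy_heine_difference]).  Granting this, [f U = H + C(f)_U] on the closure
    of [U] in [Omega], the continuation of [CH] from [U] being [f U - H].  The
    function [H \o rho] is bounded and holomorphic on the half-plane, and near the
    imaginary axis, which [rho] carries to the boundary of [Omega], its modulus is
    at most the boundary supremum of [f - C(f)] up to any [e > 0].  The
    Phragmen-Lindelof principle ([phragmen_lindelof]) extends the bound to the
    half-plane, which is the first inequality.  The second one is the triangle
    inequality for upper limits at the boundary ([sup_boundary_perturb]).

    To construct [H], fix a point [x] of [Omega].

    If [x] lies in an element, nothing is to be glued: [CH] is a linear functional
    of the kernel [1 / (tau - zeta)], bounded because the mass of the coboundary is
    finite, and may therefore be differentiated in [zeta] off the boundary of the
    partition ([cder_functional], [cut_kernel_holo]).

    If [x] is a regular point at which no arc ends or has zero derivative, the arc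
    through [x] straightens the boundary of the partition near [x] into the real
    axis of a chart, and the two sides of the arc belong to single elements [P] and
    [Q] ([arc_structure]).  Moving the contour to one side of the arc changes the
    integral by a residue for the points it passes over: the Cauchy integral of
    [f P - f Q] jumps by [f P - f Q] across the arc ([arc_integral_above],
    [arc_integral_below]).  This is also the jump of [f], so [f U - CH] goes through
    ([locally_extends_good]).

    The remaining points are isolated.  Singular points are so by hypothesis; near
    a regular point there are finitely many arcs, and each is injective, hence has
    finitely many critical points ([finite_critical]).  As [f] and [C(f)] are
    bounded, so is [f U - CH], and these points are removable
    ([locally_extends_punctured]).

    The complex analysis is built on integrals over the boundary of rectangles:
    Goursat's theorem by bisection, allowing one exceptional point where the
    integrand is merely bounded; Cauchy's formula, the constant [2 pi i] coming from
    an arctangent; the holomorphy of derivatives; removable singularities; and the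
    maximum principle, deduced from Cauchy's formula for the powers of a
    function. *)


(** * The complex plane: modulus, topology, complex derivatives *)

#[global] Arguments cmod : simpl never.

Section Modulus.
Variable R : realType.
Local Notation C := R[i].
Implicit Types z w : C.

Lemma normE z : `|z| = (cmod z)%:C%C. Proof. by []. Qed.

Lemma cmod0 : cmod (0 : C) = 0. Proof. exact: ComplexField.Normc.normc0. Qed.
Lemma cmod1 : cmod (1 : C) = 1. Proof. exact: ComplexField.Normc.normc1. Qed.

Lemma cmod_ge0 z : 0 <= cmod z.
Proof. by rewrite -lecR -normE normr_ge0. Qed.

Lemma cmod_eq0 z : (cmod z == 0) = (z == 0).
Proof.
by apply/eqP/eqP => [/ComplexField.Normc.eq0_normc//|->]; rewrite cmod0.
Qed.

Lemma cmod_gt0 z : (0 < cmod z) = (z != 0).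
Proof. by rewrite lt_neqAle cmod_ge0 andbT eq_sym cmod_eq0. Qed.

Lemma cmodM z w : cmod (z * w) = cmod z * cmod w.
Proof. exact: ComplexField.Normc.normcM. Qed.

Lemma cmodV z : cmod z^-1 = (cmod z)^-1.
Proof. exact: ComplexField.Normc.normcV. Qed.

Lemma cmodX z n : cmod (z ^+ n) = cmod z ^+ n.
Proof.
by elim: n => [|n IH]; rewrite ?expr0 ?cmod1// !exprS cmodM IH.
Qed.

Lemma cmodN z : cmod (- z) = cmod z. Proof. exact: normcN. Qed.

Lemma cmodD z w : cmod (z + w) <= cmod z + cmod w.
Proof. exact: le_normcD. Qed.

Lemma cmodBC z w : cmod (z - w) = cmod (w - z).
Proof. by rewrite -cmodN opprB. Qed.

Lemma cmodB z w : cmod (z - w) <= cmod z + cmod w.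
Proof. by rewrite -(cmodN w); exact: cmodD. Qed.

Lemma cmod_triangle a z w : cmod (z - w) <= cmod (z - a) + cmod (a - w).
Proof. by rewrite (_ : z - w = (z - a) + (a - w)) ?cmodD//; ring. Qed.

Lemma cmod_lower z w : cmod z - cmod w <= cmod (z - w).
Proof. by rewrite lerBlDr -{1}(subrK w z) cmodD. Qed.

Lemma cmod_real (x : R) : cmod x%:C%C = `|x|.
Proof. by rewrite /cmod /= expr0n /= addr0 sqrtr_sqr. Qed.

Lemma cmod_Re z : `|Re z| <= cmod z.
Proof.
case: z => x y /=; rewrite /cmod /= -sqrtr_sqr ler_wsqrtr// lerDl.
exact: sqr_ge0.
Qed.

Lemma cmod_Im z : `|Im z| <= cmod z.
Proof.
case: z => x y /=; rewrite /cmod /= -sqrtr_sqr ler_wsqrtr// lerDr.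
exact: sqr_ge0.
Qed.

Lemma complex_ext z w :
  Re z = Re w -> Im z = Im w -> z = w.
Proof. by case: z => a b; case: w => c d /= -> ->. Qed.

Lemma complexN (a b : R) : - Complex a b = Complex (- a) (- b) :> C.
Proof. by []. Qed.

Lemma complexB (a b c d : R) :
  Complex a b - Complex c d = Complex (a - c) (b - d) :> C.
Proof. by []. Qed.

Lemma cmod_le z : cmod z <= `|Re z| + `|Im z|.
Proof.
case: z => x y; rewrite [Re _]/= [Im _]/=.
have -> : Complex x y = x%:C%C + (Complex 0 1) * y%:C%C.
  by apply: complex_ext => /=; ring.
apply: (le_trans (cmodD _ _)); rewrite cmodM !cmod_real.
have -> : cmod (Complex 0 1 : C) = 1.
  by rewrite /cmod /= expr0n add0r expr1n sqrtr1.
by rewrite mul1r.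
Qed.

Lemma ReD z w : Re (z + w) = Re z + Re w.
Proof. by case: z => a b; case: w => c d. Qed.
Lemma ImD z w : Im (z + w) = Im z + Im w.
Proof. by case: z => a b; case: w => c d. Qed.
Lemma ReN z : Re (- z) = - Re z. Proof. by case: z. Qed.
Lemma ImN z : Im (- z) = - Im z. Proof. by case: z. Qed.
Lemma ReM z w : Re (z * w) =
  Re z * Re w - Im z * Im w.
Proof. by case: z => a b; case: w => c d. Qed.
Lemma ImM z w : Im (z * w) =
  Re z * Im w + Im z * Re w.
Proof. by case: z => a b; case: w => c d. Qed.

End Modulus.

Section Topology.
Variable R : realType.
Local Notation C := R[i].
Implicit Types z w : C.

Lemma disc_center z (r : R) : 0 < r -> disc z r z.
Proof. by move=> r0; rewrite /disc /= subrr cmod0. Qed.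

Lemma disc_sub z (r s : R) : r <= s -> disc z r `<=` disc z s.
Proof. by move=> rs w; rewrite /disc /= => /lt_le_trans; apply. Qed.

(** The balls of [R[i]] have complex radii; this brings every neighbourhood
    argument back to discs with a real radius. *)
Lemma nbhs_discP z (A : set C) :
  nbhs z A <-> exists2 r : R, 0 < r & disc z r `<=` A.
Proof.
apply: (iff_trans (iff_sym (nbhs_ballP z A))); split.
- move=> [e e0 he]; have [eR e0'] : (Im e = 0) /\ 0 < Re e.
    by move: e0; rewrite /= ltcE => /andP[/eqP/= -> ->].
  exists (Re e) => // w hw; apply: he.
  suff : `|z - w| < e by [].
  have -> : e = (Re e)%:C%C by apply: complex_ext => //=.
  by rewrite -normrN opprB normE ltcR.
- move=> [r r0 hr]; exists r%:C%C; first by rewrite /= ltcR.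
  move=> w hw; have : `|z - w| < r%:C%C by [].
  by rewrite -normrN opprB normE ltcR; exact: hr.
Qed.

Lemma nbhs_disc z (r : R) : 0 < r -> nbhs z (disc z r).
Proof. by move=> r0; apply/nbhs_discP; exists r. Qed.

Lemma open_discP (A : set C) :
  open A <-> forall z, A z -> exists2 r : R, 0 < r & disc z r `<=` A.
Proof.
rewrite openE; split=> h z Az; first by apply/nbhs_discP; exact: h.
by apply/nbhs_discP; exact: h.
Qed.

Lemma open_disc z (r : R) : open (disc z r).
Proof.
apply/open_discP => w; rewrite /disc /= => wr.
exists (r - cmod (w - z)); first by rewrite subr_gt0.
move=> v; rewrite /= ltrBrDr => hv.
exact: le_lt_trans (cmod_triangle w _ _) hv.
Qed.

Lemma closure_discP (A : set C) z :
  closure A z <-> forall r : R, 0 < r -> exists2 w, A w & cmod (w - z) < r.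
Proof.
split=> [cz r r0|h B /nbhs_discP[r r0 rB]].
  by have [w [Aw zw]] := cz _ (nbhs_disc z r0); exists w.
by have [w Aw wr] := h _ r0; exists w; split=> //; exact: rB.
Qed.

Lemma cvg_discP (g : C -> C) z (l : C) : g @ z --> l <->
  forall e : R, 0 < e -> exists2 r : R, 0 < r &
    forall w, cmod (w - z) < r -> cmod (g w - l) < e.
Proof.
split=> [h e e0|h A /nbhs_discP[e e0 eA]].
  have /nbhs_discP[r r0 hr] := h _ (nbhs_disc l e0).
  by exists r => // w wr; exact: hr.
have [r r0 hr] := h _ e0; apply/nbhs_discP; exists r => // w /hr hw.
exact: eA.
Qed.

Lemma cont_bounded (g : C -> C) z : {for z, continuous g} ->
  exists2 r : R, 0 < r & forall w, cmod (w - z) < r ->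
    cmod (g w) <= cmod (g z) + 1.
Proof.
move=> /cvg_discP/(_ 1 ltr01)[r r0 h]; exists r => // w /h hw.
by rewrite -lerBlDl; apply/ltW; apply: le_lt_trans hw; exact: cmod_lower.
Qed.

End Topology.

Section Continuity.
Variable R : realType.
Local Notation C := R[i].
Implicit Types (g h : C -> C) (c z : C).

Lemma cont_discP g z : {for z, continuous g} <->
  forall e : R, 0 < e -> exists2 r : R, 0 < r &
    forall w, cmod (w - z) < r -> cmod (g w - g z) < e.
Proof. exact: cvg_discP. Qed.

Lemma cont_cst c z : {for z, continuous (fun _ : C => c)}.
Proof.
by apply/cont_discP => e e0; exists 1 => // w _; rewrite subrr cmod0.
Qed.

Lemma cont_id z : {for z, continuous (fun w : C => w)}.
Proof. by apply/cont_discP => e e0; exists e. Qed.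

Lemma contD g h z : {for z, continuous g} -> {for z, continuous h} ->
  {for z, continuous (fun w => g w + h w)}.
Proof. by move=> cg ch; exact: (@cvgD _ R[i]^o _ _ _ g h _ _ cg ch). Qed.

Lemma contN g z : {for z, continuous g} ->
  {for z, continuous (fun w => - g w)}.
Proof. by move=> cg; exact: (@cvgN _ R[i]^o _ _ _ g _ cg). Qed.

Lemma contB g h z : {for z, continuous g} -> {for z, continuous h} ->
  {for z, continuous (fun w => g w - h w)}.
Proof. by move=> cg ch; exact: contD cg (contN ch). Qed.

Lemma contM g h z : {for z, continuous g} -> {for z, continuous h} ->
  {for z, continuous (fun w => g w * h w)}.
Proof. by move=> cg ch; exact: (@cvgM R[i] _ _ _ g h _ _ cg ch). Qed.

Lemma contV g z : g z != 0 -> {for z, continuous g} ->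
  {for z, continuous (fun w => (g w)^-1)}.
Proof. by move=> g0 cg; exact: (@cvgV R[i] _ _ _ g _ g0 cg). Qed.

Lemma contX g z n : {for z, continuous g} ->
  {for z, continuous (fun w => g w ^+ n)}.
Proof.
move=> cg; elim: n => [|n IH]; first exact: cont_cst.
have -> : (fun w => g w ^+ n.+1) = (fun w => g w * g w ^+ n).
  by apply/funext => w; rewrite exprS.
by apply: contM; [exact: cg|exact: IH].
Qed.

End Continuity.


Section ComplexDerivative.
Variable R : realType.
Local Notation C := R[i].
Implicit Types (g h : C -> C) (z w d : C).

(** Caratheodory's form of [g] has complex derivative [d] at [z]: the slope
    function is continuous at [z].  It turns the rules of differentiation into
    the continuity of sums, products and composites. *)
Definition cder g z d := exists q : C -> C,
  [/\ {for z, continuous q}, q z = d & forall w, g w = g z + q w * (w - z)].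

Lemma cvg_dnbhs_discP (F : C -> C) z (l : C) : F @ z^' --> l <->
  forall e : R, 0 < e -> exists2 r : R, 0 < r &
    forall w, w != z -> cmod (w - z) < r -> cmod (F w - l) < e.
Proof.
split=> [h e e0|h A /nbhs_discP[e e0 eA]].
  have /nbhs_discP[r r0 hr] := h _ (nbhs_disc l e0).
  by exists r => // w wz wr; exact: hr.
have [r r0 hr] := h _ e0; apply/nbhs_discP; exists r => // w wr wz.
by apply: eA; exact: hr.
Qed.

Lemma cder_slope g z d : cder g z d <->
  (fun w => (g w - g z) / (w - z)) @ z^' --> d.
Proof.
split.
- move=> [q [/cvg_discP cq qz gq]]; apply/cvg_dnbhs_discP => e e0.
  have [r r0 hr] := cq _ e0; exists r => // w wz /hr; rewrite qz; congr (_ < _).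
  rewrite gq (_ : (g z + q w * (w - z) - g z) / (w - z) = q w)//.
  by field; rewrite subr_eq0.
- move=> /cvg_dnbhs_discP h.
  exists (fun w => if w == z then d else (g w - g z) / (w - z)); split => //.
  + apply/cvg_discP => e e0; have [r r0 hr] := h _ e0; exists r => // w wr.
    rewrite eqxx; case: eqVneq => [_|wz]; first by rewrite subrr cmod0.
    exact: hr.
  + by rewrite eqxx.
  + move=> w; case: eqVneq => [->|wz]; first by ring.
    by field; rewrite subr_eq0.
Qed.

(** The epsilon form, for estimates; the slope form above is for algebra. *)
Lemma cderP g z d : cder g z d <-> forall e : R, 0 < e ->
  exists2 r : R, 0 < r & forall w, cmod (w - z) < r ->
    cmod (g w - g z - d * (w - z)) <= e * cmod (w - z).
Proof.
rewrite cder_slope; split=> [/cvg_dnbhs_discP h e e0|h].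
  have [r r0 hr] := h _ e0; exists r => // w wr.
  have [->|wz] := eqVneq w z; first by rewrite !subrr mulr0 subrr cmod0 mulr0.
  have wz0 : w - z != 0 by rewrite subr_eq0.
  rewrite (_ : _ - d * _ = ((g w - g z) / (w - z) - d) * (w - z)); last by field.
  by rewrite cmodM ler_pM2r ?cmod_gt0//; apply/ltW/hr.
apply/cvg_dnbhs_discP => e e0.
have [r r0 hr] := h _ (divr_gt0 e0 (ltr0n R 2)); exists r => // w wz wr.
have wz0 : w - z != 0 by rewrite subr_eq0.
have := hr _ wr.
rewrite (_ : _ - d * _ = ((g w - g z) / (w - z) - d) * (w - z)); last by field.
rewrite cmodM ler_pM2r ?cmod_gt0// => /le_lt_trans; apply.
by rewrite ltr_pdivrMr// ltr_pMr// ltr1n.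
Qed.

Lemma cder_derivable g z d : cder g z d -> derivable g z 1 /\ derive1 g z = d.
Proof.
move=> /cder_slope/cvg_dnbhs_discP h.
have cv : (fun x : C => x^-1 *: (g (x + z) - g z)) @ 0^' --> d.
  apply/cvg_dnbhs_discP => e e0; have [r r0 hr] := h _ e0; exists r => // w w0.
  rewrite subr0 => wr; have := hr (w + z).
  rewrite addrK => /(_ _ wr) H.
  rewrite -[_ *: _]/(_ * _) mulrC; apply: H.
  by rewrite -subr_eq0 addrK.
split.
  apply/cvg_ex; exists d; apply: cvg_trans cv; apply: near_eq_cvg.
  by near=> x; rewrite [x *: 1]mulr1.
rewrite /derive1; apply: cvg_lim cv; exact: (@norm_hausdorff _ R[i]^o).
Unshelve. all: by end_near. Qed.

Lemma derivable_cder g z : derivable g z 1 -> cder g z (derive1 g z).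
Proof.
move=> /cvg_ex[l hl].
suff cg : cder g z l by have [_ ->] := cder_derivable cg.
have {}hl : (fun x : C => x^-1 *: (g (x + z) - g z)) @ 0^' --> l.
  apply: cvg_trans hl; apply: near_eq_cvg; near=> x.
  by rewrite [x *: 1]mulr1.
move/cvg_dnbhs_discP : hl => hl.
apply/cder_slope/cvg_dnbhs_discP => e e0.
have [r r0 hr] := hl _ e0; exists r => // w wz wr.
have := hr (w - z); rewrite subr_eq0 subr0 subrK => /(_ wz wr).
by rewrite mulrC.
Unshelve. all: by end_near. Qed.

Lemma holoP (A : set C) g :
  holomorphic_on A g <-> forall z, A z -> exists d, cder g z d.
Proof.
split=> h z /h; first by move=> /derivable_cder; eexists; eassumption.
by move=> [d /cder_derivable[]].
Qed.

Lemma holo_cder (A : set C) g z :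
  holomorphic_on A g -> A z -> cder g z (derive1 g z).
Proof. by move=> gA /gA /derivable_cder. Qed.

Lemma cder_unique g z d d' : cder g z d -> cder g z d' -> d = d'.
Proof. by move=> /cder_derivable[_ <-] /cder_derivable[_ <-]. Qed.

Lemma cder_cont g z d : cder g z d -> {for z, continuous g}.
Proof.
move=> [q [cq _ gq]].
have -> : g = (fun w => g z + q w * (w - z)) by apply/funext => w; exact: gq.
apply: contD; first exact: cont_cst.
apply: contM; first exact: cq.
by apply: contB; [exact: cont_id|exact: cont_cst].
Qed.

Lemma holo_cont (A : set C) g z :
  holomorphic_on A g -> A z -> {for z, continuous g}.
Proof. by move=> /holoP h /h[d /cder_cont]. Qed.

Lemma cder_near g h z d (r : R) : 0 < r ->
  (forall w, disc z r w -> g w = h w) -> cder g z d -> cder h z d.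
Proof.
move=> r0 gh /cderP hg; apply/cderP => e e0; have [s s0 hs] := hg _ e0.
exists (Num.min r s); first by rewrite lt_min r0 s0.
move=> w; rewrite lt_min => /andP[wr ws].
by rewrite -gh// -gh; [exact: hs|exact: disc_center].
Qed.

Lemma cder_cst c z : cder (fun=> c) z 0.
Proof.
exists (fun=> 0); split=> [|//|w]; first exact: cont_cst.
by rewrite mul0r addr0.
Qed.

Lemma cder_id z : cder (fun w => w) z 1.
Proof.
exists (fun=> 1); split=> [|//|w]; first exact: cont_cst.
by ring.
Qed.

Lemma cderD g h z d d' : cder g z d -> cder h z d' ->
  cder (fun w => g w + h w) z (d + d').
Proof.
move=> [p [cp <- gp]] [q [cq <- hq]]; exists (fun w => p w + q w).
split=> [|//|w]; first by apply: contD; [exact: cp|exact: cq].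
by rewrite gp hq; ring.
Qed.

Lemma cderN g z d : cder g z d -> cder (fun w => - g w) z (- d).
Proof.
move=> [p [cp <- gp]]; exists (fun w => - p w).
split=> [|//|w]; first by apply: contN; exact: cp.
by rewrite gp; ring.
Qed.

Lemma cderB g h z d d' : cder g z d -> cder h z d' ->
  cder (fun w => g w - h w) z (d - d').
Proof. by move=> hg /cderN; exact: cderD. Qed.

Lemma cder_sub p z : cder (fun w => w - p) z 1.
Proof. by have := cderB (cder_id z) (cder_cst p z); rewrite subr0. Qed.

Lemma cderM g h z d d' : cder g z d -> cder h z d' ->
  cder (fun w => g w * h w) z (d * h z + g z * d').
Proof.
move=> hg hh; have ch := cder_cont hh.
move: hg hh => [p [cp <- gp]] [q [cq <- hq]].
exists (fun w => p w * h w + g z * q w).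
split=> [|//|w].
  apply: contD; first by apply: contM; [exact: cp|exact: ch].
  by apply: contM; [exact: cont_cst|exact: cq].
by rewrite gp {1 2}hq; ring.
Qed.

Lemma cderZ c g z d : cder g z d -> cder (fun w => c * g w) z (c * d).
Proof.
move=> [p [cp <- gp]]; exists (fun w => c * p w).
split=> [|//|w]; first by apply: contM; [exact: cont_cst|exact: cp].
by rewrite gp; ring.
Qed.

(** The slope [- p w / (g w * g z)] represents the inverse only where [g] does
    not vanish, hence the passage to a function equal to [1 / g] near [z]. *)
Lemma cderV g z d : g z != 0 -> cder g z d ->
  cder (fun w => (g w)^-1) z (- d / g z ^+ 2).
Proof.
move=> g0 hg; have cg := cder_cont hg.
have [r r0 hr] : exists2 r : R, 0 < r & forall w, disc z r w -> g w != 0.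
  move/cvg_discP : cg => /(_ (cmod (g z))); rewrite cmod_gt0 => /(_ g0)[r r0 h].
  exists r => // w /h; apply: contraTneq => ->.
  by rewrite sub0r cmodN ltxx.
move: hg => [p [cp <- gp]].
apply: (@cder_near (fun w => if `[< disc z r w >] then (g w)^-1 else
    (g z)^-1 - p w / (g w * g z) * (w - z)) _ z _ r) => //.
  by move=> w /asboolT ->.
exists (fun w => - p w / (g w * g z)).
have gg : g z * g z != 0 by rewrite mulf_neq0.
split=> [||w].
- apply: contM; first by apply: contN; exact: cp.
  apply: contV; first exact: gg.
  by apply: contM; [exact: cg|exact: cont_cst].
- by rewrite expr2.
- rewrite (asboolT (disc_center z r0)).
  case: asboolP => [/hr gw|_]; last by ring.
  have e : p w * (w - z) = g w - g z by rewrite gp; ring.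
  rewrite (_ : _ * (w - z) = - (p w * (w - z)) / (g w * g z)); last by ring.
  by rewrite e; field; rewrite ?gw ?g0.
Qed.

Lemma cder_comp g h z d d' : cder g z d -> cder h (g z) d' ->
  cder (fun w => h (g w)) z (d' * d).
Proof.
move=> hg hh; have cg := cder_cont hg.
move: hg hh => [p [cp <- gp]] [q [cq <- hq]].
exists (fun w => q (g w) * p w).
split=> [|//|w].
  apply: contM; last exact: cp.
  by apply: continuous_comp; [exact: cg|exact: cq].
rewrite hq (_ : g w - g z = p w * (w - z)); last by rewrite (gp w); ring.
by ring.
Qed.

Lemma cderX g z d n : cder g z d -> exists d', cder (fun w => g w ^+ n) z d'.
Proof.
move=> hg; elim: n => [|n [d' IH]]; first by exists 0; exact: cder_cst.
exists (d * g z ^+ n + g z * d').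
by under eq_fun do rewrite exprS; exact: cderM.
Qed.

Lemma holoS (A B : set C) g : A `<=` B -> holomorphic_on B g -> holomorphic_on A g.
Proof. by move=> AB h z /AB /h. Qed.

Lemma holo_cst (A : set C) c : holomorphic_on A (fun=> c).
Proof. by apply/holoP => z _; exists 0; exact: cder_cst. Qed.

Lemma holoD (A : set C) g h : holomorphic_on A g -> holomorphic_on A h ->
  holomorphic_on A (fun w => g w + h w).
Proof.
move=> hg hh; apply/holoP => z Az.
by eexists; exact: cderD (holo_cder hg Az) (holo_cder hh Az).
Qed.

Lemma holoB (A : set C) g h : holomorphic_on A g -> holomorphic_on A h ->
  holomorphic_on A (fun w => g w - h w).
Proof.
move=> hg hh; apply/holoP => z Az.
by eexists; exact: cderB (holo_cder hg Az) (holo_cder hh Az).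
Qed.

Lemma holoM (A : set C) g h : holomorphic_on A g -> holomorphic_on A h ->
  holomorphic_on A (fun w => g w * h w).
Proof.
move=> hg hh; apply/holoP => z Az.
by eexists; exact: cderM (holo_cder hg Az) (holo_cder hh Az).
Qed.

Lemma holoZ (A : set C) c g : holomorphic_on A g ->
  holomorphic_on A (fun w => c * g w).
Proof. by move=> hg; apply: holoM; [exact: holo_cst|exact: hg]. Qed.

Lemma holo_comp (A B : set C) g h : holomorphic_on A g -> g @` A `<=` B ->
  holomorphic_on B h -> holomorphic_on A (fun w => h (g w)).
Proof.
move=> hg gAB hh; apply/holoP => z Az.
eexists; apply: cder_comp (holo_cder hg Az) (holo_cder hh _).
by apply: gAB; exists z.
Qed.

End ComplexDerivative.

(** * Integrals of complex functions of a real variable *)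

Section ComplexIntegral.
Variable R : realType.
Local Notation C := R[i].
Local Notation mu := (@lebesgue_measure R).
Local Notation mset D := (@measurable _ (measurableTypeR R) D).
Implicit Types (h k : R -> C) (D : set R) (c : C).

Definition cinteg D h :=
  mu.-integrable D (EFin \o (fun t => Re (h t))) /\
  mu.-integrable D (EFin \o (fun t => Im (h t))).

Lemma integrable_ext D (f g : R -> R) : mset D ->
  (forall t, D t -> f t = g t) ->
  mu.-integrable D (EFin \o f) -> mu.-integrable D (EFin \o g).
Proof.
move=> mD fg; apply: eq_integrable => // t; rewrite inE /= => /fg ->//.
Qed.

Lemma integrable_lin D (a b : R) (f g : R -> R) : mset D ->
  mu.-integrable D (EFin \o f) -> mu.-integrable D (EFin \o g) ->
  mu.-integrable D (EFin \o (fun t => a * f t + b * g t)).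
Proof.
move=> mD hf hg.
have := integrableD mD (integrableZl mD a hf) (integrableZl mD b hg).
by apply: eq_integrable.
Qed.

Lemma Rintegral_lin D (a b : R) (f g : R -> R) : mset D ->
  mu.-integrable D (EFin \o f) -> mu.-integrable D (EFin \o g) ->
  \int[mu]_(t in D) (a * f t + b * g t) =
  a * \int[mu]_(t in D) f t + b * \int[mu]_(t in D) g t.
Proof.
move=> mD hf hg.
rewrite RintegralD ?RintegralZl//.
- by have := integrableZl mD a hf; apply: eq_integrable.
- by have := integrableZl mD b hg; apply: eq_integrable.
Qed.

Lemma eq_cintegral D h k : (forall t, D t -> h t = k t) ->
  cintegral D h = cintegral D k.
Proof.
move=> hk; rewrite /cintegral; congr Complex; apply: eq_Rintegral => t;
  by rewrite inE => /hk ->.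
Qed.

Lemma cintegZ D c h : mset D -> cinteg D h -> cinteg D (fun t => c * h t).
Proof.
move=> mD [h1 h2]; split.
  apply: integrable_ext (integrable_lin (Re c) (- Im c) mD h1 h2)
    => // t _.
  by rewrite ReM mulNr.
apply: integrable_ext (integrable_lin (Im c) (Re c) mD h1 h2)
  => // t _.
by rewrite ImM addrC.
Qed.

Lemma cintegralD D h k : mset D -> cinteg D h -> cinteg D k ->
  cintegral D (fun t => h t + k t) = cintegral D h + cintegral D k.
Proof.
move=> mD [h1 h2] [k1 k2]; apply: complex_ext => /=.
  under eq_Rintegral do rewrite ReD.
  exact: RintegralD.
under eq_Rintegral do rewrite ImD.
exact: RintegralD.
Qed.

Lemma cintegralZ D c h : mset D -> cinteg D h ->
  cintegral D (fun t => c * h t) = c * cintegral D h.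
Proof.
move=> mD [h1 h2]; apply: complex_ext.
  rewrite ReM -mulNr.
  transitivity (\int[mu]_(t in D)
      (Re c * Re (h t) + - Im c * Im (h t))).
    by apply: eq_Rintegral => t _; rewrite ReM mulNr.
  exact: Rintegral_lin.
rewrite ImM addrC.
transitivity (\int[mu]_(t in D)
    (Im c * Re (h t) + Re c * Im (h t))).
  by apply: eq_Rintegral => t _; rewrite ImM addrC.
exact: Rintegral_lin.
Qed.

Lemma cintegralB D h k : mset D -> cinteg D h -> cinteg D k ->
  cintegral D (fun t => h t - k t) = cintegral D h - cintegral D k.
Proof.
move=> mD hh hk; rewrite -mulN1r -cintegralZ// -cintegralD//; last exact: cintegZ.
by apply: eq_cintegral => t _; rewrite mulN1r.
Qed.

(** The factor 2 is the price of bounding the real and imaginary parts apart;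
    the estimates below never need a sharp constant. *)
Lemma cintegral_bound D h (g : R -> R) : mset D -> cinteg D h ->
  mu.-integrable D (EFin \o g) -> (forall t, D t -> cmod (h t) <= g t) ->
  cmod (cintegral D h) <= 2 * \int[mu]_(t in D) g t.
Proof.
move=> mD [h1 h2] hg hhg; apply: (le_trans (cmod_le _)) => /=.
rewrite mulr_natl mulr2n; apply: lerD.
  apply: (le_trans (le_normr_Rintegral mD h1)); apply: le_Rintegral => //.
    exact: (integrable_norm h1).
  by move=> t Dt; apply: le_trans (cmod_Re _) _; exact: hhg.
apply: (le_trans (le_normr_Rintegral mD h2)); apply: le_Rintegral => //.
  exact: (integrable_norm h2).
by move=> t Dt; apply: le_trans (cmod_Im _) _; exact: hhg.
Qed.

(** ** Continuous integrands on a segment *)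

Lemma contR_discP h (t : R) : {for t, continuous h} <->
  forall e : R, 0 < e -> exists2 r : R, 0 < r &
    forall s, `|s - t| < r -> cmod (h s - h t) < e.
Proof.
split=> [ct e e0|ct A /nbhs_discP[e e0 eA]].
  have /nbhs_ballP[r r0 hr] := ct _ (nbhs_disc (h t) e0).
  exists r => // s sr; apply: hr; suff : `|t - s| < r by [].
  by rewrite distrC.
have [r r0 hr] := ct _ e0; apply/nbhs_ballP; exists r => // s ts.
have {ts} : `|t - s| < r by [].
by rewrite distrC => sr; apply: eA; exact: hr.
Qed.

Lemma Re_cont h t : {for t, continuous h} ->
  {for t, continuous (fun s => Re (h s))}.
Proof.
move=> /contR_discP ct; apply/cvgrPdist_lt => e e0; have [r r0 hr] := ct _ e0.
apply/nbhs_ballP; exists r => // s ts; have {ts}sr : `|t - s| < r by [].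
apply: le_lt_trans (hr s _); last by rewrite distrC.
by rewrite distrC -ReN -ReD; exact: cmod_Re.
Qed.

Lemma Im_cont h t : {for t, continuous h} ->
  {for t, continuous (fun s => Im (h s))}.
Proof.
move=> /contR_discP ct; apply/cvgrPdist_lt => e e0; have [r r0 hr] := ct _ e0.
apply/nbhs_ballP; exists r => // s ts; have {ts}sr : `|t - s| < r by [].
apply: le_lt_trans (hr s _); last by rewrite distrC.
by rewrite distrC -ImN -ImD; exact: cmod_Im.
Qed.

Lemma cont_cinteg (a b : R) h : (forall t, a <= t <= b -> {for t, continuous h}) ->
  cinteg `[a, b] h.
Proof.
move=> ch; split; apply: continuous_compact_integrable;
  do ?exact: segment_compact; apply: continuous_in_subspaceT => t;
  rewrite inE /= in_itv /= => /ch.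
  exact: Re_cont.
exact: Im_cont.
Qed.

Lemma fine_mu_itv (a b : R) : a <= b -> fine (mu `[a, b]) = b - a.
Proof.
move=> ab; rewrite lebesgue_measure_itv /= lte_fin.
by case: ltgtP ab => // -> _; rewrite subrr.
Qed.

Lemma cintegral_itv_bound (a b M : R) h : a <= b ->
  cinteg `[a, b] h -> (forall t, a <= t <= b -> cmod (h t) <= M) ->
  cmod (cintegral `[a, b] h) <= 2 * (M * (b - a)).
Proof.
move=> ab hh hM.
have mD : mset `[a, b] by exact: measurable_itv.
have -> : M * (b - a) = \int[mu]_(t in `[a, b]) M.
  rewrite Rintegral_cst//; congr (_ * _).
  exact/esym/fine_mu_itv.
apply: cintegral_bound => //.
apply: continuous_compact_integrable; first exact: segment_compact.
by apply: continuous_subspaceT => t; exact: cvg_cst.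
Qed.

Lemma cintegral_cst (a b : R) c : a <= b ->
  cintegral `[a, b] (fun=> c) = c * (b - a)%:C%C.
Proof.
move=> ab.
have mD : mset `[a, b] by exact: measurable_itv.
have e := fine_mu_itv ab.
apply: complex_ext; rewrite /cintegral ?ReM ?ImM /= Rintegral_cst// e; ring.
Qed.

Lemma cintegral_cat (a b d : R) h : a <= b -> b <= d -> cinteg `[a, d] h ->
  cintegral `[a, d] h = cintegral `[a, b] h + cintegral `[b, d] h.
Proof.
move=> ab bd hh.
have H (f : R -> R) : mu.-integrable `[a, d] (EFin \o f) ->
  \int[mu]_(t in `[a, d]) f t =
  \int[mu]_(t in `[a, b]) f t + \int[mu]_(t in `[b, d]) f t.
  move=> hf; have := @Rintegral_itvB _ f (BLeft a) (BRight d) b hf.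
  rewrite bnd_simp bnd_simp => /(_ ab bd).
  rewrite Rintegral_itv_obnd_cbnd; last first.
    by apply: integrableS hf => // t; rewrite /= !in_itv /= => /andP[/ltW/(le_trans ab)-> ->].
  by move/eqP; rewrite subr_eq addrC => /eqP.
case: hh => h1 h2; apply: complex_ext; rewrite ?ReD ?ImD; exact: H.
Qed.

End ComplexIntegral.

(** * Cauchy's theorem on rectangles *)

Section RectangleIntegral.
Variable R : realType.
Local Notation C := R[i].
Local Notation mset D := (@measurable _ (measurableTypeR R) D).
Implicit Types (g h : C -> C) (a b c d x y : R).

Definition crect x1 x2 y1 y2 : set C :=
  [set z | x1 <= Re z <= x2 /\ y1 <= Im z <= y2].

Definition orect x1 x2 y1 y2 : set C :=
  [set z | x1 < Re z < x2 /\ y1 < Im z < y2].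

Definition redge x1 x2 y1 y2 : set C := crect x1 x2 y1 y2 `\` orect x1 x2 y1 y2.

Definition hor g y a b : C := cintegral `[a, b] (fun x => g (Complex x y)).
Definition ver g x a b : C := cintegral `[a, b] (fun y => g (Complex x y)).

(** The integral along the boundary, counterclockwise. *)
Definition rectint g x1 x2 y1 y2 : C :=
  hor g y1 x1 x2 - hor g y2 x1 x2
  + Complex 0 1 * (ver g x2 y1 y2 - ver g x1 y1 y2).

Lemma hor_cont g y a : {for Complex a y, continuous g} ->
  {for a, continuous (fun x => g (Complex x y))}.
Proof.
move=> /cont_discP cg; apply/contR_discP => e e0.
have [r r0 hr] := cg _ e0; exists r => // s sr; apply: hr.
rewrite complexB subrr -[Complex _ 0]/((s - a)%:C%C) cmod_real//.
Qed.

Lemma cmod_i : cmod (Complex 0 1 : C) = 1.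
Proof. by rewrite /cmod /= expr0n add0r expr1n sqrtr1. Qed.

Lemma ver_cont g x a : {for Complex x a, continuous g} ->
  {for a, continuous (fun y => g (Complex x y))}.
Proof.
move=> /cont_discP cg; apply/contR_discP => e e0.
have [r r0 hr] := cg _ e0; exists r => // s sr; apply: hr.
rewrite complexB subrr.
have -> : Complex 0 (s - a) = Complex 0 1 * (s - a)%:C%C :> C.
  by apply: complex_ext => /=; ring.
by rewrite cmodM cmod_i mul1r cmod_real.
Qed.

Lemma hor_integ g y a b :
  (forall x, a <= x <= b -> {for Complex x y, continuous g}) ->
  cinteg `[a, b] (fun x => g (Complex x y)).
Proof. by move=> cg; apply: cont_cinteg => t /cg; exact: hor_cont. Qed.

Lemma ver_integ g x a b :
  (forall y, a <= y <= b -> {for Complex x y, continuous g}) ->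
  cinteg `[a, b] (fun y => g (Complex x y)).
Proof. by move=> cg; apply: cont_cinteg => t /cg; exact: ver_cont. Qed.

Lemma hor_cat g y a b d : a <= b -> b <= d ->
  (forall x, a <= x <= d -> {for Complex x y, continuous g}) ->
  hor g y a d = hor g y a b + hor g y b d.
Proof. by move=> ab bd cg; apply: cintegral_cat => //; exact: hor_integ. Qed.

Lemma ver_cat g x a b d : a <= b -> b <= d ->
  (forall y, a <= y <= d -> {for Complex x y, continuous g}) ->
  ver g x a d = ver g x a b + ver g x b d.
Proof. by move=> ab bd cg; apply: cintegral_cat => //; exact: ver_integ. Qed.

Lemma rectint_splitx g x1 m x2 y1 y2 : x1 <= m -> m <= x2 ->
  (forall x, x1 <= x <= x2 -> {for Complex x y1, continuous g}) ->
  (forall x, x1 <= x <= x2 -> {for Complex x y2, continuous g}) ->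
  rectint g x1 x2 y1 y2 = rectint g x1 m y1 y2 + rectint g m x2 y1 y2.
Proof.
move=> h1 h2 c1 c2.
by rewrite /rectint (hor_cat h1 h2 c1) (hor_cat h1 h2 c2); ring.
Qed.

Lemma rectint_splity g x1 x2 y1 m y2 : y1 <= m -> m <= y2 ->
  (forall y, y1 <= y <= y2 -> {for Complex x1 y, continuous g}) ->
  (forall y, y1 <= y <= y2 -> {for Complex x2 y, continuous g}) ->
  rectint g x1 x2 y1 y2 = rectint g x1 x2 y1 m + rectint g x1 x2 m y2.
Proof.
move=> h1 h2 c1 c2.
by rewrite /rectint (ver_cat h1 h2 c1) (ver_cat h1 h2 c2); ring.
Qed.

Section Edges.
Variables (x1 x2 y1 y2 : R).
Hypotheses (hx : x1 <= x2) (hy : y1 <= y2).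
Local Notation E := (redge x1 x2 y1 y2).

Lemma redge_bottom x : x1 <= x <= x2 -> E (Complex x y1).
Proof. by move=> ?; split; [split=> //=; rewrite lexx|case=> _ /=; rewrite ltxx]. Qed.

Lemma redge_top x : x1 <= x <= x2 -> E (Complex x y2).
Proof.
move=> ?; split; [split=> //=; rewrite lexx andbT//|].
by case=> _ /=; rewrite ltxx andbF.
Qed.

Lemma redge_left y : y1 <= y <= y2 -> E (Complex x1 y).
Proof. by move=> ?; split; [split=> //=; rewrite lexx|case=> /=; rewrite ltxx]. Qed.

Lemma redge_right y : y1 <= y <= y2 -> E (Complex x2 y).
Proof.
move=> ?; split; [split=> //=; rewrite lexx andbT//|].
by case=> /=; rewrite ltxx andbF.
Qed.

Lemma edge_integ g : (forall z, E z -> {for z, continuous g}) ->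
  [/\ cinteg `[x1, x2] (fun x => g (Complex x y1)),
    cinteg `[x1, x2] (fun x => g (Complex x y2)),
    cinteg `[y1, y2] (fun y => g (Complex x1 y)) &
    cinteg `[y1, y2] (fun y => g (Complex x2 y))].
Proof.
move=> cg; split.
- by apply: hor_integ => x hx'; apply: cg; exact: redge_bottom.
- by apply: hor_integ => x hx'; apply: cg; exact: redge_top.
- by apply: ver_integ => y hy'; apply: cg; exact: redge_left.
- by apply: ver_integ => y hy'; apply: cg; exact: redge_right.
Qed.

Lemma rectintE g : (forall z, E z -> {for z, continuous g}) ->
  rectint g x1 x2 y1 y2 =
  cintegral `[x1, x2] (fun x => g (Complex x y1) - g (Complex x y2)) +
  Complex 0 1 *
  cintegral `[y1, y2] (fun y => g (Complex x2 y) - g (Complex x1 y)).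
Proof. by move=> /edge_integ[? ? ? ?]; rewrite /rectint !cintegralB. Qed.

Lemma eq_rectint g h : (forall z, E z -> g z = h z) ->
  rectint g x1 x2 y1 y2 = rectint h x1 x2 y1 y2.
Proof.
move=> gh; rewrite /rectint /hor /ver; congr (_ - _ + _ * (_ - _));
  apply: eq_cintegral => t; rewrite /= in_itv /= => ht; apply: gh.
- exact: redge_bottom.
- exact: redge_top.
- exact: redge_right.
- exact: redge_left.
Qed.

Lemma rectintD g h : (forall z, E z -> {for z, continuous g}) ->
  (forall z, E z -> {for z, continuous h}) ->
  rectint (fun z => g z + h z) x1 x2 y1 y2 =
  rectint g x1 x2 y1 y2 + rectint h x1 x2 y1 y2.
Proof.
move=> /edge_integ[? ? ? ?] /edge_integ[? ? ? ?].
by rewrite /rectint /hor /ver !cintegralD//; ring.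
Qed.

Lemma rectintZ (k : C) g : (forall z, E z -> {for z, continuous g}) ->
  rectint (fun z => k * g z) x1 x2 y1 y2 = k * rectint g x1 x2 y1 y2.
Proof.
move=> /edge_integ[? ? ? ?]; rewrite /rectint /hor /ver !cintegralZ//.
by ring.
Qed.

Lemma rectint_bound g (M : R) : (forall z, E z -> {for z, continuous g}) ->
  (forall z, E z -> cmod (g z) <= M) ->
  cmod (rectint g x1 x2 y1 y2) <= 4 * M * ((x2 - x1) + (y2 - y1)).
Proof.
move=> /edge_integ[ib it il ir] gM; rewrite /rectint.
apply: (le_trans (cmodD _ _)); rewrite cmodM cmod_i mul1r.
have := cmodB (hor g y1 x1 x2) (hor g y2 x1 x2).
have := cmodB (ver g x2 y1 y2) (ver g x1 y1 y2).
have := cintegral_itv_bound hx ib (fun t ht => gM _ (redge_bottom ht)).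
have := cintegral_itv_bound hx it (fun t ht => gM _ (redge_top ht)).
have := cintegral_itv_bound hy il (fun t ht => gM _ (redge_left ht)).
have := cintegral_itv_bound hy ir (fun t ht => gM _ (redge_right ht)).
rewrite -!/(hor _ _ _ _) -!/(ver _ _ _ _) mulrDr -!mulrA; lra.
Qed.

Lemma rectint_affine (k l : C) :
  rectint (fun z => k + l * z) x1 x2 y1 y2 = 0.
Proof.
rewrite rectintE; last first.
  move=> z _; apply: contD; first exact: cont_cst.
  by apply: contM; [exact: cont_cst|exact: cont_id].
rewrite (@eq_cintegral _ _ _ (fun=> l * Complex 0 (y1 - y2))); last first.
  move=> x _; rewrite opprD addrACA subrr add0r -mulrBr complexB subrr//.
rewrite [X in _ + _ * X](@eq_cintegral _ _ _ (fun=> l * (x2 - x1)%:C%C)); last first.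
  move=> y _; rewrite opprD addrACA subrr add0r -mulrBr complexB subrr//.
rewrite !cintegral_cst//.
by apply: complex_ext; rewrite /= ?(ReM, ImM, ReD, ImD) /=; ring.
Qed.

End Edges.

Lemma dist_crect x1 x2 y1 y2 z w : crect x1 x2 y1 y2 z -> crect x1 x2 y1 y2 w ->
  cmod (z - w) <= (x2 - x1) + (y2 - y1).
Proof.
case: z => a b; case: w => c d [/= /andP[? ?] /andP[? ?]] [/= /andP[? ?] /andP[? ?]].
apply: (le_trans (cmod_le _)) => /=.
by apply: lerD; rewrite ler_norml; apply/andP; split; lra.
Qed.

(** ** Bisection *)

Ltac conjuncts := repeat match goal with
  | |- and _ _ => split | |- and3 _ _ _ => split | |- and4 _ _ _ _ => split end.

Lemma exp2_gt (L r : R) : 0 < r -> exists n, L / 2 ^+ n < r.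
Proof.
move=> r0; have [n hn] : exists n : nat, `|L| / r < n%:R.
  by exists (Num.bound (`|L| / r)); rewrite archi_boundP// divr_ge0// ltW.
exists n; rewrite ltr_pdivrMr ?exprn_gt0//.
apply: (le_lt_trans (ler_norm L)); move: hn; rewrite ltr_pdivrMr// mulrC => hn.
apply: (lt_le_trans hn); rewrite ler_wpM2l//; first exact: ltW.
by rewrite -natrX ler_nat; apply: ltnW; exact: ltn_expl.
Qed.

(** Otherwise some quarter of the rectangle fails [P], some quarter of that one,
    and so on; these nested rectangles shrink to a point, near which [P] holds. *)
Lemma rect_induction (P : R -> R -> R -> R -> Prop) x1 x2 y1 y2 :
  x1 <= x2 -> y1 <= y2 ->
  (forall a b c d, a <= b -> c <= d -> x1 <= a -> b <= x2 -> y1 <= c -> d <= y2 ->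
    P a ((a + b) / 2) c ((c + d) / 2) -> P ((a + b) / 2) b c ((c + d) / 2) ->
    P a ((a + b) / 2) ((c + d) / 2) d -> P ((a + b) / 2) b ((c + d) / 2) d ->
    P a b c d) ->
  (forall z, crect x1 x2 y1 y2 z -> exists2 r : R, 0 < r &
    forall a b c d, a <= b -> c <= d -> x1 <= a -> b <= x2 -> y1 <= c -> d <= y2 ->
      crect a b c d z -> b - a < r -> d - c < r -> P a b c d) ->
  P x1 x2 y1 y2.
Proof.
move=> hx hy hquarter hlocal; apply: contrapT => nP.
pose inside (s : R * R * (R * R)) :=
  [/\ s.1.1 <= s.1.2, s.2.1 <= s.2.2, x1 <= s.1.1 & s.1.2 <= x2] /\
  (y1 <= s.2.1 /\ s.2.2 <= y2).
pose bad s := inside s /\ ~ P s.1.1 s.1.2 s.2.1 s.2.2.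
pose half (s t : R * R * (R * R)) :=
  [/\ s.1.1 <= t.1.1, t.1.2 <= s.1.2, s.2.1 <= t.2.1 & t.2.2 <= s.2.2] /\
  ((t.1.2 - t.1.1 = (s.1.2 - s.1.1) / 2) /\ (t.2.2 - t.2.1 = (s.2.2 - s.2.1) / 2)).
have step s : exists t, bad s -> bad t /\ half s t.
  case: (pselect (bad s)) => [bs|]; last by exists s.
  case: s bs => -[a b] [c d] [[[/= ab cd xa bx] [yc dy]] nPs].
  have [q1|q1] := pselect (P a ((a + b) / 2) c ((c + d) / 2)); last first.
    exists ((a, (a + b) / 2), (c, (c + d) / 2)) => _.
    by rewrite /bad /half /inside /=; conjuncts=> //; lra.
  have [q2|q2] := pselect (P ((a + b) / 2) b c ((c + d) / 2)); last first.
    exists (((a + b) / 2, b), (c, (c + d) / 2)) => _.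
    by rewrite /bad /half /inside /=; conjuncts=> //; lra.
  have [q3|q3] := pselect (P a ((a + b) / 2) ((c + d) / 2) d); last first.
    exists ((a, (a + b) / 2), ((c + d) / 2, d)) => _.
    by rewrite /bad /half /inside /=; conjuncts=> //; lra.
  have [q4|q4] := pselect (P ((a + b) / 2) b ((c + d) / 2) d); last first.
    exists (((a + b) / 2, b), ((c + d) / 2, d)) => _.
    by rewrite /bad /half /inside /=; conjuncts=> //; lra.
  by exfalso; apply: nPs; exact: hquarter.
have [next hnext] := choice step.
pose S n := iter n next ((x1, x2), (y1, y2)).
have badS n : bad (S n).
  by elim: n => [|n IH]; [split=> //; split=> //=; split|have [] := hnext _ IH].
have halfS n : half (S n) (S n.+1) by have [] := hnext _ (badS n).
have width n : (S n).1.2 - (S n).1.1 = (x2 - x1) / 2 ^+ n /\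
               (S n).2.2 - (S n).2.1 = (y2 - y1) / 2 ^+ n.
  elim: n => [|n [IH1 IH2]]; first by rewrite expr0 !divr1.
  have [_ [-> ->]] := halfS n; rewrite IH1 IH2 exprS.
  by split; field; rewrite expf_neq0.
have mono n k : [/\ (S n).1.1 <= (S (n + k)%N).1.1, (S (n + k)%N).1.2 <= (S n).1.2,
    (S n).2.1 <= (S (n + k)%N).2.1 & (S (n + k)%N).2.2 <= (S n).2.2].
  elim: k => [|k [i1 i2 i3 i4]]; first by rewrite addn0.
  have [[j1 j2 j3 j4] _] := halfS (n + k)%N; rewrite addnS.
  by split; [exact: le_trans j1|exact: le_trans i2|exact: le_trans j3|exact: le_trans i4].
have order n : (S n).1.1 <= (S n).1.2 /\ (S n).2.1 <= (S n).2.2.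
  by have [[[? ? _ _] _] _] := badS n.
have cross n m : (S n).1.1 <= (S m).1.2 /\ (S n).2.1 <= (S m).2.2.
  have [i1 _ i3 _] := mono n m; have [_ j2 _ j4] := mono m n.
  have [u1 u2] := order (n + m)%N; rewrite addnC in j2 j4.
  by split; [apply: (le_trans i1); apply: le_trans j2
            |apply: (le_trans i3); apply: le_trans j4].
pose A := range (fun n => (S n).1.1); pose B := range (fun n => (S n).2.1).
have supA m : (S m).1.1 <= sup A <= (S m).1.2.
  apply/andP; split.
    apply: sup_upper_bound; last by exists m.
    split; first by exists (S 0%N).1.1, 0%N.
    by exists (S 0%N).1.2 => _ [n _ <-]; case: (cross n 0%N).
  apply: ge_sup; first by exists (S 0%N).1.1, 0%N.
  by move=> _ [n _ <-]; case: (cross n m).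
have supB m : (S m).2.1 <= sup B <= (S m).2.2.
  apply/andP; split.
    apply: sup_upper_bound; last by exists m.
    split; first by exists (S 0%N).2.1, 0%N.
    by exists (S 0%N).2.2 => _ [n _ <-]; case: (cross n 0%N).
  apply: ge_sup; first by exists (S 0%N).2.1, 0%N.
  by move=> _ [n _ <-]; case: (cross n m).
have [r r0 hr] := hlocal (Complex (sup A) (sup B)) (conj (supA 0%N) (supB 0%N)).
have [n1 hn1] := exp2_gt (x2 - x1) r0; have [n2 hn2] := exp2_gt (y2 - y1) r0.
pose n := (n1 + n2)%N.
have small (L : R) p q : 0 <= L -> L / 2 ^+ p < r -> L / 2 ^+ (p + q) < r.
  move=> L0; apply: le_lt_trans; rewrite ler_wpM2l// lef_pV2 ?posrE ?exprn_gt0//.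
  by rewrite ler_eXn2l ?ltr1n// leq_addr.
have [[[ab cd xa bx] [yc dy]] nPn] := badS n; apply: nPn.
have [w1 w2] := width n.
apply: (hr _ _ _ _ ab cd xa bx yc dy (conj (supA n) (supB n))).
  by rewrite w1; apply: small => //; rewrite subr_ge0.
by rewrite w2 /n addnC; apply: small => //; rewrite subr_ge0.
Qed.

End RectangleIntegral.

Section Cauchy.
Variable R : realType.
Local Notation C := R[i].
Local Notation mu := (@lebesgue_measure R).
Implicit Types (g h : C -> C) (z w : C).

Lemma le0_eps (x K : R) : 0 <= K -> (forall e, 0 < e -> x <= e * K) -> x <= 0.
Proof.
move=> K0 h; rewrite leNgt; apply/negP => x0.
have K1 : 0 < K + 1 by lra.
have := h (x / (K + 1)) (divr_gt0 x0 K1).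
rewrite mulrAC ler_pdivlMr// ler_pM2l//; lra.
Qed.

Lemma mid_between (a b : R) : a <= b -> a <= (a + b) / 2 /\ (a + b) / 2 <= b.
Proof. by move=> ab; split; lra. Qed.

(** By bisection, the integral over [[a, b] x [c, d]] is at most
    [e * ((b - a) + (d - c)) ^+ 2] for every [e > 0].  Four quarters satisfying
    this bound give it for the whole, and near each point the affine part of [g]
    integrates to zero while the remainder is small compared with the diameter. *)
Lemma goursat g x1 x2 y1 y2 : x1 <= x2 -> y1 <= y2 ->
  (forall z, crect x1 x2 y1 y2 z -> exists d, cder g z d) ->
  rectint g x1 x2 y1 y2 = 0.
Proof.
move=> hx hy hg.
have cg z : crect x1 x2 y1 y2 z -> {for z, continuous g}.
  by move=> /hg[d /cder_cont].
apply/eqP; rewrite -cmod_eq0 eq_le cmod_ge0 andbT; apply/eqP/eqP.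
apply: (@le0_eps _ (((x2 - x1) + (y2 - y1)) ^+ 2)); first exact: sqr_ge0.
move=> e e0.
pose P a b c d := cmod (rectint g a b c d) <= e * ((b - a) + (d - c)) ^+ 2.
apply: (@rect_induction _ P) => //; rewrite {}/P.
- move=> a b c d ab cd xa bx yc dy.
  have [h1 h2] := mid_between ab; have [h3 h4] := mid_between cd.
  have cgr x y : a <= x <= b -> c <= y <= d -> {for Complex x y, continuous g}.
    move=> /andP[? ?] /andP[? ?]; apply: cg.
    by split; apply/andP; split; apply: le_trans; eassumption.
  move=> q1 q2 q3 q4.
  rewrite (rectint_splitx h1 h2); last first.
  + by move=> x hx'; apply: cgr => //; rewrite lexx cd.
  + by move=> x hx'; apply: cgr => //; rewrite lexx cd.
  rewrite (rectint_splity h3 h4); last first.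
  + by move=> y hy'; apply: cgr => //; rewrite h1 h2.
  + by move=> y hy'; apply: cgr => //; rewrite lexx ab.
  rewrite [X in _ + X](rectint_splity h3 h4); last first.
  + by move=> y hy'; apply: cgr => //; rewrite lexx ab.
  + by move=> y hy'; apply: cgr => //; rewrite h1 h2.
  apply: (le_trans (cmodD _ _)); apply: (le_trans (lerD (cmodD _ _) (cmodD _ _))).
  have /le_trans := lerD (lerD q1 q3) (lerD q2 q4); apply.
  by rewrite le_eqVlt; apply/orP; left; apply/eqP; field.
- move=> z hz; have [d hd] := hg z hz.
  have [r r0 hr] := (cderP _ _ _).1 hd (e / 4) (divr_gt0 e0 (ltr0n R 4)).
  exists (r / 2); first by rewrite divr_gt0.
  move=> a b c k ab ck xa bx yc ky zr br kr.
  pose err w := g w - ((g z - d * z) + d * w).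
  have sub w : crect a b c k w -> crect x1 x2 y1 y2 w.
    by case=> /andP[? ?] /andP[? ?]; split; apply/andP; split; lra.
  have sube w : redge a b c k w -> crect x1 x2 y1 y2 w by case=> /sub.
  have caff w : {for w, continuous (fun w => (g z - d * z) + d * w)}.
    apply: contD; first exact: cont_cst.
    by apply: contM; [exact: cont_cst|exact: cont_id].
  have cerr w : redge a b c k w -> {for w, continuous err}.
    by move=> hw; apply: contB; [apply: cg; exact: sube|exact: caff].
  have -> : rectint g a b c k = rectint err a b c k.
    have := rectintD ab ck cerr (fun w _ => caff w).
    rewrite rectint_affine// addr0 => <-.
    by apply: eq_rectint => [//|//|w _]; rewrite /err; ring.
  set L := (b - a) + (k - c).
  have L0 : 0 <= L by rewrite /L; lra.
  apply: (le_trans (@rectint_bound _ _ _ _ _ ab ck err (e / 4 * L) cerr _)).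
    move=> w [hw _]; have wL := dist_crect hw zr.
    have wr : cmod (w - z) < r by apply: (le_lt_trans wL); rewrite /L; lra.
    have -> : err w = g w - g z - d * (w - z) by rewrite /err; ring.
    by apply: (le_trans (hr _ wr)); rewrite ler_wpM2l//; lra.
  by rewrite -/L le_eqVlt; apply/orP; left; apply/eqP; field.
Qed.

(** The region between the two boundaries is cut into four rectangles, to each
    of which Goursat's theorem applies. *)
Lemma rectint_annulus g x1 a1 a2 x2 y1 b1 b2 y2 :
  x1 <= a1 -> a1 <= a2 -> a2 <= x2 -> y1 <= b1 -> b1 <= b2 -> b2 <= y2 ->
  (forall z, crect x1 x2 y1 y2 z -> ~ orect a1 a2 b1 b2 z ->
     exists d, cder g z d) ->
  rectint g x1 x2 y1 y2 = rectint g a1 a2 b1 b2.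
Proof.
move=> h1 h2 h3 h4 h5 h6 hg.
have cg z : crect x1 x2 y1 y2 z -> ~ orect a1 a2 b1 b2 z ->
    {for z, continuous g}.
  by move=> hz /(hg _ hz)[d /cder_cont].
have cv x y : x1 <= x <= x2 -> y1 <= y <= y2 -> (x <= a1) || (a2 <= x) ->
    {for Complex x y, continuous g}.
  move=> hx hy /orP hh; apply: cg; first by split.
  by case=> /= /andP[? ?] _; case: hh => ?; lra.
have ch x y : x1 <= x <= x2 -> y1 <= y <= y2 -> (y <= b1) || (b2 <= y) ->
    {for Complex x y, continuous g}.
  move=> hx hy /orP hh; apply: cg; first by split.
  by case=> /= _ /andP[? ?]; case: hh => ?; lra.
have z1 : rectint g x1 a1 y1 y2 = 0.
  apply: goursat; [lra|lra|case=> x y [/= /andP[? ?] /andP[? ?]]].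
  apply: hg; first by split=> /=; lra.
  by case=> /= /andP[? ?] _; lra.
have z2 : rectint g a2 x2 y1 y2 = 0.
  apply: goursat; [lra|lra|case=> x y [/= /andP[? ?] /andP[? ?]]].
  apply: hg; first by split=> /=; lra.
  by case=> /= /andP[? ?] _; lra.
have z3 : rectint g a1 a2 y1 b1 = 0.
  apply: goursat; [lra|lra|case=> x y [/= /andP[? ?] /andP[? ?]]].
  apply: hg; first by split=> /=; lra.
  by case=> /= _ /andP[? ?]; lra.
have z4 : rectint g a1 a2 b2 y2 = 0.
  apply: goursat; [lra|lra|case=> x y [/= /andP[? ?] /andP[? ?]]].
  apply: hg; first by split=> /=; lra.
  by case=> /= _ /andP[? ?]; lra.
rewrite (@rectint_splitx _ _ _ a1)//; first last.
- by move=> x /andP[? ?]; apply: ch; lra.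
- by move=> x /andP[? ?]; apply: ch; lra.
- lra.
rewrite z1 add0r (@rectint_splitx _ _ _ a2)//; first last.
- by move=> x /andP[? ?]; apply: ch; lra.
- by move=> x /andP[? ?]; apply: ch; lra.
rewrite z2 addr0 (@rectint_splity _ _ _ _ _ b1)//; first last.
- by move=> x /andP[? ?]; apply: cv; lra.
- by move=> x /andP[? ?]; apply: cv; lra.
- lra.
rewrite z3 add0r (@rectint_splity _ _ _ _ _ b2)//; first last.
- by move=> x /andP[? ?]; apply: cv; lra.
- by move=> x /andP[? ?]; apply: cv; lra.
by rewrite z4 addr0.
Qed.

End Cauchy.

Section Exceptional.
Variable R : realType.
Local Notation C := R[i].
Local Notation mu := (@lebesgue_measure R).
Implicit Types (g h : C -> C) (z w : C).

Definition square w (s : R) : set C :=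
  crect (Re w - s) (Re w + s) (Im w - s) (Im w + s).

Lemma square_in_orect w x1 x2 y1 y2 : orect x1 x2 y1 y2 w ->
  exists2 s0 : R, 0 < s0 & forall s, s <= s0 ->
  [/\ x1 <= Re w - s, Re w + s <= x2,
    y1 <= Im w - s & Im w + s <= y2].
Proof.
case=> /andP[? ?] /andP[? ?].
exists (Num.min (Num.min (Re w - x1) (x2 - Re w))
                (Num.min (Im w - y1) (y2 - Im w))).
  by rewrite !lt_min !subr_gt0; apply/andP; split; apply/andP; split.
move=> s; rewrite !le_min => /andP[/andP[? ?] /andP[? ?]].
by split; lra.
Qed.

Lemma orect_square w (s : R) : 0 < s ->
  orect (Re w - s) (Re w + s) (Im w - s) (Im w + s) w.
Proof. by move=> s0; split; apply/andP; split; lra. Qed.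

Lemma disc_orect w (s : R) z : disc w s z ->
  orect (Re w - s) (Re w + s) (Im w - s) (Im w + s) z.
Proof.
move=> zs; have h1 := le_lt_trans (cmod_Re _) zs; have h2 := le_lt_trans (cmod_Im _) zs.
move: h1 h2; rewrite ReD ImD ReN ImN !ltr_norml => /andP[? ?] /andP[? ?].
by split; apply/andP; split; lra.
Qed.

Lemma square_disc w (s : R) z : square w s z -> cmod (z - w) <= 2 * s.
Proof.
case: z w => a b [c d] [/= /andP[? ?] /andP[? ?]].
apply: (le_trans (cmod_le _)) => /=.
rewrite mulr_natl mulr2n.
by apply: lerD; rewrite ler_norml; apply/andP; split; lra.
Qed.

(** A point where the integrand is merely bounded is harmless: the integral may
    be taken over arbitrarily small squares about it. *)
Lemma goursat_except g x1 x2 y1 y2 w : orect x1 x2 y1 y2 w ->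
  (forall z, crect x1 x2 y1 y2 z -> z != w -> exists d, cder g z d) ->
  (exists2 r : R, 0 < r & exists M : R, forall z, z != w -> cmod (z - w) < r ->
     cmod (g z) <= M) ->
  rectint g x1 x2 y1 y2 = 0.
Proof.
move=> hw hg [r r0 [M hM]].
have [s0 s00 hs0] := square_in_orect hw.
apply/eqP; rewrite -cmod_eq0 eq_le cmod_ge0 andbT; apply/eqP/eqP.
apply: (@le0_eps _ _ (16 * `|M|)); first by rewrite mulr_ge0.
move=> e e0.
pose s := Num.min e (Num.min s0 (r / 4)).
have [s_gt0 s_e s_s0 s_r] : [/\ 0 < s, s <= e, s <= s0 & s <= r / 4].
  split; first by rewrite !lt_min e0 s00 divr_gt0.
  - by rewrite ge_min lexx.
  - by rewrite !ge_min lexx orbT.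
  - by rewrite !ge_min lexx !orbT.
have [i1 i2 i3 i4] := hs0 _ s_s0.
have o_ne z : ~ orect (Re w - s) (Re w + s)
    (Im w - s) (Im w + s) z -> z != w.
  by apply: contra_not_neq => ->; exact: orect_square.
have sub z : square w s z -> crect x1 x2 y1 y2 z.
  by case=> /andP[? ?] /andP[? ?]; split; apply/andP; split; lra.
rewrite (@rectint_annulus _ g _ (Re w - s) (Re w + s) _ _
  (Im w - s) (Im w + s))//; [|lra|lra|]; last first.
  by move=> z hz /o_ne; exact: hg.
apply: (le_trans (@rectint_bound _ (Re w - s) (Re w + s)
  (Im w - s) (Im w + s) _ _ g M _ _)).
- lra.
- lra.
- by move=> z [hz /o_ne zw]; have [d /cder_cont] := hg _ (sub _ hz) zw.
- move=> z [hz /o_ne zw]; apply: hM => //.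
  by apply: (le_lt_trans (square_disc hz)); lra.
- apply: (@le_trans _ _ (4 * `|M| * (4 * s))).
    have -> : Re w + s - (Re w - s) +
      (Im w + s - (Im w - s)) = 4 * s by ring.
    by rewrite ler_pM2r ?mulr_gt0// ler_pM2l// ler_norm.
  rewrite (_ : 4 * `|M| * (4 * s) = s * (16 * `|M|)); last by ring.
  by rewrite ler_wpM2r// mulr_ge0.
Qed.

(** A primitive is [2 * atan ((x - c) / s)], whose arctangent goes from [- pi / 4]
    to [pi / 4]. *)
Lemma atan_integral (c s : R) : 0 < s ->
  \int[mu]_(x in `[c - s, c + s]) (2 * s / (s ^+ 2 + (x - c) ^+ 2)) = pi.
Proof.
move=> s0.
pose F (x : R) := 2 * atan (s^-1 * (x - c)).
have den (x : R) : s ^+ 2 + (x - c) ^+ 2 != 0.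
  by rewrite gt_eqF// ltr_pwDl ?exprn_gt0// sqr_ge0.
have dF (x : R) : is_derive x 1 F (2 * s / (s ^+ 2 + (x - c) ^+ 2)).
  have h1 : is_derive x 1 (fun x : R => s^-1 * (x - c)) s^-1.
    apply: (is_derive_eq (is_deriveZ s^-1 (is_derive_shift x 1 (- c)))).
    by rewrite [_ *: _]mulr1.
  have h2 := is_deriveZ 2 (is_derive1_comp (is_derive1_atan _) h1).
  apply: (is_derive_eq h2); rewrite /GRing.scale /=.
  have s0' : s != 0 by rewrite gt_eqF.
  have -> : 1 + (s^-1 * (x - c)) ^+ 2 = (s ^+ 2 + (x - c) ^+ 2) / s ^+ 2 by field.
  by field; rewrite s0' den.
rewrite /Rintegral (@continuous_FTC2 _ _ F).
- rewrite /= /F addrAC subrr add0r [c - s - c]addrAC subrr add0r mulrN mulVf ?gt_eqF//.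
  by rewrite atanN atan1; field.
- lra.
- apply: continuous_subspaceT => x.
  apply: cvgM; first exact: cvg_cst.
  apply: cvgV; first exact: den.
  apply: cvgD; first exact: cvg_cst.
  have h : (fun x : R => x - c) @ x --> x - c.
    by apply: cvgB; [exact: cvg_id|exact: cvg_cst].
  exact: (cvgM h h).
- have cF (x : R) : {for x, continuous F}.
    by apply: differentiable_continuous; apply/derivable1_diffP; have [] := dF x.
  split.
  + by move=> x _; have [] := dF x.
  + exact/cvg_at_right_filter/cF.
  + exact/cvg_at_left_filter/cF.
- by move=> x _; rewrite derive1E; have [_ ->] := dF x.
Qed.

End Exceptional.

(** * Cauchy's formula and its consequences *)

Section CauchyFormula.
Variable R : realType.
Local Notation C := R[i].
Local Notation mu := (@lebesgue_measure R).
Implicit Types (g h : C -> C) (z w : C).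

Definition twopii : C := Complex 0 (2 * pi).

Lemma twopii_neq0 : twopii != 0.
Proof. by rewrite eq_complex /= eqxx /= mulf_neq0// gt_eqF// pi_gt0. Qed.

Lemma cintegral_im (D : set R) (phi : R -> R) :
  cintegral D (fun t => Complex 0 (phi t)) = Complex 0 (\int[mu]_(t in D) phi t).
Proof. by apply: complex_ext; rewrite //= /Rintegral integral0. Qed.

Lemma cintegral_re (D : set R) (phi : R -> R) :
  cintegral D (fun t => Complex (phi t) 0) = Complex (\int[mu]_(t in D) phi t) 0.
Proof. by apply: complex_ext; rewrite //= /Rintegral integral0. Qed.

Lemma cont_subV (A : set C) w : ~ A w ->
  forall z, A z -> {for z, continuous (fun z => (z - w)^-1)}.
Proof.
move=> Aw z Az; apply: contV.
  by rewrite subr_eq0; apply: contra_notN Aw => /eqP <-.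
by apply: contB; [exact: cont_id|exact: cont_cst].
Qed.

Lemma cont_subXV (A : set C) w n : ~ A w ->
  forall z, A z -> {for z, continuous (fun z => (z - w)^-n)}.
Proof.
move=> Aw z Az; apply: contV.
  by rewrite expf_neq0// subr_eq0; apply: contra_notN Aw => /eqP <-.
by apply: contX; apply: contB; [exact: cont_id|exact: cont_cst].
Qed.

Lemma redge_orect x1 x2 y1 y2 w : orect x1 x2 y1 y2 w -> ~ redge x1 x2 y1 y2 w.
Proof. by move=> ? []. Qed.

Lemma orect_crect (x1 x2 y1 y2 : R) w : orect x1 x2 y1 y2 w -> crect x1 x2 y1 y2 w.
Proof. by case=> /andP[? ?] /andP[? ?]; split; apply/andP; split; exact: ltW. Qed.

Lemma orect_le (x1 x2 y1 y2 : R) w : orect x1 x2 y1 y2 w -> x1 <= x2 /\ y1 <= y2.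
Proof.
case=> /andP[? ?] /andP[? ?].
by split; apply: ltW; apply: lt_trans; eassumption.
Qed.

Lemma cder_inv_sub z w : z != w ->
  cder (fun z => (z - w)^-1) z (- (z - w)^-2).
Proof.
move=> zw; have := cderV (g := fun z => z - w) _ (cder_sub w z).
by rewrite mulN1r subr_eq0; apply.
Qed.

(** The annulus argument reduces to a square centred at [w], where opposite
    sides combine into twice the derivative of an arctangent. *)
Lemma rectint_inv x1 x2 y1 y2 w : orect x1 x2 y1 y2 w ->
  rectint (fun z => (z - w)^-1) x1 x2 y1 y2 = twopii.
Proof.
move=> hw; have [s s0 hs] := square_in_orect hw.
have [i1 i2 i3 i4] := hs s (lexx s).
have os := orect_square w s0.
have [le1 le2] := orect_le os.
have [l1 l2] : Re w - s <= Re w /\ Re w <= Re w + s.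
  by split; lra.
rewrite (rectint_annulus i1 le1 i2 i3 le2 i4); last first.
  move=> z _ no; eexists; apply: cder_inv_sub.
  by apply: contra_not_neq no => ->.
rewrite (rectintE le1 le2); last by apply: cont_subV; exact: redge_orect.
have den (t c : R) : s ^+ 2 + (t - c) ^+ 2 != 0.
  by rewrite gt_eqF// ltr_pwDl ?exprn_gt0// sqr_ge0.
rewrite (@eq_cintegral _ _ _ (fun x => Complex 0
    (2 * s / (s ^+ 2 + (x - Re w) ^+ 2)))); last first.
  move=> x _; case: w {hw hs i1 i2 i3 i4 os le1 le2 l1 l2} => u v /=.
  have dd := den x u.
  have dd' : (x - u) ^+ 2 + s ^+ 2 != 0 by rewrite addrC.
  have e1 : v - s - v = - s by ring.
  have e2 : v + s - v = s by ring.
  by apply: complex_ext => /=; rewrite e1 e2; field; rewrite ?dd ?dd'.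
rewrite [X in _ + _ * X](@eq_cintegral _ _ _ (fun y => Complex
    (2 * s / (s ^+ 2 + (y - Im w) ^+ 2)) 0)); last first.
  move=> y _; case: w {hw hs i1 i2 i3 i4 os le1 le2 l1 l2} => u v /=.
  have dd := den y v.
  have e1 : u - s - u = - s by ring.
  have e2 : u + s - u = s by ring.
  by apply: complex_ext => /=; rewrite e1 e2; field; rewrite ?sqrrN dd.
rewrite cintegral_im cintegral_re !atan_integral//.
by apply: complex_ext => /=; ring.
Qed.

(** The difference quotient of [g] at [w] is bounded near [w], so its integral
    vanishes by Goursat's theorem with an exceptional point. *)
Lemma cauchy_formula g x1 x2 y1 y2 w : orect x1 x2 y1 y2 w ->
  (forall z, crect x1 x2 y1 y2 z -> exists d, cder g z d) ->
  rectint (fun z => g z * (z - w)^-1) x1 x2 y1 y2 = twopii * g w.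
Proof.
move=> hw hg; have [le1 le2] := orect_le hw.
have cg z : crect x1 x2 y1 y2 z -> {for z, continuous g}.
  by move=> /hg[d /cder_cont].
pose q z := (g z - g w) * (z - w)^-1.
have ne z : redge x1 x2 y1 y2 z -> z - w != 0.
  by case=> _ h; rewrite subr_eq0; apply: contra_not_neq h => ->.
have cinv : forall z, redge x1 x2 y1 y2 z -> {for z, continuous (fun z => (z - w)^-1)}.
  by apply: cont_subV; exact: redge_orect.
have cq z : redge x1 x2 y1 y2 z -> {for z, continuous q}.
  move=> hz; apply: contM; last exact: cinv.
  by apply: contB; [apply: cg; case: hz|exact: cont_cst].
have q0 : rectint q x1 x2 y1 y2 = 0.
  apply: (goursat_except hw).
    move=> z hz zw; have [d hd] := hg z hz.
    eexists; apply: cderM; last exact: (cder_inv_sub zw).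
    by apply: cderB; [exact: hd|exact: cder_cst].
  have [d /cder_slope/cvg_dnbhs_discP/(_ 1 ltr01)[r r0 hr]] := hg w (orect_crect hw).
  exists r => //; exists (cmod d + 1) => z zw /(hr _ zw) h.
  rewrite -lerBlDl; apply/ltW; apply: le_lt_trans h; exact: cmod_lower.
have -> : rectint (fun z => g z * (z - w)^-1) x1 x2 y1 y2 =
    rectint (fun z => q z + g w * (z - w)^-1) x1 x2 y1 y2.
  by apply: eq_rectint => [//|//|z _]; rewrite /q; ring.
have cinv' z : redge x1 x2 y1 y2 z -> {for z, continuous (fun z => g w * (z - w)^-1)}.
  by move=> hz; apply: contM; [exact: cont_cst|exact: cinv].
rewrite (rectintD le1 le2 cq cinv') q0 add0r (rectintZ le1 le2 (g w) cinv).
by rewrite rectint_inv// mulrC.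
Qed.

(** Differentiation under a linear functional: an integral of any kind, over a
    curve or over a whole family of curves, that is bounded by a constant times
    the supremum of its argument. *)
Lemma cder_functional (T : Type) (adm : (T -> C) -> Prop) (Lam : (T -> C) -> C)
    (S : set T) (K : R) (h : C -> T -> C) (h' : T -> C) z (r B : R) :
  0 < r -> 0 <= K -> 0 <= B ->
  (forall a b k l, adm k -> adm l -> adm (fun t => a * k t + b * l t) /\
     Lam (fun t => a * k t + b * l t) = a * Lam k + b * Lam l) ->
  (forall k M, 0 <= M -> adm k -> (forall t, S t -> cmod (k t) <= M) ->
     cmod (Lam k) <= K * M) ->
  (forall w, cmod (w - z) < r -> adm (h w)) -> adm h' ->
  (forall w t, cmod (w - z) < r -> S t ->
     cmod (h w t - h z t - (w - z) * h' t) <= B * cmod (w - z) ^+ 2) ->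
  cder (fun w => Lam (h w)) z (Lam h').
Proof.
move=> r0 K0 B0 lin bnd ah ah' hB; apply/cderP => e e0.
have KB : 0 < K * B + 1 by rewrite ltr_wpDl// mulr_ge0.
exists (Num.min r (e / (K * B + 1))); first by rewrite lt_min r0 divr_gt0.
move=> w; rewrite lt_min => /andP[wr we].
have az : adm (h z) by apply: ah; rewrite subrr cmod0.
have [a1 e1] := lin 1 (-1) _ _ (ah _ wr) az.
have [a2 e2] := lin 1 (- (w - z)) _ _ a1 ah'.
have -> : Lam (h w) - Lam (h z) - Lam h' * (w - z) =
    Lam (fun t => 1 * (1 * h w t + -1 * h z t) + - (w - z) * h' t).
  by rewrite e2 e1; ring.
have hM t : S t -> cmod (1 * (1 * h w t + -1 * h z t) + - (w - z) * h' t) <=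
    B * cmod (w - z) ^+ 2.
  move=> St; have := hB w t wr St; congr (cmod _ <= _); ring.
have M0 : 0 <= B * cmod (w - z) ^+ 2 by rewrite mulr_ge0// sqr_ge0.
apply: (le_trans (bnd _ _ M0 a2 hM)).
rewrite expr2 !mulrA ler_wpM2r ?cmod_ge0//.
move: we; rewrite ltr_pdivlMr// => /ltW; apply: le_trans.
by rewrite mulrC ler_wpM2l ?cmod_ge0// lerDl.
Qed.

Lemma inv_far (u : C) (p : R) : 0 < p -> p <= cmod u -> cmod u^-1 <= p^-1.
Proof.
by move=> p0 pu; rewrite cmodV lef_pV2// posrE// (lt_le_trans p0 pu).
Qed.

Lemma far_neq0 (u : C) (p : R) : 0 < p -> p <= cmod u -> u != 0.
Proof. by move=> p0 pu; rewrite -cmod_gt0; exact: lt_le_trans pu. Qed.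

Lemma inv_expansion (t z w : C) (p : R) : 0 < p -> p <= cmod (t - z) ->
  cmod (w - z) < p / 2 ->
  cmod ((t - w)^-1 - (t - z)^-1 - (w - z) * (t - z)^-2) <=
    2 / p ^+ 3 * cmod (w - z) ^+ 2.
Proof.
move=> p0 pz wz.
have p2 : 0 < p / 2 by rewrite divr_gt0.
have pw : p / 2 <= cmod (t - w).
  by have := cmod_triangle w t z; lra.
have nz := far_neq0 p0 pz; have nw := far_neq0 p2 pw.
have -> : (t - w)^-1 - (t - z)^-1 - (w - z) * (t - z)^-2 =
    (t - w)^-1 * (t - z)^-1 * (t - z)^-1 * (w - z) ^+ 2.
  by field; rewrite nz nw.
rewrite cmodM cmodX ler_wpM2r ?sqr_ge0// !cmodM.
have i1 := inv_far p0 pz; have i2 := inv_far p2 pw.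
have -> : 2 / p ^+ 3 = (p / 2)^-1 * p^-1 * p^-1 by field; rewrite gt_eqF.
apply: ler_pM => //; rewrite ?mulr_ge0 ?cmod_ge0//.
by apply: ler_pM; rewrite ?cmod_ge0.
Qed.

Lemma sqr_inv_expansion (t z w : C) (p : R) : 0 < p -> p <= cmod (t - z) ->
  cmod (w - z) < p / 2 ->
  cmod ((t - w)^-2 - (t - z)^-2 - (w - z) * (2 * (t - z)^-3)) <=
    8 / p ^+ 4 * cmod (w - z) ^+ 2.
Proof.
move=> p0 pz wz.
have p2 : 0 < p / 2 by rewrite divr_gt0.
have pw : p / 2 <= cmod (t - w).
  by have := cmod_triangle w t z; lra.
have nz := far_neq0 p0 pz; have nw := far_neq0 p2 pw.
have -> : (t - w)^-2 - (t - z)^-2 - (w - z) * (2 * (t - z)^-3) =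
    (t - z)^-1 * (t - z)^-1 * (t - w)^-1 * ((t - w)^-1 + 2 * (t - z)^-1)
     * (w - z) ^+ 2.
  by field; rewrite nz nw.
rewrite cmodM cmodX ler_wpM2r ?sqr_ge0// !cmodM.
have i1 := inv_far p0 pz; have i2 := inv_far p2 pw.
have -> : 8 / p ^+ 4 = p^-1 * p^-1 * (p / 2)^-1 * (2 * p^-1 + 2 * p^-1).
  by field; rewrite gt_eqF.
have j : cmod ((t - w)^-1 + 2 * (t - z)^-1) <= 2 * p^-1 + 2 * p^-1.
  apply: (le_trans (cmodD _ _)); rewrite cmodM.
  have -> : cmod (2 : C) = 2.
    by rewrite -(rmorph_nat (real_complex R)) cmod_real normr_nat.
  have e : (p / 2)^-1 = 2 * p^-1 by field; rewrite gt_eqF.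
  by apply: lerD; [rewrite -e|rewrite ler_pM2l].
apply: ler_pM => //; rewrite ?mulr_ge0 ?cmod_ge0//.
apply: ler_pM => //; rewrite ?mulr_ge0 ?cmod_ge0//.
by apply: ler_pM; rewrite ?cmod_ge0.
Qed.

End CauchyFormula.

Arguments twopii {R}.
Arguments twopii_neq0 {R}.


Section Consequences.
Variable R : realType.
Local Notation C := R[i].
Implicit Types (g h k : C -> C) (z w : C).

(** Compactness of the rectangle, by bisection. *)
Lemma bounded_rect g (x1 x2 y1 y2 : R) : x1 <= x2 -> y1 <= y2 ->
  (forall z, crect x1 x2 y1 y2 z -> {for z, continuous g}) ->
  exists2 M : R, 0 <= M & forall z, crect x1 x2 y1 y2 z -> cmod (g z) <= M.
Proof.
move=> hx hy cg.
suff [M hM] : exists M : R, forall z, crect x1 x2 y1 y2 z -> cmod (g z) <= M.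
  exists `|M|; first exact: normr_ge0.
  by move=> z /hM /le_trans; apply; exact: ler_norm.
apply: (@rect_induction _ (fun a b c d => exists M : R, forall z,
  crect a b c d z -> cmod (g z) <= M)) => //.
- move=> a b c d _ _ _ _ _ _ [M1 h1] [M2 h2] [M3 h3] [M4 h4].
  exists (Num.max (Num.max M1 M2) (Num.max M3 M4)) => z [/andP[za zb] /andP[zc zd]].
  rewrite !le_max.
  case: (leP (Re z) ((a + b) / 2)) => [l1|/ltW l1];
    case: (leP (Im z) ((c + d) / 2)) => [l2|/ltW l2].
  + by rewrite h1//; split; apply/andP; split.
  + by rewrite (h3 z) ?orbT//; split; apply/andP; split.
  + by rewrite (h2 z) ?orbT//; split; apply/andP; split.
  + by rewrite (h4 z) ?orbT//; split; apply/andP; split.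
- move=> z hz; have [r r0 hr] := cont_bounded (cg z hz).
  exists (r / 2); first by rewrite divr_gt0.
  move=> a b c d _ _ _ _ _ _ zr ba dc; exists (cmod (g z) + 1) => w wr.
  by apply: hr; apply: (le_lt_trans (dist_crect wr zr)); lra.
Qed.

Lemma redge_far (x1 x2 y1 y2 : R) w : orect x1 x2 y1 y2 w ->
  exists2 p : R, 0 < p & forall t, redge x1 x2 y1 y2 t -> p <= cmod (t - w).
Proof.
move=> hw; have [s s0 hs] := square_in_orect hw; exists s => // t [_ no].
have [i1 i2 i3 i4] := hs s (lexx s).
rewrite leNgt; apply/negP => tw; apply: no.
have [/andP[? ?] /andP[? ?]] := disc_orect tw.
by split; apply/andP; split; lra.
Qed.

Section EdgeCauchy.
Variables (x1 x2 y1 y2 M : R) (k : C -> C).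
Hypothesis ck : forall z, redge x1 x2 y1 y2 z -> {for z, continuous k}.
Hypothesis kM : forall z, redge x1 x2 y1 y2 z -> cmod (k z) <= M.

Let adm (phi : C -> C) := forall z, redge x1 x2 y1 y2 z -> {for z, continuous phi}.

(** Differentiation under the integral over the boundary, with density [k]. *)
Lemma edge_functional (h : C -> C -> C) (h' : C -> C) w (r B : R) :
  orect x1 x2 y1 y2 w -> 0 < r -> 0 <= B ->
  (forall v, cmod (v - w) < r -> adm (h v)) -> adm h' ->
  (forall v t, cmod (v - w) < r -> redge x1 x2 y1 y2 t ->
     cmod (h v t - h w t - (v - w) * h' t) <= B * cmod (v - w) ^+ 2) ->
  cder (fun v => rectint (fun t => k t * h v t) x1 x2 y1 y2) w
       (rectint (fun t => k t * h' t) x1 x2 y1 y2).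
Proof.
move=> hw r0 B0 ah ah' hB.
have [hx hy] := orect_le hw.
have prod phi : adm phi -> adm (fun t => k t * phi t).
  by move=> ap z hz; apply: contM; [exact: ck|exact: ap].
have M0 : 0 <= M.
  apply: le_trans (kM (redge_bottom hy (_ : x1 <= x1 <= x2))); first exact: cmod_ge0.
  by rewrite lexx.
pose Lam phi := rectint (fun t => k t * phi t) x1 x2 y1 y2.
apply: (@cder_functional _ _ adm Lam (redge x1 x2 y1 y2)
  (4 * M * (x2 - x1 + (y2 - y1))) h h' w r B);
  [exact: r0| |exact: B0| | |exact: ah|exact: ah'|exact: hB].
- by rewrite !mulr_ge0// addr_ge0// subr_ge0.
- move=> a b u v au av; split.
    move=> z hz; apply: contD.
      by apply: contM; [exact: cont_cst|exact: au].
    by apply: contM; [exact: cont_cst|exact: av].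
  rewrite /Lam.
  have pa : adm (fun t => a * (k t * u t)).
    by move=> z hz; apply: contM; [exact: cont_cst|exact: prod].
  have pb : adm (fun t => b * (k t * v t)).
    by move=> z hz; apply: contM; [exact: cont_cst|exact: prod].
  rewrite -(rectintZ hx hy a (prod _ au)) -(rectintZ hx hy b (prod _ av)).
  rewrite -(rectintD hx hy pa pb); apply: eq_rectint => [//|//|t _]; ring.
- move=> u N N0 au uN; rewrite /Lam.
  apply: (le_trans (rectint_bound hx hy (prod _ au) (M := M * N) _)).
    move=> z hz; rewrite cmodM; apply: ler_pM; rewrite ?cmod_ge0//.
      exact: kM.
    exact: uN.
  by rewrite le_eqVlt; apply/orP; left; apply/eqP; ring.
Qed.

Lemma orect_near w : orect x1 x2 y1 y2 w -> exists2 r : R, 0 < r &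
  forall v, cmod (v - w) < r -> orect x1 x2 y1 y2 v.
Proof.
move=> hw; have [s s0 hs] := square_in_orect hw; exists s => // v vs.
have [i1 i2 i3 i4] := hs s (lexx s).
have [/andP[? ?] /andP[? ?]] := disc_orect vs.
by split; apply/andP; split; lra.
Qed.

Lemma edge_cauchy1 w : orect x1 x2 y1 y2 w ->
  cder (fun v => rectint (fun t => k t * (t - v)^-1) x1 x2 y1 y2) w
       (rectint (fun t => k t * (t - w)^-2) x1 x2 y1 y2).
Proof.
move=> hw; have [p p0 hp] := redge_far hw; have [r r0 hr] := orect_near hw.
have cinv v : orect x1 x2 y1 y2 v -> adm (fun t => (t - v)^-1).
  by move=> hv; apply: cont_subV; exact: redge_orect.
apply: (@edge_functional _ (fun t => (t - w)^-2) w (Num.min r (p / 2)) (2 / p ^+ 3));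
  [exact: hw| | | | |].
- by rewrite lt_min r0 divr_gt0.
- by rewrite divr_ge0// exprn_ge0// ltW.
- by move=> v; rewrite lt_min => /andP[/hr hv _]; exact: cinv.
- by apply: cont_subXV; exact: redge_orect.
- move=> v t; rewrite lt_min => /andP[_ vp] ht.
  by apply: (inv_expansion p0) => //; exact: hp.
Qed.

Lemma edge_cauchy2 w : orect x1 x2 y1 y2 w ->
  exists d, cder (fun v => rectint (fun t => k t * (t - v)^-2) x1 x2 y1 y2) w d.
Proof.
move=> hw; have [p p0 hp] := redge_far hw; have [r r0 hr] := orect_near hw.
have cinv v : orect x1 x2 y1 y2 v -> adm (fun t => (t - v)^-1).
  by move=> hv; apply: cont_subV; exact: redge_orect.
have cinv2 v : orect x1 x2 y1 y2 v -> adm (fun t => (t - v)^-2).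
  by move=> hv; apply: cont_subXV; exact: redge_orect.
eexists.
apply: (@edge_functional _ (fun t => 2 * (t - w)^-3) w (Num.min r (p / 2)) (8 / p ^+ 4));
  [exact: hw| | | | |].
- by rewrite lt_min r0 divr_gt0.
- by rewrite divr_ge0// exprn_ge0// ltW.
- by move=> v; rewrite lt_min => /andP[/hr hv _]; exact: cinv2.
- move=> z hz; apply: contM; first exact: cont_cst.
  move: z hz; apply: cont_subXV; exact: redge_orect.
- move=> v t; rewrite lt_min => /andP[_ vp] ht.
  by apply: (sqr_inv_expansion p0) => //; exact: hp.
Qed.

End EdgeCauchy.

Lemma disc_square w (s r : R) : 2 * s < r -> square w s `<=` disc w r.
Proof. by move=> sr z /square_disc /le_lt_trans; apply. Qed.

Lemma open_square (A : set C) w : open A -> A w ->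
  exists2 s : R, 0 < s & square w s `<=` A.
Proof.
move=> /open_discP oA /oA[r r0 rA]; exists (r / 3); first by rewrite divr_gt0.
by move=> z hz; apply: rA; apply: disc_square hz; lra.
Qed.

(** The form in which Cauchy's formula is differentiated: an integral over a fixed
    square, valid on a whole disc. *)
Lemma cauchy_square g w (s : R) : 0 < s ->
  (forall z, square w s z -> exists d, cder g z d) ->
  let F v := rectint (fun t => g t * (t - v)^-1) (Re w - s)
    (Re w + s) (Im w - s) (Im w + s) in
  exists2 r : R, 0 < r & forall v, disc w r v ->
    square w s v /\ (g v = twopii^-1 * F v).
Proof.
move=> s0 hg F; have ow := orect_square w s0.
have [r r0 hr] := orect_near ow; exists r => // v /hr hv.
split; first exact: orect_crect.
by rewrite /F (cauchy_formula hv hg) mulrA mulVf ?mul1r// twopii_neq0.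
Qed.

(** Cauchy's formula makes [g] a Cauchy integral, which may be differentiated
    twice under the integral sign. *)
Lemma holo_derive (A : set C) g : open A -> holomorphic_on A g ->
  holomorphic_on A (derive1 g).
Proof.
move=> oA /holoP hg; apply/holoP => w Aw.
have [s s0 sA] := open_square oA Aw.
have hgs z : square w s z -> exists d, cder g z d by move=> /sA /hg.
have [r r0 hr] := cauchy_square s0 hgs.
have ow := orect_square w s0; have [hx hy] := orect_le ow.
have cg z : square w s z -> {for z, continuous g} by move=> /hgs[d /cder_cont].
have [M _ hM] := bounded_rect hx hy cg.
have cge z : redge (Re w - s) (Re w + s) (Im w - s)
    (Im w + s) z -> {for z, continuous g} by move=> [/cg].
have hMe z : redge (Re w - s) (Re w + s) (Im w - s)
    (Im w + s) z -> cmod (g z) <= M by move=> [/hM].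
have [r' r'0 hr'] := orect_near ow.
have [d hd] := edge_cauchy2 cge hMe ow.
exists (twopii^-1 * d).
apply: (@cder_near _ (fun v => twopii^-1 * rectint (fun t => g t * (t - v)^-2)
  (Re w - s) (Re w + s) (Im w - s) (Im w + s))
  _ _ _ (Num.min r r')).
- by rewrite lt_min r0.
- move=> v; rewrite /disc /= lt_min => /andP[vr /hr' ov].
  have hd1 := cderZ twopii^-1 (edge_cauchy1 cge hMe ov).
  have /open_discP/(_ v vr)[q q0 hq] := @open_disc _ w r.
  have gv u : disc v q u -> twopii^-1 * rectint (fun t => g t * (t - u)^-1)
      (Re w - s) (Re w + s) (Im w - s) (Im w + s) = g u.
    by move=> /hq /hr[_ ->].
  by have [_ ->] := cder_derivable (cder_near q0 gv hd1).
- exact: cderZ.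
Qed.

End Consequences.

Section Removable.
Variable R : realType.
Local Notation C := R[i].
Implicit Types (g h k : C -> C) (z w p : C).

Lemma sub_disc_at z (r : R) p : disc p r z ->
  exists2 q : R, 0 < q & disc z q `<=` disc p r.
Proof. by move=> hz; have /open_discP/(_ z hz) := @open_disc _ p r. Qed.

(** Dividing out a zero: near [p] the quotient is itself a Cauchy integral,
    with density [k t / (t - p)]. *)
Lemma holo_divide k p (r : R) : 0 < r -> holomorphic_on (disc p r) k -> k p = 0 ->
  exists2 k1, holomorphic_on (disc p r) k1 &
    forall z, disc p r z -> k z = (z - p) * k1 z.
Proof.
move=> r0 /holoP hk kp.
pose k1 z := if z == p then derive1 k p else k z * (z - p)^-1.
exists k1; last first.
  move=> z _; rewrite /k1; case: eqVneq => [->|zp]; first by rewrite kp subrr mul0r.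
  by field; rewrite subr_eq0.
have [s s0 sA] := open_square (@open_disc _ p r) (disc_center p r0).
have hks z : square p s z -> exists d, cder k z d by move=> /sA /hk.
have [r1 r10 hr1] := cauchy_square s0 hks.
have ow := orect_square p s0; have [hx hy] := orect_le ow.
set x1 := Re p - s in ow hx hr1; set x2 := Re p + s in ow hx hr1.
set y1 := Im p - s in ow hy hr1; set y2 := Im p + s in ow hy hr1.
have ck z : square p s z -> {for z, continuous k} by move=> /hks[d /cder_cont].
have [M M0 hM] := bounded_rect hx hy ck.
have [q q0 hq] := redge_far ow.
pose kq t := k t * (t - p)^-1.
have cinv v : orect x1 x2 y1 y2 v ->
    forall z, redge x1 x2 y1 y2 z -> {for z, continuous (fun t => (t - v)^-1)}.
  by move=> hv; apply: cont_subV; exact: redge_orect.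
have cke z : redge x1 x2 y1 y2 z -> {for z, continuous kq}.
  by move=> hz; apply: contM; [apply: ck; case: hz|exact: cinv].
have kqM z : redge x1 x2 y1 y2 z -> cmod (kq z) <= M * q^-1.
  move=> hz; rewrite cmodM; apply: ler_pM; rewrite ?cmod_ge0//.
    by apply: hM; case: hz.
  by apply: inv_far => //; exact: hq.
pose T v := twopii^-1 * rectint (fun t => kq t * (t - v)^-1) x1 x2 y1 y2.
have [r2 r20 hr2] := orect_near ow.
pose rr := Num.min r1 r2.
have rr0 : 0 < rr by rewrite lt_min r10.
have hT v : disc p rr v -> k v = (v - p) * T v.
  rewrite /disc /= lt_min => /andP[/hr1[_ kv] /hr2 ov].
  have [_ kp'] := hr1 p (disc_center p r10).
  have ckv z : redge x1 x2 y1 y2 z ->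
      {for z, continuous (fun t => (v - p) * (kq t * (t - v)^-1))}.
    move=> hz; apply: contM; first exact: cont_cst.
    by apply: contM; [exact: cke|exact: cinv].
  have ckv' z : redge x1 x2 y1 y2 z ->
      {for z, continuous (fun t => kq t * (t - v)^-1)}.
    by move=> hz; apply: contM; [exact: cke|exact: cinv].
  have e : rectint (fun t => k t * (t - v)^-1) x1 x2 y1 y2 =
      rectint (fun t => kq t + (v - p) * (kq t * (t - v)^-1)) x1 x2 y1 y2.
    apply: eq_rectint => [//|//|t ht]; rewrite /kq.
    have tp : t - p != 0 by rewrite subr_eq0; case: ht => _; apply: contra_not_neq => ->.
    have tv : t - v != 0 by rewrite subr_eq0; case: ht => _; apply: contra_not_neq => ->.
    by field; rewrite tp tv.
  rewrite kv e (rectintD hx hy cke ckv) (rectintZ hx hy (v - p) ckv') mulrDr.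
  by rewrite -kp' kp add0r /T; ring.
have dT := cderZ twopii^-1 (edge_cauchy1 cke kqM ow).
have Tp : derive1 k p = T p.
  have h1 := cder_near rr0 (fun u hu => esym (hT u hu)) (cderM (cder_sub p p) dT).
  by have [_ ->] := cder_derivable h1; rewrite subrr mul0r addr0 mul1r.
apply/holoP => z hz; have [->|zp] := eqVneq z p.
  eexists; apply: cder_near rr0 _ dT => v hv.
  rewrite /k1 -/(T v); case: eqVneq => [->|vp]; first by rewrite Tp.
  by rewrite hT// mulrAC divff ?mul1r// subr_eq0.
have [d hd] := hk z hz; eexists.
apply: (@cder_near _ (fun z => k z * (z - p)^-1) _ _ _ (cmod (z - p))).
- by rewrite cmod_gt0 subr_eq0.
- move=> v; rewrite /k1; case: eqVneq => // ->.
  by rewrite /disc /= cmodBC ltxx.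
- by apply: cderM; [exact: hd|exact: cder_inv_sub].
Qed.

(** The function [(z - p) ^+ 2 * g z], extended by zero, is differentiable at [p]
    with derivative zero, since [g] is bounded.  It thus has a double zero there,
    which is divided out. *)
Lemma removable g p (r M : R) : 0 < r ->
  holomorphic_on (disc p r `\ p) g ->
  (forall z, disc p r z -> z != p -> cmod (g z) <= M) ->
  exists2 G, holomorphic_on (disc p r) G &
    forall z, disc p r z -> z != p -> G z = g z.
Proof.
move=> r0 /holoP hg hM.
pose k z := if z == p then 0 else (z - p) ^+ 2 * g z.
have kp : k p = 0 by rewrite /k eqxx.
have dkp : cder k p 0.
  apply/cderP => e e0.
  have M1 : 0 < `|M| + 1 by rewrite ltr_wpDl.
  exists (Num.min r (e / (`|M| + 1))); first by rewrite lt_min r0 divr_gt0.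
  move=> w; rewrite lt_min => /andP[wr we]; rewrite kp subr0 mul0r subr0.
  rewrite /k; case: eqVneq => [->|wp]; first by rewrite subrr cmod0 mulr0.
  rewrite cmodM cmodX expr2 -mulrA [e * _]mulrC ler_wpM2l ?cmod_ge0//.
  move: we; rewrite ltr_pdivlMr// => /ltW; apply: le_trans.
  rewrite ler_wpM2l ?cmod_ge0//; apply: (le_trans (hM _ wr wp)).
  by apply: (le_trans (ler_norm M)); rewrite lerDl.
have hk : holomorphic_on (disc p r) k.
  apply/holoP => z hz; have [->|zp] := eqVneq z p; first by exists 0.
  have [|d hd] := hg z; first by split=> //; apply/eqP.
  eexists; apply: (@cder_near _ (fun z => (z - p) * (z - p) * g z) _ _ _ (cmod (z - p))).
  - by rewrite cmod_gt0 subr_eq0.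
  - move=> v; rewrite /k expr2; case: eqVneq => // ->.
    by rewrite /disc /= cmodBC ltxx.
  - by apply: cderM; [apply: cderM; exact: cder_sub|exact: hd].
have [k1 hk1 kk1] := holo_divide r0 hk kp.
have k1p : k1 p = 0.
  have d1 := holo_cder hk1 (disc_center p r0).
  have h1 := cder_near r0 (fun u hu => esym (kk1 u hu)) (cderM (cder_sub p p) d1).
  by have := cder_unique h1 dkp; rewrite subrr mul0r addr0 mul1r.
have [k2 hk2 kk2] := holo_divide r0 hk1 k1p.
exists k2 => // z hz zp.
have := kk1 z hz; rewrite kk2// /k (negbTE zp) => e.
have zp0 : (z - p) ^+ 2 != 0 by rewrite expf_neq0// subr_eq0.
by apply: (mulfI zp0); rewrite e; ring.
Qed.

(** ** Maximum principle *)

Lemma geometric_small (x K : R) : 0 <= x -> x < 1 -> exists n, K * x ^+ n < 1.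
Proof.
move=> x0 x1.
have cx : K * x ^+ n @[n --> \oo] --> K * 0.
  by apply: cvgM; [exact: cvg_cst|apply: cvg_expr; rewrite ger0_norm].
rewrite mulr0 in cx; move/cvgrPdist_lt : cx => /(_ 1 ltr01)[n _ hn]; exists n.
have := hn n (leqnn n); rewrite sub0r normrN; apply: le_lt_trans.
exact: ler_norm.
Qed.

Lemma geometric_le0 (x K a : R) : 0 <= x -> x < 1 ->
  (forall n, a <= K * x ^+ n) -> a <= 0.
Proof.
move=> x0 x1 h; rewrite leNgt; apply/negP => a0.
have [n hn] := geometric_small (K / a) x0 x1.
have := h n; rewrite leNgt => /negP; apply.
by move: hn; rewrite mulrAC ltr_pdivrMr// mul1r.
Qed.

(** Were [b < a], the sequence [K * (b / a) ^+ n] would tend to zero while staying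
    above 1. *)
Lemma power_trick (a b K : R) : 0 <= a -> 0 <= b ->
  (forall n, a ^+ n <= K * b ^+ n) -> a <= b.
Proof.
move=> a0 b0 h; rewrite leNgt; apply/negP => ba.
have a1 := le_lt_trans b0 ba.
have [n] : exists n, K * (b / a) ^+ n < 1.
  by apply: geometric_small; [rewrite divr_ge0|rewrite ltr_pdivrMr// mul1r].
rewrite expr_div_n mulrA ltr_pdivrMr ?exprn_gt0// mul1r ltNge h//.
Qed.

(** Cauchy's formula bounds [g w] by the maximum of [g] on the boundary times a
    constant; applied to the powers of [g], it makes the constant disappear. *)
Lemma maximum_rect g (x1 x2 y1 y2 M : R) w : orect x1 x2 y1 y2 w ->
  (forall z, crect x1 x2 y1 y2 z -> exists d, cder g z d) ->
  0 <= M -> (forall z, redge x1 x2 y1 y2 z -> cmod (g z) <= M) ->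
  cmod (g w) <= M.
Proof.
move=> ow hg M0 hM; have [hx hy] := orect_le ow.
have [q q0 hq] := redge_far ow.
apply: (power_trick (K := 4 * q^-1 * (x2 - x1 + (y2 - y1)) / cmod (twopii : C)))
  => //; first exact: cmod_ge0.
move=> n; have t0 : 0 < cmod (twopii : C) by rewrite cmod_gt0 twopii_neq0.
have hgn z : crect x1 x2 y1 y2 z -> exists d, cder (fun z => g z ^+ n) z d.
  by move=> /hg[d hd]; exact: cderX hd.
have := cauchy_formula ow hgn => /(congr1 (@cmod R)); rewrite cmodM cmodX => e.
rewrite -(ler_pM2l t0) -e.
have -> : cmod (twopii : C) * (4 * q^-1 * (x2 - x1 + (y2 - y1)) /
   cmod (twopii : C) * M ^+ n) = 4 * (M ^+ n * q^-1) * (x2 - x1 + (y2 - y1)).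
  by field; rewrite !gt_eqF.
apply: rectint_bound => //.
  move=> z hz; apply: contM.
    by have [d /cder_cont] := hgn z (proj1 hz).
  by move: z hz; apply: cont_subV; exact: redge_orect.
move=> z hz; rewrite cmodM cmodX; apply: ler_pM.
- by rewrite exprn_ge0// cmod_ge0.
- exact: cmod_ge0.
- by apply: lerXn2r; rewrite ?nnegrE ?cmod_ge0//; exact: hM.
- by apply: inv_far => //; exact: hq.
Qed.

(** A zero which is a limit of zeros has infinite order: all the quotients
    [phi / (z - p) ^ n] are holomorphic, and the maximum principle bounds them
    by [M / s ^ n]. *)
Lemma zeros_isolated g p (r : R) : 0 < r -> holomorphic_on (disc p r) g ->
  (forall e, 0 < e -> exists z, [/\ z != p, cmod (z - p) < e & g z = 0]) ->
  exists2 s : R, 0 < s & forall z, disc p s z -> g z = 0.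
Proof.
move=> r0 hg acc.
have quot n : exists2 gn, holomorphic_on (disc p r) gn &
    forall z, disc p r z -> g z = (z - p) ^+ n * gn z.
  elim: n => [|n [gn hgn gE]].
    by exists g => // z _; rewrite expr0 mul1r.
  have gnp : gn p = 0.
    apply: contrapT => /eqP nz.
    have := holo_cont hgn (disc_center p r0).
    move/cont_discP => /(_ (cmod (gn p))); rewrite cmod_gt0 => /(_ nz)[q q0 hq].
    have [|z [zp zq gz]] := acc (Num.min q r); first by rewrite lt_min q0.
    move: zq; rewrite lt_min => /andP[/hq zq zr].
    move: gz zq; rewrite gE// => /eqP; rewrite mulf_eq0 expf_eq0 subr_eq0 (negbTE zp).
    by rewrite andbF /= => /eqP ->; rewrite sub0r cmodN ltxx.
  have [gn1 h1 e1] := holo_divide r0 hgn gnp.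
  by exists gn1 => // z hz; rewrite gE// e1// exprSr mulrA.
have [s s0 sA] := open_square (@open_disc _ p r) (disc_center p r0).
exists s => // z hz.
have ow := orect_square p s0; have [hx hy] := orect_le ow.
have cg u : square p s u -> {for u, continuous g}.
  by move=> /sA; exact: holo_cont.
have [M M0 hM] := bounded_rect hx hy cg.
have oz : orect (Re p - s) (Re p + s) (Im p - s)
    (Im p + s) z by exact: disc_orect.
apply/eqP; rewrite -cmod_eq0 eq_le cmod_ge0 andbT.
apply: (@geometric_le0 (cmod (z - p) / s) M).
- by rewrite divr_ge0 ?cmod_ge0// ltW.
- by rewrite ltr_pdivrMr// mul1r.
move=> n; have [gn hgn gE] := quot n.
rewrite gE; last by apply: sA; exact: orect_crect.
rewrite cmodM cmodX expr_div_n mulrA mulrC mulrAC ler_wpM2r ?exprn_ge0 ?cmod_ge0//.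
apply: (maximum_rect oz).
- by move=> u /sA hu; eexists; exact: holo_cder hgn hu.
- by rewrite divr_ge0// exprn_ge0// ltW.
move=> u [hu no]; rewrite ler_pdivlMr ?exprn_gt0//.
apply: le_trans (hM u hu); rewrite (gE u (sA u hu)) cmodM cmodX mulrC.
rewrite ler_wpM2r ?cmod_ge0//; apply: lerXn2r; [by rewrite nnegrE ltW|by rewrite nnegrE cmod_ge0|].
by rewrite leNgt; apply/negP => us; apply: no; exact: disc_orect.
Qed.

End Removable.

(** * The Phragmen-Lindelof principle on the half-plane *)

Section PhragmenLindelof.
Variable R : realType.
Local Notation C := R[i].
Implicit Types (h : C -> C) (z w : C).

(** Compactness of the segment [[- T, T]] of the axis makes the neighbourhoods of
    its points, where [h] is bounded, cover a strip of positive width. *)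
Lemma strip_bound h (T M : R) : 0 <= T ->
  (forall y : R, exists2 r : R, 0 < r & forall w, half_plane w ->
     cmod (w - Complex 0 y) < r -> cmod (h w) <= M) ->
  exists2 eta : R, 0 < eta & forall w, 0 < Re w <= eta ->
    - T <= Im w <= T -> cmod (h w) <= M.
Proof.
move=> T0 hb.
apply: (@rect_induction _ (fun _ _ c d => exists2 eta : R, 0 < eta & forall w,
  0 < Re w <= eta -> c <= Im w <= d -> cmod (h w) <= M) 0 0) => //.
- lra.
- move=> _ _ c d _ _ _ _ _ _ [e1 e10 h1] _ [e2 e20 h2] _.
  exists (Num.min e1 e2); first by rewrite lt_min e10.
  move=> w /andP[w0]; rewrite le_min => /andP[we1 we2] /andP[cw wd].
  have [l|/ltW l] := leP (Im w) ((c + d) / 2).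
    by apply: h1; rewrite ?w0 ?cw.
  by apply: h2; rewrite ?w0 ?l.
- case=> x y [/andP[/= x0 x0'] _].
  have -> : x = 0 by apply/eqP; rewrite eq_le x0 x0'.
  have [r r0 hr] := hb y; exists (r / 2); first by rewrite divr_gt0.
  move=> _ _ c d _ _ _ _ _ _ [_ /andP[/= cy yd]] _ dc.
  exists (r / 3); first by rewrite divr_gt0.
  move=> [a b] /= /andP[a0 ar] /andP[cb bd]; apply: hr => //.
  apply: (le_lt_trans (cmod_le _)); rewrite /= subr0 ger0_norm ?ltW//.
  have : `|b - y| <= d - c by rewrite ler_norml; apply/andP; split; lra.
  by lra.
Qed.

(** Dividing the powers of [h] by [1 + w] makes them small at infinity without
    enlarging them on the axis, and the factor is lost in the power trick. *)
Lemma phragmen_lindelof h (B M : R) : holomorphic_on (@half_plane R) h ->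
  (forall w, half_plane w -> cmod (h w) <= B) -> 0 <= M ->
  (forall (y e : R), 0 < e -> exists2 r : R, 0 < r & forall w, half_plane w ->
     cmod (w - Complex 0 y) < r -> cmod (h w) <= M + e) ->
  forall w, half_plane w -> cmod (h w) <= M.
Proof.
move=> hh hB M0 hb w0 hw0; apply/ler_addgt0Pr => e e0.
set M' := M + e; have M'0 : 0 < M' by rewrite /M' ltr_wpDl.
apply: (power_trick (K := cmod (1 + w0))); [exact: cmod_ge0|exact: ltW|].
move=> n.
have B0 : 0 <= B by apply: le_trans (hB _ hw0); exact: cmod_ge0.
have Mn : 0 < M' ^+ n by rewrite exprn_gt0.
(* On the sides of the rectangle away from the axis, [1 + w] has modulus at
   least [T], and [T] is chosen so that [B ^+ n / T <= M' ^+ n]. *)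
pose T := 1 + `|Re w0| + `|Im w0| + B ^+ n / M' ^+ n.
have q0 : 0 <= B ^+ n / M' ^+ n by rewrite divr_ge0 ?exprn_ge0// ltW.
have n1 := normr_ge0 (Re w0); have n2 := normr_ge0 (Im w0).
have l1 := ler_norm (Re w0); have l2 := ler_norm (Im w0).
have l3 := ler_norm (- Im w0); rewrite normrN in l3.
have T1 : 1 <= T by rewrite /T; lra.
have BT : B ^+ n / T <= M' ^+ n.
  rewrite ler_pdivrMr; last by lra.
  by rewrite mulrC -ler_pdivrMr// /T; lra.
have T0 : 0 <= T by lra.
have [eta eta0 heta] := strip_bound T0 (fun y => hb y e e0).
have w00 : 0 < Re w0 by [].
pose a := Num.min eta (Re w0 / 2).
have a0 : 0 < a by rewrite /a lt_min eta0 divr_gt0.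
have a_eta : a <= eta by rewrite /a ge_min lexx.
have aw : a < Re w0.
  by have : a <= Re w0 / 2 by [rewrite /a ge_min lexx orbT]; lra.
have ow : orect a T (- T) T w0.
  by split; apply/andP; split => //; rewrite /T; lra.
pose u w := h w ^+ n * (w - (-1))^-1.
have hp z : crect a T (- T) T z -> half_plane z.
  by case=> /andP[az _] _; rewrite /half_plane /=; exact: lt_le_trans az.
have far1 z : crect a T (- T) T z -> 1 <= cmod (z - (-1)).
  move=> /hp; rewrite /half_plane /= => z0.
  apply: le_trans (cmod_Re _); rewrite ReD /= opprK.
  by rewrite ger0_norm; lra.
have hu z : crect a T (- T) T z -> exists d, cder u z d.
  move=> hz; have [d hd] := cderX n (holo_cder hh (hp z hz)).
  eexists; apply: cderM; first exact: hd.
  apply: cder_inv_sub; apply/eqP => zE; have := far1 z hz.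
  by rewrite zE subrr cmod0 ler10.
have hM z : redge a T (- T) T z -> cmod (u z) <= M' ^+ n.
  move=> [hz no]; have hpz := hp z hz; have f1 := far1 z hz.
  have f0 : 0 < cmod (z - (-1)) by lra.
  rewrite /u cmodM cmodX cmodV.
  have [za|za] := leP (Re z) a.
    apply: (@le_trans _ _ (cmod (h z) ^+ n)).
      by rewrite ler_pdivrMr// ler_peMr// exprn_ge0// cmod_ge0.
    apply: lerXn2r; rewrite ?nnegrE ?cmod_ge0//; first exact: ltW.
    apply: heta; last by case: hz.
    by rewrite (le_trans za a_eta) andbT.
  apply: le_trans BT.
  have fT : T <= cmod (z - (-1)).
    case: hz => /andP[z1 z2] /andP[z3 z4].
    have [zT|zT] := leP T (Re z).
      apply: le_trans (cmod_Re _); rewrite ReD /= opprK.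
      by rewrite ger0_norm; lra.
    apply: le_trans (cmod_Im _); rewrite ImD /= !oppr0 addr0.
    have [?|?] := leP T (Im z); first by rewrite ger0_norm; lra.
    have [?|?] := leP (Im z) (- T); first by rewrite ler0_norm; lra.
    by exfalso; apply: no; split; apply/andP; split.
  apply: ler_pM; rewrite ?exprn_ge0 ?invr_ge0 ?cmod_ge0//.
    by apply: lerXn2r; rewrite ?nnegrE ?cmod_ge0//; exact: hB.
  by rewrite lef_pV2// posrE; lra.
have := maximum_rect ow hu (ltW Mn) hM.
have f0 : 0 < cmod (w0 - (-1)) by have := far1 w0 (orect_crect ow); lra.
rewrite /u cmodM cmodX cmodV ler_pdivrMr// opprK [w0 + 1]addrC mulrC.
by [].
Qed.

End PhragmenLindelof.

(** * Absolutely summable families *)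

Section Summable.
Variables (R : realType) (T : choiceType) (D : set T).
Local Notation C := R[i].
Implicit Types (a b p q : T -> R) (c : T -> C).

Local Notation ES a := (\esum_(i in D) (a i)%:E).

Lemma esum_pos_ge0 a : (forall i, D i -> 0 <= a i) -> (0 <= ES a)%E.
Proof. by move=> a0; apply: esum_ge0 => i /a0; rewrite lee_fin. Qed.

Lemma esum_pos_fin a : (forall i, D i -> 0 <= a i) -> (ES a < +oo)%E ->
  ES a \is a fin_num.
Proof. by move=> a0 h; rewrite ge0_fin_numE// esum_pos_ge0. Qed.

Lemma esum_scale (s : R) a : 0 <= s -> (forall i, D i -> 0 <= a i) ->
  ES (fun i => (s * a i)%R) = (s%:E * ES a)%E.
Proof.
have le (r : R) b : 0 <= r -> (forall i, D i -> 0 <= b i) ->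
    (ES (fun i => (r * b i)%R) <= r%:E * ES b)%E.
  move=> r0 b0; apply: ge_ereal_sup => _ [A hA <-].
  pose b' i := if i \in D then b i else 0.
  have AD i : A i -> i \in D by case: hA => _ AD /AD; rewrite inE.
  have b'0 i : (0 <= (b' i)%:E)%E.
    by rewrite lee_fin /b'; case: ifPn => //; rewrite inE => /b0.
  rewrite (eq_fsbigr (fun i => (r%:E * (b' i)%:E)%E)); last first.
    by move=> i; rewrite inE => /AD iD; rewrite /b' iD EFinM.
  rewrite -ge0_mule_fsumr//; apply: lee_wpmul2l; rewrite ?lee_fin//.
  apply: esum_ge; exists A => //.
  rewrite (eq_fsbigr (fun i => (b i)%:E))// => i; rewrite inE => /AD iD.
  by rewrite /b' iD.
rewrite le_eqVlt => /orP[/eqP <- a0|s0 a0].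
  by rewrite mul0e; apply: esum1 => i _; rewrite mul0r.
apply/eqP; rewrite eq_le le//=; last exact: ltW.
have := le s^-1 (fun i => s * a i).
rewrite invr_ge0 (ltW s0) => /(_ isT) h.
have {}h := h (fun i Di => mulr_ge0 (ltW s0) (a0 i Di)).
have e : ES a = ES (fun i => (s^-1 * (s * a i))%R).
  by apply: eq_esum => i _; rewrite mulrA mulVf ?mul1r// gt_eqF.
rewrite e; apply: (le_trans (lee_wpmul2l _ h)); first by rewrite lee_fin ltW.
by rewrite muleA -EFinM divff ?gt_eqF// mul1e.
Qed.

Definition asummable a := (ES (fun i => `|a i|%R) < +oo)%E.

(** Any decomposition into nonnegative summable families computes the sum, as
    [max a 0 + q = max (- a) 0 + p]; linearity follows by adding or scaling
    decompositions. *)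
Lemma rsum_pq a p q : (forall i, D i -> a i = p i - q i) ->
  (forall i, D i -> 0 <= p i) -> (forall i, D i -> 0 <= q i) ->
  (ES p < +oo)%E -> (ES q < +oo)%E ->
  rsum D a = fine (ES p) - fine (ES q).
Proof.
move=> e p0 q0 fp fq; rewrite /rsum.
set P := fun i => Num.max (a i) 0; set Q := fun i => Num.max (- a i) 0.
have P0 i : D i -> 0 <= P i by move=> _; rewrite /P le_max lexx orbT.
have Q0 i : D i -> 0 <= Q i by move=> _; rewrite /Q le_max lexx orbT.
have fP : (ES P < +oo)%E.
  apply: le_lt_trans fp; apply: le_esum => i Di; rewrite lee_fin /P ge_max p0//.
  by rewrite e// gerBl q0.
have fQ : (ES Q < +oo)%E.
  apply: le_lt_trans fq; apply: le_esum => i Di; rewrite lee_fin /Q ge_max q0//.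
  by rewrite e// opprB gerBl p0.
have E : (ES P + ES q = ES Q + ES p)%E.
  rewrite -!esumD; [|by move=> i Di; rewrite lee_fin; auto..].
  apply: eq_esum => i Di; rewrite -!EFinD; congr EFin; rewrite /P /Q e//.
  by case: (leP (p i - q i) 0); case: (leP (- (p i - q i)) 0); lra.
move: E; rewrite -(fineK (esum_pos_fin P0 fP)) -(fineK (esum_pos_fin q0 fq)).
rewrite -(fineK (esum_pos_fin Q0 fQ)) -(fineK (esum_pos_fin p0 fp)) -!EFinD.
by move=> [] E; lra.
Qed.

Lemma asummable_pos a : asummable a -> (ES (fun i => Num.max (a i) 0) < +oo)%E.
Proof.
apply: le_lt_trans; apply: le_esum => i _; rewrite lee_fin ge_max normr_ge0 andbT.
exact: ler_norm.
Qed.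

Lemma asummable_neg a : asummable a -> (ES (fun i => Num.max (- a i) 0) < +oo)%E.
Proof.
apply: le_lt_trans; apply: le_esum => i _; rewrite lee_fin ge_max normr_ge0 andbT.
by rewrite -normrN; exact: ler_norm.
Qed.

Lemma esum_add p q : (forall i, D i -> 0 <= p i) -> (forall i, D i -> 0 <= q i) ->
  ES (fun i => p i + q i) = (ES p + ES q)%E.
Proof.
by move=> p0 q0; rewrite -esumD; [|by move=> i Di; rewrite lee_fin; auto..].
Qed.

Lemma posneg (x : R) : x = Num.max x 0 - Num.max (- x) 0.
Proof. by case: (leP x 0); case: (leP (- x) 0); lra. Qed.

Lemma pos_ge0 (x : R) : 0 <= Num.max x 0.
Proof. by rewrite le_max lexx orbT. Qed.

Lemma rsumD a b : asummable a -> asummable b ->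
  rsum D (fun i => a i + b i) = rsum D a + rsum D b.
Proof.
move=> ha hb.
rewrite (@rsum_pq _ (fun i => Num.max (a i) 0 + Num.max (b i) 0)
  (fun i => Num.max (- a i) 0 + Num.max (- b i) 0)).
- have fa := asummable_pos ha; have fa' := asummable_neg ha.
  have fb := asummable_pos hb; have fb' := asummable_neg hb.
  rewrite !esum_add; do ?by move=> *; exact: pos_ge0.
  rewrite !fineD; do ?by apply: esum_pos_fin => // *; exact: pos_ge0.
  by rewrite /rsum; lra.
- by move=> i _; rewrite {1}(posneg (a i)) {1}(posneg (b i)); ring.
- by move=> i _; rewrite addr_ge0// pos_ge0.
- by move=> i _; rewrite addr_ge0// pos_ge0.
- rewrite esum_add; do ?by move=> *; exact: pos_ge0.
  by rewrite lte_add_pinfty//; exact: asummable_pos.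
- rewrite esum_add; do ?by move=> *; exact: pos_ge0.
  by rewrite lte_add_pinfty//; exact: asummable_neg.
Qed.

Lemma rsumZ (s : R) a : asummable a -> rsum D (fun i => s * a i) = s * rsum D a.
Proof.
move=> ha; have fa := asummable_pos ha; have fa' := asummable_neg ha.
have lt (r : R) p : 0 <= r -> (forall i, D i -> 0 <= p i) -> (ES p < +oo)%E ->
    (ES (fun i => (r * p i)%R) < +oo)%E.
  move=> r0 p0 fp; rewrite esum_scale//.
  by rewrite -(fineK (esum_pos_fin p0 fp)) -EFinM ltry.
have fZ (r : R) p : 0 <= r -> (forall i, D i -> 0 <= p i) -> (ES p < +oo)%E ->
    fine (ES (fun i => (r * p i)%R)) = r * fine (ES p).
  by move=> r0 p0 fp; rewrite esum_scale// fineM// esum_pos_fin.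
have [s0|/ltW s0] := leP 0 s.
  rewrite (@rsum_pq _ (fun i => s * Num.max (a i) 0) (fun i => s * Num.max (- a i) 0)).
  - rewrite (fZ s (fun i => Num.max (a i) 0) s0 (fun i _ => pos_ge0 _) fa).
    rewrite (fZ s (fun i => Num.max (- a i) 0) s0 (fun i _ => pos_ge0 _) fa').
    by rewrite /rsum; ring.
  - by move=> i _; rewrite {1}(posneg (a i)); ring.
  - by move=> i _; rewrite mulr_ge0// pos_ge0.
  - by move=> i _; rewrite mulr_ge0// pos_ge0.
  - by apply: lt => // *; exact: pos_ge0.
  - by apply: lt => // *; exact: pos_ge0.
have s0' : 0 <= - s by rewrite oppr_ge0.
rewrite (@rsum_pq _ (fun i => - s * Num.max (- a i) 0) (fun i => - s * Num.max (a i) 0)).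
- rewrite (fZ _ (fun i => Num.max (a i) 0) s0' (fun i _ => pos_ge0 _) fa).
  rewrite (fZ _ (fun i => Num.max (- a i) 0) s0' (fun i _ => pos_ge0 _) fa').
  by rewrite /rsum; ring.
- by move=> i _; rewrite {1}(posneg (a i)); ring.
- by move=> i _; rewrite mulr_ge0// pos_ge0.
- by move=> i _; rewrite mulr_ge0// pos_ge0.
- by apply: lt => // *; exact: pos_ge0.
- by apply: lt => // *; exact: pos_ge0.
Qed.

Lemma rsum_bound a : asummable a -> `|rsum D a| <= fine (ES (fun i => `|a i|)).
Proof.
move=> ha; rewrite /rsum.
have n0 i : D i -> 0 <= `|a i| by [].
have le p : (forall i, D i -> 0 <= p i) -> (forall i, D i -> p i <= `|a i|) ->
    0 <= fine (ES p) <= fine (ES (fun i => `|a i|)).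
  move=> p0 pa; have fp : (ES p < +oo)%E.
    by apply: le_lt_trans ha; apply: le_esum => i /pa; rewrite lee_fin.
  rewrite fine_ge0 ?esum_pos_ge0//=; apply: fine_le; try exact: esum_pos_fin.
  by apply: le_esum => i /pa; rewrite lee_fin.
have /andP[? ?] := le (fun i => Num.max (a i) 0) (fun i _ => pos_ge0 _)
  (fun i _ => ltac:(by rewrite ge_max normr_ge0 ler_norm)).
have /andP[? ?] := le (fun i => Num.max (- a i) 0) (fun i _ => pos_ge0 _)
  (fun i _ => ltac:(by rewrite ge_max normr_ge0 -normrN ler_norm)).
by rewrite ler_norml; apply/andP; split; lra.
Qed.

Lemma esum_single (j : T) a : D j -> (forall i, D i -> 0 <= a i) ->
  (forall i, D i -> i <> j -> a i = 0) -> ES a = (a j)%:E.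
Proof.
move=> Dj a0 az; rewrite (esumID [set j]); last by move=> i /a0; rewrite lee_fin.
have -> : D `&` [set j] = [set j].
  by apply/seteqP; split=> [i []//|i /= ->].
rewrite esum_set1 ?lee_fin ?a0// esum1 ?adde0// => i [Di ij].
by rewrite az.
Qed.

Lemma rsum_single (j : T) a : D j -> (forall i, D i -> i <> j -> a i = 0) ->
  rsum D a = a j.
Proof.
move=> Dj az; rewrite /rsum !(@esum_single j)//=.
- by rewrite -posneg.
- by move=> i _; exact: pos_ge0.
- by move=> i Di ij; rewrite az// oppr0 maxxx.
- by move=> i _; exact: pos_ge0.
- by move=> i Di ij; rewrite az// maxxx.
Qed.

Lemma eq_rsum a b : (forall i, D i -> a i = b i) -> rsum D a = rsum D b.
Proof.
by move=> ab; rewrite /rsum; congr (fine _ - fine _); apply: eq_esum => i /ab ->.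
Qed.

Definition csummable c := (ES (fun i => cmod (c i)) < +oo)%E.

Lemma csummable_Re c : csummable c -> asummable (fun i => Re (c i)).
Proof.
by apply: le_lt_trans; apply: le_esum => i _; rewrite lee_fin cmod_Re.
Qed.

Lemma csummable_Im c : csummable c -> asummable (fun i => Im (c i)).
Proof.
by apply: le_lt_trans; apply: le_esum => i _; rewrite lee_fin cmod_Im.
Qed.

Lemma eq_csum c d : (forall i, D i -> c i = d i) -> csum D c = csum D d.
Proof. by move=> cd; congr Complex; apply: eq_rsum => i /cd ->. Qed.

Lemma csumD c d : csummable c -> csummable d ->
  csum D (fun i => c i + d i) = csum D c + csum D d.
Proof.
move=> hc hd; apply: complex_ext.
  rewrite ReD /= -(rsumD (csummable_Re hc) (csummable_Re hd)).
  by apply: eq_rsum => i _; rewrite ReD.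
rewrite ImD /= -(rsumD (csummable_Im hc) (csummable_Im hd)).
by apply: eq_rsum => i _; rewrite ImD.
Qed.

Lemma asummableZ (s : R) a : asummable a -> asummable (fun i => s * a i).
Proof.
move=> ha; rewrite /asummable.
rewrite (eq_esum (b := fun i => (`|s| * `|a i|)%:E)); last first.
  by move=> i _; rewrite normrM.
rewrite esum_scale//.
by rewrite -(fineK (esum_pos_fin (fun i _ => normr_ge0 (a i)) ha)) -EFinM ltry.
Qed.

Lemma csumZ (k : C) c : csummable c -> csum D (fun i => k * c i) = k * csum D c.
Proof.
move=> hc; have hr := csummable_Re hc; have hi := csummable_Im hc.
apply: complex_ext.
  rewrite ReM /= -!rsumZ// -mulN1r -rsumZ; last exact: asummableZ.
  rewrite -rsumD; try exact: asummableZ; last by do 2!apply: asummableZ.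
  by apply: eq_rsum => i _; rewrite ReM; ring.
rewrite ImM /= -!rsumZ// -rsumD; try exact: asummableZ.
by apply: eq_rsum => i _; rewrite ImM; ring.
Qed.

Lemma csum_bound c : csummable c ->
  cmod (csum D c) <= 2 * fine (ES (fun i => cmod (c i))).
Proof.
move=> hc; apply: (le_trans (cmod_le _)) => /=.
have fc : ES (fun i => cmod (c i)) \is a fin_num.
  by apply: esum_pos_fin => // i _; exact: cmod_ge0.
rewrite mulr_natl mulr2n; apply: lerD.
  apply: (le_trans (rsum_bound (csummable_Re hc))); apply: fine_le => //.
    by apply: esum_pos_fin => //; exact: csummable_Re.
  by apply: le_esum => i _; rewrite lee_fin cmod_Re.
apply: (le_trans (rsum_bound (csummable_Im hc))); apply: fine_le => //.
  by apply: esum_pos_fin => //; exact: csummable_Im.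
by apply: le_esum => i _; rewrite lee_fin cmod_Im.
Qed.

Lemma csum_single (j : T) c : D j -> (forall i, D i -> i <> j -> c i = 0) ->
  csum D c = c j.
Proof.
move=> Dj cz; apply: complex_ext => /=; apply: rsum_single => // i Di ij;
  by rewrite cz.
Qed.

Lemma csum0 c : (forall i, D i -> c i = 0) -> csum D c = 0.
Proof.
move=> cz; apply: complex_ext; rewrite /= /rsum !esum1 ?subrr// => i Di;
  by rewrite cz//= ?oppr0 maxxx.
Qed.

End Summable.

(** * Sums of weighted integrals over a family of arcs *)

Section WeightedFamily.
Variables (R : realType) (T1 T2 : choiceType).
Local Notation C := R[i].
Local Notation mu := (@lebesgue_measure R).
Local Notation mset D := (@measurable _ (measurableTypeR R) D).
Variables (P : set T1) (A : T1 -> set T2) (dom : T1 -> T2 -> set R).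
Variables (W : T1 -> T2 -> R -> C) (g : T1 -> T2 -> R -> R) (k0 : C).

Definition cmeas (D : set R) (h : R -> C) : Prop :=
  measurable_fun (D : set (measurableTypeR R)) (fun t => Re (h t)) /\
  measurable_fun (D : set (measurableTypeR R)) (fun t => Im (h t)).

Lemma cmeasM D h k : mset D -> cmeas D h -> cmeas D k ->
  cmeas D (fun t => h t * k t).
Proof.
move=> mD [h1 h2] [k1 k2]; split.
  apply: (eq_measurable_fun (fun t => Re (h t) * Re (k t) -
    Im (h t) * Im (k t))); first by move=> t _; rewrite ReM.
  by apply: measurable_funB; apply: measurable_funM.
apply: (eq_measurable_fun (fun t => Re (h t) * Im (k t) +
  Im (h t) * Re (k t))); first by move=> t _; rewrite ImM.
by apply: measurable_funD; apply: measurable_funM.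
Qed.

Lemma cmeasD D h k : cmeas D h -> cmeas D k -> cmeas D (fun t => h t + k t).
Proof.
move=> [h1 h2] [k1 k2]; split.
  apply: (eq_measurable_fun (fun t => Re (h t) + Re (k t))).
    by move=> t _; rewrite ReD.
  exact: measurable_funD.
apply: (eq_measurable_fun (fun t => Im (h t) + Im (k t))).
  by move=> t _; rewrite ImD.
exact: measurable_funD.
Qed.

Lemma cmeas_cst D (c : C) : cmeas D (fun=> c).
Proof. by split; exact: measurable_cst. Qed.

Lemma cmeas_cont D h : mset D -> (forall t, D t -> {for t, continuous h}) ->
  cmeas D h.
Proof.
move=> mD ch; split; apply: subspace_continuous_measurable_fun => //;
  apply: continuous_in_subspaceT => t; rewrite inE => /ch; [exact: Re_cont|exact: Im_cont].
Qed.

Lemma cinteg_dominated D h (M : R -> R) : mset D -> cmeas D h ->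
  mu.-integrable D (EFin \o M) -> (forall t, D t -> cmod (h t) <= M t) ->
  cinteg D h.
Proof.
move=> mD [h1 h2] hM hle; split; apply: le_integrable hM => //.
- exact/measurable_EFinP.
- move=> t Dt; rewrite /= lee_fin; apply: (le_trans (cmod_Re _)).
  by apply: (le_trans (hle t Dt)); rewrite ler_norm.
- exact/measurable_EFinP.
- move=> t Dt; rewrite /= lee_fin; apply: (le_trans (cmod_Im _)).
  by apply: (le_trans (hle t Dt)); rewrite ler_norm.
Qed.

Hypothesis mdom : forall p G, P p -> A p G -> mset (dom p G).
Hypothesis mW : forall p G, P p -> A p G -> cmeas (dom p G) (W p G).
Hypothesis mg : forall p G, P p -> A p G ->
  measurable_fun (dom p G : set (measurableTypeR R)) (g p G).
Hypothesis g0 : forall p G t, P p -> A p G -> dom p G t -> 0 <= g p G t.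
Hypothesis Wg : forall p G t, P p -> A p G -> dom p G t ->
  cmod (W p G t) <= g p G t.
Hypothesis k0_neq0 : k0 != 0.

Let I1 p G := (\int[mu]_(t in dom p G) (g p G t)%:E)%E.
Let E1 p := (\esum_(G in A p) I1 p G)%E.

Hypothesis mass : (\esum_(p in P) ((cmod k0)%:E * E1 p) < +oo)%E.

(** The shape of the Cauchy-Heine integral, as a linear functional of the kernel
    [h]: a sum over [p], and over the arcs [G] of [p], of integrals against a
    weight [W] dominated by a [g] of finite total mass. *)
Definition family_functional (h : T1 * T2 * R -> C) : C :=
  csum P (fun p => k0 * csum (A p) (fun G =>
    cintegral (dom p G) (fun t => W p G t * h (p, G, t)))).

Definition family_support : set (T1 * T2 * R) :=
  [set x | [/\ P x.1.1, A x.1.1 x.1.2 & dom x.1.1 x.1.2 x.2]].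

Definition admissible (h : T1 * T2 * R -> C) : Prop :=
  (forall p G, P p -> A p G -> cmeas (dom p G) (fun t => h (p, G, t))) /\
  exists2 M : R, 0 <= M & forall x, family_support x -> cmod (h x) <= M.

Let I1_ge0 p G : P p -> A p G -> (0 <= I1 p G)%E.
Proof. by move=> hp hG; apply: integral_ge0 => t ht; rewrite lee_fin g0. Qed.

Let E1_ge0 p : P p -> (0 <= E1 p)%E.
Proof. by move=> hp; apply: esum_ge0 => G; exact: I1_ge0. Qed.

Lemma esum_term_le (T : choiceType) (D : set T) (a : T -> \bar R) i : D i ->
  (forall j, D j -> 0 <= a j)%E -> (a i <= \esum_(j in D) a j)%E.
Proof.
move=> Di a0; apply: esum_ge; exists [set i]; last by rewrite fsbig_set1.
by split; [exact: finite_set1|move=> j ->].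
Qed.

Let kgt0 : 0 < cmod k0. Proof. by rewrite cmod_gt0. Qed.

Let E1_fin p : P p -> E1 p \is a fin_num.
Proof.
move=> hp; rewrite ge0_fin_numE ?E1_ge0//.
have pos q : P q -> (0 <= (cmod k0)%:E * E1 q)%E.
  by move=> hq; rewrite mule_ge0 ?E1_ge0// lee_fin ltW.
have := le_lt_trans (esum_term_le hp pos) mass.
case: (E1 p) (E1_ge0 hp) => [r _ _|_|//]; first exact: ltry.
by rewrite gt0_muley ?lte_fin// ltxx.
Qed.

Let I1_fin p G : P p -> A p G -> I1 p G \is a fin_num.
Proof.
move=> hp hG; rewrite ge0_fin_numE ?I1_ge0//.
have := E1_fin hp; rewrite ge0_fin_numE ?E1_ge0//; apply: le_lt_trans.
by apply: esum_term_le => // j; exact: I1_ge0.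
Qed.

Let g_integrable p G : P p -> A p G -> mu.-integrable (dom p G) (EFin \o g p G).
Proof.
move=> hp hG; apply/integrableP; split; first by apply/measurable_EFinP; exact: mg.
have := I1_fin hp hG; rewrite ge0_fin_numE ?I1_ge0//; apply: le_lt_trans.
rewrite le_eqVlt; apply/orP; left; apply/eqP; apply: eq_integral => t.
by rewrite inE => ht; rewrite /= ger0_norm// g0.
Qed.

Lemma Wh_cinteg h p G : admissible h -> P p -> A p G ->
  cinteg (dom p G) (fun t => W p G t * h (p, G, t)).
Proof.
move=> [mh [M M0 hM]] hp hG; have mD := mdom hp hG.
apply: (@cinteg_dominated _ _ (fun t => M * g p G t)) => //.
- by apply: cmeasM => //; [exact: mW|exact: mh].
- have := integrableZl mD M (g_integrable hp hG).
  by apply: eq_integrable.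
- move=> t ht; rewrite cmodM mulrC; apply: ler_pM; rewrite ?cmod_ge0//.
    by apply: hM; split.
  exact: Wg.
Qed.

Let bnd h (M : R) := forall x, family_support x -> cmod (h x) <= M.

Let arc_bound h (M : R) p G : 0 <= M -> admissible h -> bnd h M -> P p -> A p G ->
  cmod (cintegral (dom p G) (fun t => W p G t * h (p, G, t)))
    <= 2 * M * fine (I1 p G).
Proof.
move=> M0 ah hM hp hG; have mD := mdom hp hG.
have gi := g_integrable hp hG.
have := @cintegral_bound _ _ _ (fun t => M * g p G t) mD (Wh_cinteg ah hp hG).
rewrite RintegralZl// mulrA; apply.
  by have := integrableZl mD M gi; apply: eq_integrable.
move=> t ht; rewrite cmodM mulrC; apply: ler_pM; rewrite ?cmod_ge0//.
  by apply: hM; split.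
exact: Wg.
Qed.

Let esum_I1 p (s : R) : 0 <= s -> P p ->
  (\esum_(G in A p) (s * fine (I1 p G))%:E = (s * fine (E1 p))%:E)%E.
Proof.
move=> s0 hp; rewrite esum_scale//; last first.
  by move=> G hG; rewrite fine_ge0// I1_ge0.
rewrite EFinM fineK ?E1_fin//; congr (_ * _)%E; apply: eq_esum => G hG.
by rewrite fineK// I1_fin.
Qed.

Lemma arcs_csummable h p : admissible h -> P p ->
  csummable (A p) (fun G => cintegral (dom p G) (fun t => W p G t * h (p, G, t))).
Proof.
move=> ah hp; have [_ [M M0 hM]] := ah.
have M20 : 0 <= 2 * M by rewrite mulr_ge0.
apply: (@le_lt_trans _ _ (\esum_(G in A p) (2 * M * fine (I1 p G))%:E)%E).
  by apply: le_esum => G hG; rewrite lee_fin; exact: arc_bound.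
by rewrite esum_I1// ltry.
Qed.

Let pair_bound h (M : R) p : 0 <= M -> admissible h -> bnd h M -> P p ->
  cmod (k0 * csum (A p) (fun G =>
    cintegral (dom p G) (fun t => W p G t * h (p, G, t))))
  <= 4 * M * (cmod k0 * fine (E1 p)).
Proof.
move=> M0 ah hM hp; rewrite cmodM.
have := csum_bound (arcs_csummable ah hp).
have M20 : 0 <= 2 * M by rewrite mulr_ge0.
have le : (\esum_(G in A p) (cmod (cintegral (dom p G)
    (fun t => W p G t * h (p, G, t))))%:E <= (2 * M * fine (E1 p))%:E)%E.
  by rewrite -esum_I1//; apply: le_esum => G hG; rewrite lee_fin; exact: arc_bound.
move=> /le_trans/(_ (_ : _ <= 2 * (2 * M * fine (E1 p)))) h2.
rewrite [leRHS](_ : _ = cmod k0 * (2 * (2 * M * fine (E1 p)))); last by ring.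
rewrite ler_pM2l//; apply: h2; rewrite ler_pM2l//.
rewrite -lee_fin fineK//; apply: esum_pos_fin; last exact: le_lt_trans le (ltry _).
by move=> G _; exact: cmod_ge0.
Qed.

Let tot := fine (\esum_(p in P) ((cmod k0)%:E * E1 p)%E).

Let esum_E1 (s : R) : 0 <= s ->
  (\esum_(p in P) (s * (cmod k0 * fine (E1 p)))%:E = (s * tot)%:E)%E.
Proof.
move=> s0; rewrite esum_scale//; last first.
  by move=> p hp; rewrite mulr_ge0 ?cmod_ge0// fine_ge0// E1_ge0.
rewrite EFinM /tot fineK.
  congr (_ * _)%E; apply: eq_esum => p hp.
  by rewrite EFinM fineK// E1_fin.
rewrite ge0_fin_numE//; apply: esum_ge0 => p hp.
by rewrite mule_ge0 ?E1_ge0// lee_fin ltW.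
Qed.

Lemma pairs_csummable h : admissible h ->
  csummable P (fun p => k0 * csum (A p) (fun G =>
    cintegral (dom p G) (fun t => W p G t * h (p, G, t)))).
Proof.
move=> ah; have [_ [M M0 hM]] := ah.
have M40 : 0 <= 4 * M by rewrite mulr_ge0.
apply: (@le_lt_trans _ _ (\esum_(p in P) (4 * M * (cmod k0 * fine (E1 p)))%:E)%E).
  by apply: le_esum => p hp; rewrite lee_fin; exact: pair_bound.
by rewrite esum_E1// ltry.
Qed.

(** The constant 8 is three factors 2: one for the integral and one for each of
    the two sums, each bounded through real and imaginary parts. *)
Lemma functional_bound h (M : R) : 0 <= M -> admissible h ->
  (forall x, family_support x -> cmod (h x) <= M) ->
  cmod (family_functional h) <= 8 * tot * M.
Proof.
move=> M0 ah hM; have M40 : 0 <= 4 * M by rewrite mulr_ge0.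
apply: (le_trans (csum_bound (pairs_csummable ah))).
rewrite (_ : 8 * tot * M = 2 * (4 * M * tot)); last by ring.
rewrite ler_pM2l// -lee_fin -esum_E1// fineK; last first.
  apply: esum_pos_fin; first by move=> p _; exact: cmod_ge0.
  exact: pairs_csummable.
by apply: le_esum => p hp; rewrite lee_fin; exact: pair_bound.
Qed.

Lemma functional_mass_ge0 : 0 <= 8 * tot.
Proof.
rewrite mulr_ge0// fine_ge0//; apply: esum_ge0 => p hp.
by rewrite mule_ge0 ?E1_ge0// lee_fin ltW.
Qed.

Lemma functional_linear (a b : C) h k : admissible h -> admissible k ->
  admissible (fun x => a * h x + b * k x) /\
  family_functional (fun x => a * h x + b * k x) =
  a * family_functional h + b * family_functional k.
Proof.
move=> ah ak; have [mh [M M0 hM]] := ah; have [mk [N N0 kN]] := ak.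
have alin : admissible (fun x => a * h x + b * k x).
  split.
    move=> p G hp hG; have mD := mdom hp hG.
    apply: cmeasD; (apply: cmeasM; [exact: mD|exact: cmeas_cst|]).
      exact: mh.
    exact: mk.
  exists (cmod a * M + cmod b * N).
    by rewrite addr_ge0// mulr_ge0// cmod_ge0.
  move=> x hx; apply: (le_trans (cmodD _ _)); rewrite !cmodM.
  by apply: lerD; rewrite ler_wpM2l ?cmod_ge0//; [exact: hM|exact: kN].
split=> //; rewrite /family_functional.
have sh := pairs_csummable ah; have sk := pairs_csummable ak.
have scal (c : C) (T : choiceType) (D : set T) (u : T -> C) :
    csummable D u -> csummable D (fun i => c * u i).
  move=> hu; rewrite /csummable.
  rewrite (eq_esum (b := fun i => (cmod c * cmod (u i))%:E)); last first.
    by move=> i _; rewrite cmodM.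
  rewrite esum_scale ?cmod_ge0//; last by move=> i _; exact: cmod_ge0.
  have := esum_pos_fin (fun i _ => cmod_ge0 (u i)) hu.
  by move=> /fineK <-; rewrite -EFinM ltry.
rewrite -(csumZ a sh) -(csumZ b sk) -csumD; [|exact: scal..].
apply: eq_csum => p hp.
have th := arcs_csummable ah hp; have tk := arcs_csummable ak hp.
rewrite mulrCA [b * _]mulrCA -mulrDr; congr (_ * _).
rewrite -(csumZ a th) -(csumZ b tk) -csumD; [|exact: scal..].
apply: eq_csum => G hG; have mD := mdom hp hG.
have ih := Wh_cinteg ah hp hG; have ik := Wh_cinteg ak hp hG.
rewrite -(cintegralZ a mD ih) -(cintegralZ b mD ik) -cintegralD//; try exact: cintegZ.
by apply: eq_cintegral => t _; ring.
Qed.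

(** A weight may be badly behaved where a factor of it vanishes; only the rest of
    the domain matters for measurability. *)
Lemma cmeas_if (D : set R) (act : R -> bool) (k : R -> C) : mset D ->
  mset (D `&` [set t | act t]) ->
  (forall t, D t -> act t -> {for t, continuous k}) ->
  cmeas D (fun t => if act t then k t else 0).
Proof.
move=> mD mA ck.
have [k1 k2] : cmeas (D `&` [set t | act t]) k.
  by apply: cmeas_cont => // t [Dt at_]; exact: ck.
have ma : measurable_fun (D : set (measurableTypeR R)) act.
  by apply: (measurable_fun_bool true) => //.
split.
  have -> : (fun t => Re (if act t then k t else 0)) =
     (fun t => if act t then Re (k t) else 0).
    by apply/funext => t; case: ifP.
  by apply: measurable_fun_if.
have -> : (fun t => Im (if act t then k t else 0)) =
   (fun t => if act t then Im (k t) else 0).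
  by apply/funext => t; case: ifP.
by apply: measurable_fun_if.
Qed.

(** The Cauchy transform of the family, cut off by [act] to arcs that stay at
    distance [q] from [z], is holomorphic near [z]. *)
Section CauchyKernel.
Variables (gam : T2 -> R -> C) (act : T1 * T2 * R -> bool) (z : C) (q : R).
Hypothesis q0 : 0 < q.
Hypothesis cgam : forall p G t, P p -> A p G -> dom p G t ->
  {for t, continuous (gam G)}.
Hypothesis mact : forall p G, P p -> A p G ->
  mset (dom p G `&` [set t | act (p, G, t)]).
Hypothesis far : forall x, family_support x -> act x ->
  q <= cmod (gam x.1.2 x.2 - z).

Definition cut_kernel n (w : C) (x : T1 * T2 * R) : C :=
  if act x then (gam x.1.2 x.2 - w) ^- n else 0.

Lemma cut_kernel_admissible n w : cmod (w - z) < q / 2 ->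
  admissible (cut_kernel n w).
Proof.
move=> wz; have q2 : 0 < q / 2 by rewrite divr_gt0.
have farw x : family_support x -> act x -> q / 2 <= cmod (gam x.1.2 x.2 - w).
  move=> hx ax; have := far hx ax.
  by have := cmod_triangle w (gam x.1.2 x.2) z; lra.
split.
  move=> p G hp hG; apply: cmeas_if; [exact: mdom|exact: mact|].
  move=> t ht at_.
  have cf : {for gam G t, continuous (fun u : C => (u - w) ^- n)}.
    apply: contV; last first.
      by apply: contX; apply: contB; [exact: cont_id|exact: cont_cst].
    rewrite expf_neq0//; apply: (far_neq0 q2).
    by apply: (farw (p, G, t)).
  exact: (@continuous_comp _ _ _ (gam G) _ t (cgam hp hG ht) cf).
exists ((q / 2)^-1 ^+ n); first by rewrite exprn_ge0// invr_ge0 ltW.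
move=> x hx; rewrite /cut_kernel; case: ifP => ax; last first.
  by rewrite cmod0 exprn_ge0// invr_ge0 ltW.
rewrite -exprVn cmodX; apply: lerXn2r; rewrite ?nnegrE ?cmod_ge0//.
  by rewrite invr_ge0 ltW.
by apply: inv_far => //; exact: farw.
Qed.

Lemma cut_kernel_holo :
  exists d, cder (fun w => family_functional (cut_kernel 1 w)) z d.
Proof.
exists (family_functional (cut_kernel 2 z)).
apply: (@cder_functional _ _ admissible family_functional family_support
  (8 * tot) (cut_kernel 1) (cut_kernel 2 z) z (q / 2) (2 / q ^+ 3)).
- by rewrite divr_gt0.
- exact: functional_mass_ge0.
- by rewrite divr_ge0// exprn_ge0// ltW.
- by move=> a b k l; exact: functional_linear.
- by move=> k M; exact: functional_bound.
- by move=> w; exact: cut_kernel_admissible.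
- by apply: cut_kernel_admissible; rewrite subrr cmod0 divr_gt0.
- move=> w x wz hx; rewrite /cut_kernel; case: ifP => ax; last first.
    by rewrite subrr mulr0 subr0 cmod0 mulr_ge0 ?sqr_ge0// divr_ge0// exprn_ge0// ltW.
  by rewrite expr1; apply: inv_expansion => //; exact: far.
Qed.

End CauchyKernel.

End WeightedFamily.

(** * Local charts of a holomorphic map *)

Section LocalChart.
Variable R : realType.
Local Notation C := R[i].
Implicit Types (g h : C -> C) (z w : C).

(** Bisection of an interval, as bisection of a degenerate rectangle. *)
Lemma interval_induction (P : R -> R -> Prop) :
  (forall c d, 0 <= c -> c <= d -> d <= 1 ->
     P c ((c + d) / 2) -> P ((c + d) / 2) d -> P c d) ->
  (forall s, 0 <= s <= 1 -> exists2 r : R, 0 < r & forall c d,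
     0 <= c -> d <= 1 -> c <= s <= d -> d - c < r -> P c d) ->
  P 0 1.
Proof.
move=> hhalf hloc.
apply: (@rect_induction _ (fun _ _ c d => P c d) 0 0 0 1) => //.
- by move=> a b c d _ cd _ _ c0 d1 p1 _ p2 _; exact: hhalf.
- move=> z [_ hz]; have [r r0 hr] := hloc _ hz; exists r => //.
  by move=> a b c d _ cd _ _ c0 d1 [_ zcd] _ dr; exact: hr.
Qed.

Lemma disc_convex p (r s : R) z w : disc p r z -> disc p r w -> 0 <= s <= 1 ->
  disc p r (z + s%:C%C * (w - z)).
Proof.
move=> hz hw /andP[s0 s1]; rewrite /disc /=.
have -> : z + s%:C%C * (w - z) - p = (1 - s)%:C%C * (z - p) + s%:C%C * (w - p).
  by rewrite rmorphB rmorph1; ring.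
apply: (le_lt_trans (cmodD _ _)); rewrite !cmodM !cmod_real.
rewrite !ger0_norm ?subr_ge0//.
have [->|s_neq0] := eqVneq s 0; first by rewrite mul0r subr0 mul1r addr0.
have {s_neq0}s_gt0 : 0 < s by rewrite lt_neqAle eq_sym s_neq0.
have h1 : (1 - s) * cmod (z - p) <= (1 - s) * r.
  by rewrite ler_wpM2l ?subr_ge0// ltW.
have h2 : s * cmod (w - p) < s * r by rewrite ltr_pM2l.
lra.
Qed.

(** Bisection again: on a short piece of the segment from [w] to [z] about the
    point [gam s], the increment of [g] is close to its linear part. *)
Lemma mean_value_ineq g p (r M : R) z w : holomorphic_on (disc p r) g ->
  (forall u, disc p r u -> cmod (derive1 g u) <= M) ->
  disc p r z -> disc p r w -> cmod (g z - g w) <= M * cmod (z - w).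
Proof.
move=> hg hM hz hw.
pose gam (s : R) := w + s%:C%C * (z - w).
have g0 : gam 0 = w by rewrite /gam mul0r addr0.
have g1 : gam 1 = z by rewrite /gam mul1r addrC subrK.
have hgam s : 0 <= s <= 1 -> disc p r (gam s).
  by move=> hs; exact: disc_convex.
apply/ler_addgt0Pr => e e0.
set L := cmod (z - w); have L0 : 0 <= L by exact: cmod_ge0.
have L1 : 0 < L + 1 by lra.
suff : cmod (g (gam 1) - g (gam 0)) <= (M * L + e) * (1 - 0).
  by rewrite g0 g1 subr0 mulr1.
apply: (@interval_induction (fun c d =>
  cmod (g (gam d) - g (gam c)) <= (M * L + e) * (d - c))).
- move=> c d c0 cd d1 h1 h2.
  apply: (le_trans (cmod_triangle (g (gam ((c + d) / 2))) _ _)).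
  apply: (le_trans (lerD h2 h1)).
  by rewrite le_eqVlt; apply/orP; left; apply/eqP; field.
move=> s hs; have hgs := hgam s hs.
have e1 : 0 < e / (L + 1) by rewrite divr_gt0.
have [q q0 hq] := (cderP _ _ _).1 (holo_cder hg hgs) _ e1.
exists (q / (L + 1)); first by rewrite divr_gt0.
move=> c d c0 d1 /andP[cs sd] dc.
have dist t : gam t - gam s = (t - s)%:C%C * (z - w).
  by rewrite /gam rmorphB; ring.
have near t : `|t - s| <= d - c -> cmod (g (gam t) - g (gam s) -
    derive1 g (gam s) * (gam t - gam s)) <= e / (L + 1) * (`|t - s| * L).
  move=> ts; have := hq (gam t); rewrite dist cmodM cmod_real; apply.
  move: dc; rewrite ltr_pdivlMr//; apply: le_lt_trans.
  by apply: ler_pM => //; rewrite lerDl.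
have nd := near d; have nc := near c.
have ed : `|d - s| = d - s by rewrite ger0_norm// subr_ge0.
have ec : `|c - s| = s - c by rewrite distrC ger0_norm// subr_ge0.
rewrite ed in nd; rewrite ec in nc.
have {}nd := nd ltac:(lra); have {}nc := nc ltac:(lra).
have -> : g (gam d) - g (gam c) =
    (g (gam d) - g (gam s) - derive1 g (gam s) * (gam d - gam s)) -
    (g (gam c) - g (gam s) - derive1 g (gam s) * (gam c - gam s)) +
    derive1 g (gam s) * ((d - c)%:C%C * (z - w)).
  by rewrite !dist !rmorphB; ring.
apply: (le_trans (cmodD _ _)); apply: (le_trans (lerD (cmodB _ _) (lexx _))).
rewrite !cmodM cmod_real -/L.
have -> : `|d - c| = d - c by rewrite ger0_norm//; lra.
have h3 : cmod (derive1 g (gam s)) * ((d - c) * L) <= M * ((d - c) * L).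
  by rewrite ler_wpM2r ?hM// mulr_ge0//; lra.
apply: (le_trans (lerD (lerD nd nc) h3)).
have -> : e / (L + 1) * ((d - s) * L) + e / (L + 1) * ((s - c) * L) +
  M * ((d - c) * L) = M * L * (d - c) + e * (d - c) * (L / (L + 1)).
  by field; rewrite gt_eqF.
rewrite mulrDl lerD2l ler_piMr//; last by rewrite ler_pdivrMr// mul1r; lra.
by rewrite mulr_ge0//; lra.
Qed.

(** Quantitative injectivity and openness: all that a holomorphic inverse would be
    used for, without constructing it. *)
Definition chart g z0 (d m : R) : Prop :=
  [/\ 0 < d, 0 < m, holomorphic_on (disc z0 d) g,
    forall z w, disc z0 d z -> disc z0 d w -> m * cmod (z - w) <= cmod (g z - g w) &
    forall z (s : R), 0 < s -> square z s `<=` disc z0 d ->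
      forall y, cmod (y - g z) < m * s / 2 -> exists2 w, square z s w & g w = y].

Lemma chart_inj g z0 d m z w : chart g z0 d m -> disc z0 d z -> disc z0 d w ->
  g z = g w -> z = w.
Proof.
move=> [d0 m0 _ lip _] hz hw e; have := lip z w hz hw.
rewrite e subrr cmod0 pmulr_rle0// => h.
by apply/eqP; rewrite -subr_eq0 -cmod_eq0 eq_le h cmod_ge0.
Qed.

Lemma chart_shrink g z0 (d d' m : R) : 0 < d' -> d' <= d -> chart g z0 d m ->
  chart g z0 d' m.
Proof.
move=> d'0 dd [d0 m0 hg lip onto]; split=> //.
- exact: (holoS (disc_sub dd) hg).
- by move=> z w /(disc_sub dd) hz /(disc_sub dd) hw; exact: lip.
- by move=> z s s0 hs; apply: onto => // u /hs; exact: disc_sub.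
Qed.

(** With [a] the modulus of the derivative at [z0], the difference of [g] and its
    linear part is Lipschitz with constant [a / 2] near [z0], so [g] expands
    distances by at least [a / 2].  Surjectivity is the maximum principle for
    [1 / (g - y)]: if [g] omitted [y] on the square, this function would be smaller
    on the boundary of the square than at its centre. *)
Lemma local_chart (O : set C) g z0 : open O -> O z0 -> holomorphic_on O g ->
  derive1 g z0 != 0 ->
  exists d m, chart g z0 d m /\ disc z0 d `<=` O.
Proof.
move=> oO Oz hg dg; pose a := cmod (derive1 g z0).
have a0 : 0 < a by rewrite cmod_gt0.
have a4 : 0 < a / 2 by rewrite divr_gt0.
have /cont_discP/(_ _ a4)[r1 r10 hr1] := holo_cont (holo_derive oO hg) Oz.
have /open_discP/(_ _ Oz)[r2 r20 hr2] := oO.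
pose d := Num.min r1 r2; have d0 : 0 < d by rewrite lt_min r10.
have dO : disc z0 d `<=` O.
  by move=> z; rewrite /disc /= lt_min => /andP[_ /hr2].
have hgd : holomorphic_on (disc z0 d) g by exact: holoS dO hg.
pose h z := g z - derive1 g z0 * z.
have dh z : disc z0 d z -> cder h z (derive1 g z - derive1 g z0 * 1).
  move=> hz; apply: cderB; first exact: (holo_cder hgd hz).
  by apply: cderZ; exact: cder_id.
have hh : holomorphic_on (disc z0 d) h.
  by apply/holoP => z hz; eexists; exact: dh.
have hM z : disc z0 d z -> cmod (derive1 h z) <= a / 2.
  move=> hz; have [_ ->] := cder_derivable (dh z hz); rewrite mulr1 ltW//.
  by apply: hr1; move: hz; rewrite /disc /= lt_min => /andP[].
have lip z w : disc z0 d z -> disc z0 d w ->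
    a / 2 * cmod (z - w) <= cmod (g z - g w).
  move=> hz hw; have := mean_value_ineq hh hM hz hw.
  have -> : h z - h w = (g z - g w) - derive1 g z0 * (z - w) by rewrite /h; ring.
  have := cmod_lower (derive1 g z0 * (z - w)) (g z - g w).
  by rewrite (cmodBC (derive1 g z0 * (z - w))) cmodM -/a; lra.
exists d, (a / 2); split=> //; split=> // z s s0 hs y hy.
apply: contrapT => nex.
have ne w : square z s w -> g w - y != 0.
  by move=> hw; rewrite subr_eq0; apply/eqP => e; apply: nex; exists w.
have oz := orect_square z s0.
have dz : disc z0 d z by apply: hs; exact: orect_crect.
have ms : 0 < a / 2 * s / 2 by rewrite !mulr_gt0.
have hd w : square z s w -> exists d, cder (fun w => (g w - y)^-1) w d.
  move=> hw; eexists; apply: (cderV (g := fun w => g w - y)); first exact: ne.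
  by apply: cderB; [exact: (holo_cder hgd (hs _ hw))|exact: cder_cst].
have edge w : redge (Re z - s) (Re z + s) (Im z - s)
    (Im z + s) w -> cmod (g w - y)^-1 <= (a / 2 * s / 2)^-1.
  move=> [hw no]; apply: inv_far => //.
  have zw : s <= cmod (w - z).
    by rewrite leNgt; apply/negP => us; apply: no; exact: disc_orect.
  have h1 := lip w z (hs _ hw) dz.
  have h2 : a / 2 * s <= a / 2 * cmod (w - z) by rewrite ler_pM2l.
  by have := cmod_triangle y (g w) (g z); lra.
have := maximum_rect oz hd (ltW _) edge; rewrite invr_gt0 => /(_ ms).
rewrite cmodV lef_pV2 ?posrE// ?cmod_gt0 ?ne//; last exact: orect_crect.
by rewrite cmodBC leNgt hy.
Qed.

End LocalChart.

(** * Partitions near a regular point of an arc *)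

Section LocalStructure.
Variables (R : realType) (Omega : set R[i]) (Xi : set (set R[i])).
Local Notation C := R[i].
Variable arcs : set C -> set (C -> C).
Hypothesis part : is_partition Omega Xi arcs.
Local Notation bd := (boundary Omega).
Local Notation dX := (dXi Omega Xi).
Local Notation reg := (regular_points Omega Xi).

Lemma element_eq U V x : Xi U -> Xi V -> U x -> V x -> U = V.
Proof.
move=> XU XV Ux Vx; apply: contrapT => UV.
have := element_disjoint part XU XV UV.
by move=> /seteqP[/(_ x) h _]; apply: h.
Qed.

Lemma element_sub U : Xi U -> U `<=` Omega.
Proof. by move=> /(element_open part)[]. Qed.

Lemma element_not_dXi U x : Xi U -> U x -> ~ dX x.
Proof.
move=> XU Ux [V XV [_ [cV iV]]].
have [oU _] := element_open part XU.
have [y [Vy Uy]] := cV _ (open_nbhs_nbhs (conj oU Ux)).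
have VU := element_eq XV XU Vy Uy; apply: iV; rewrite VU.
exact: (open_nbhs_nbhs (conj oU Ux)).
Qed.

Lemma in_element x : Omega x -> ~ dX x -> exists2 U, Xi U & U x.
Proof.
move=> Ox nx; have := element_cover part.
move=> /seteqP[_ /(_ x Ox)[U XU [_ cU]]]; exists U => //.
apply: contrapT => nU; apply: nx; exists U => //; split=> //; split=> //.
by move=> /interior_subset.
Qed.

Lemma closure_boundary U x : Omega x -> closure U x -> ~ U x -> bd U x.
Proof. by move=> Ox cU nU; split=> //; split=> // /interior_subset. Qed.

(** The elements being open and disjoint, the one containing the path is locally
    constant along it. *)
Lemma path_in_element (gam : R -> C) U :
  (forall s, 0 <= s <= 1 -> {for s, continuous gam}) ->
  (forall s, 0 <= s <= 1 -> Omega (gam s) /\ ~ dX (gam s)) ->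
  Xi U -> U (gam 0) -> U (gam 1).
Proof.
move=> cgam hgam.
suff : forall U, Xi U -> U (gam 0) -> U (gam 1) by apply.
apply: (@interval_induction _ (fun c d => forall U, Xi U -> U (gam c) -> U (gam d))).
  by move=> c d _ _ _ h1 h2 V XV /(h1 _ XV)/(h2 _ XV).
move=> s hs; have [Os ns] := hgam s hs; have [V XV Vs] := in_element Os ns.
have [oV _] := element_open part XV.
have /nbhs_discP[e e0 he] : nbhs (gam s) V by exact: open_nbhs_nbhs.
have /contR_discP/(_ _ e0)[r r0 hr] := cgam s hs; exists r => //.
move=> c d c0 d1 /andP[cs sd] dc W XW Wc.
have Vc : V (gam c).
  by apply/he/hr; rewrite distrC ger0_norm ?subr_ge0//; lra.
rewrite (element_eq XW XV Wc Vc); apply/he/hr.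
by rewrite ger0_norm ?subr_ge0//; lra.
Qed.

Lemma segment_in_element (g : C -> C) (A : set C) z w U :
  (forall u, A u -> {for u, continuous g}) ->
  (forall s : R, 0 <= s <= 1 -> A (z + s%:C%C * (w - z))) ->
  (forall u, A u -> Omega (g u) /\ ~ dX (g u)) ->
  Xi U -> U (g z) -> U (g w).
Proof.
move=> cg hA hg XU Uz.
pose gam (s : R) := g (z + s%:C%C * (w - z)).
have e0 : gam 0 = g z by rewrite /gam mul0r addr0.
have e1 : gam 1 = g w by rewrite /gam mul1r addrC subrK.
rewrite -e1; apply: (path_in_element (gam := gam)) => //; last by rewrite e0.
- move=> s hs; apply: (@continuous_comp _ _ _ (fun s : R => z + s%:C%C * (w - z)) g);
    last by apply: cg; exact: hA.
  apply/contR_discP => e e_gt0.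
  have L1 : 0 < cmod (w - z) + 1 by rewrite ltr_wpDl// cmod_ge0.
  exists (e / (cmod (w - z) + 1)); first by rewrite divr_gt0.
  move=> t ts.
  have -> : z + t%:C%C * (w - z) - (z + s%:C%C * (w - z)) = (t - s)%:C%C * (w - z).
    by rewrite rmorphB; ring.
  rewrite cmodM cmod_real; move: ts; rewrite ltr_pdivlMr//; apply: le_lt_trans.
  by rewrite ler_wpM2l// lerDl.
- by move=> s hs; apply: hg; exact: hA.
Qed.

Lemma regular_nbhd x : reg x -> exists2 r : R, 0 < r &
  disc x r `<=` Omega /\ forall y, disc x r y -> dX y -> reg y.
Proof.
move=> [dx [A [oA AO Ax hl]]].
have /open_discP/(_ x Ax)[r r0 hr] := oA; exists r => //; split.
  by move=> y /hr /AO.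
move=> y /hr Ay dy; split=> //; exists A; split=> //.
Qed.

(** An injective path in a set homeomorphic to a line is open in it: by the
    intermediate value theorem it covers an interval of the line. *)
Lemma path_open_in_line (S : set C) (gam : R -> C) (a b c : R) :
  homeomorphic_to_line S -> a < c -> c < b ->
  (forall t, a <= t <= b -> {for t, continuous gam}) ->
  (forall t, a <= t <= b -> S (gam t)) ->
  (forall s t, a <= s <= b -> a <= t <= b -> gam s = gam t -> s = t) ->
  exists2 r : R, 0 < r & forall y, S y -> disc (gam c) r y ->
    exists2 t, a <= t <= b & y = gam t.
Proof.
move=> [phi [psi [cphi rphi phiK cpsi]]] ac cb cgam Sgam inj.
have psiK y : S y -> phi (psi y) = y.
  by rewrite -rphi => -[t _ <-]; rewrite phiK.
have mem t : (t \in `[a, b]) = (a <= t <= b) by rewrite in_itv.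
have wpsi : forall y, S y -> psi x @[x --> within S (nbhs y)] --> psi y.
  by apply/subspace_continuousP.
pose u t := psi (gam t).
have cu : {within `[a, b], continuous u}.
  apply/subspace_continuousP => t; rewrite /= mem => ht.
  have h := wpsi _ (Sgam t ht).
  move=> V /h; rewrite /= /within /= nbhs_simpl /= => hV.
  have := cgam t ht _ hV; rewrite /= nbhs_simpl /=.
  apply: filterS => s hs; rewrite /= mem => hs'; apply: hs; exact: Sgam.
have iu : {in `[a, b] &, injective u}.
  move=> s t; rewrite !mem => hs ht e; apply: inj => //.
  by rewrite -(psiK _ (Sgam s hs)) -(psiK _ (Sgam t ht)) -/(u s) e.
have ab : a <= b by lra.
have ain : a \in `[a, b] by rewrite mem lexx ab.
have bin : b \in `[a, b] by rewrite mem lexx ab.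
have cin : c \in `[a, b] by rewrite mem !ltW.
have [e e0 he] : exists2 e : R, 0 < e & forall v, `|v - u c| < e ->
    Num.min (u a) (u b) <= v <= Num.max (u a) (u b).
  have [uab|/ltW uba] := leP (u a) (u b).
    have mono := segment_continuous_inj_le uab cu iu.
    have u1 : u a < u c by rewrite ltNge mono// -ltNge.
    have u2 : u c < u b by rewrite ltNge mono// -ltNge.
    exists (Num.min (u c - u a) (u b - u c)); first by rewrite lt_min !subr_gt0 u1.
    move=> v; rewrite lt_min !ltr_norml => /andP[/andP[? ?] /andP[? ?]].
    by apply/andP; split; lra.
  have mono := segment_continuous_inj_ge uba cu iu.
  have u1 : u c < u a by rewrite ltNge mono// -ltNge.
  have u2 : u b < u c by rewrite ltNge mono// -ltNge.
  exists (Num.min (u c - u b) (u a - u c)); first by rewrite lt_min !subr_gt0 u2.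
  move=> v; rewrite lt_min !ltr_norml => /andP[/andP[? ?] /andP[? ?]].
  by apply/andP; split; lra.
have Sc : S (gam c) by apply: Sgam; rewrite !ltW.
have : nbhs (psi (gam c)) (ball (psi (gam c)) e) by exact: nbhsx_ballx.
move=> /(wpsi _ Sc); rewrite /= nbhs_simpl /= => /nbhs_discP[r r0 hr].
exists r => // y Sy ry; have {hr}ye : `|psi (gam c) - psi y| < e by exact: hr.
rewrite distrC in ye.
have [t tin ut] := IVT ab cu (he _ ye); exists t; first by rewrite -mem.
rewrite -(psiK _ Sy) -ut /u psiK//; apply: Sgam; by rewrite -mem.
Qed.

Lemma Re_real (t : R) : Re t%:C%C = t. Proof. by []. Qed.

Lemma real_of_Im0 (z : C) : Im z = 0 -> z = (Re z)%:C%C.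
Proof. by case: z => a b /= ->. Qed.

Lemma boundary_dXi U x : Xi U -> bd U x -> dX x.
Proof. by move=> XU bx; exists U. Qed.

Lemma arc_boundary U G t : Xi U -> arcs U G -> 0 <= t <= 1 -> bd U (G t%:C%C).
Proof.
by move=> XU hG ht; apply: (arc_sub (element_boundary part XU)).
Qed.

Lemma real_cont (G : C -> C) (t : R) : {for t%:C%C, continuous G} ->
  {for t, continuous (fun s : R => G s%:C%C)}.
Proof.
move=> /cont_discP cG; apply/contR_discP => e e0.
have [r r0 hr] := cG _ e0; exists r => // s sr; apply: hr.
by rewrite -rmorphB cmod_real.
Qed.

(** In the chart given by [G] at [t0], the boundary of the partition is the real
    axis; [P] and [Q], possibly equal, are the elements on its left and right. *)
Definition arc_chart (G : C -> C) (t0 d m : R) (P Q : set C) : Prop :=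
  [/\ chart G t0%:C%C d m, 0 < t0 - d /\ t0 + d < 1, Xi P, Xi Q &
   forall z, disc t0%:C%C d z -> [/\ Omega (G z), dX (G z) <-> Im z = 0,
     0 < Im z -> P (G z) & Im z < 0 -> Q (G z)]].

Lemma arc_chart_shrink G t0 d d' m P Q : 0 < d' -> d' <= d ->
  arc_chart G t0 d m P Q -> arc_chart G t0 d' m P Q.
Proof.
move=> d'0 dd [ch [h1 h2] XP XQ h]; split; [| |exact: XP|exact: XQ|].
- exact: (chart_shrink d'0 dd ch).
- by split; lra.
- by move=> z hz; apply: h; exact: disc_sub dd _ hz.
Qed.

Lemma convex_pos (s a b : R) : 0 <= s -> s <= 1 -> 0 < a -> 0 < b ->
  0 < (1 - s) * a + s * b.
Proof.
move=> s0 s1 a0 b0; have [->|s_neq0] := eqVneq s 0.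
  by rewrite mul0r subr0 mul1r addr0.
have s_gt0 : 0 < s by rewrite lt_neqAle eq_sym s_neq0.
by rewrite ltr_wpDl ?mulr_gt0// mulr_ge0 ?subr_ge0// ltW.
Qed.

(** Near a regular point the boundary of the partition is a topological line, and
    the arc, being injective, covers that line near the point.  Hence the chart
    maps no point off the real axis into the boundary, and each half of the disc,
    being convex, is mapped into one element. *)
Lemma arc_structure U G t0 : Xi U -> arcs U G -> 0 < t0 < 1 ->
  derive1 G t0%:C%C != 0 -> reg (G t0%:C%C) ->
  exists d m P Q, arc_chart G t0 d m P Q.
Proof.
move=> XU hG /andP[t00 t01] dG rx.
have ba := element_boundary part XU.
have [B [oB segB hB]] := arc_holomorphic ba hG.
have Bt0 : B t0%:C%C by apply: segB; rewrite in_itv /= !ltW.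
have [d0 [m [ch dB]]] := local_chart oB Bt0 hB dG.
have [d00 m0 hGd _ _] := ch.
move: (rx) => [dx [A [oA AO Ax hl]]].
have cG z : disc t0%:C%C d0 z -> {for z, continuous G}.
  exact: holo_cont hGd.
have /open_discP/(_ _ Ax)[rA rA0 hrA] := oA.
have /cont_discP/(_ _ rA0)[d1 d10 hd1] := cG _ (disc_center _ d00).
pose d2 := Num.min (Num.min d0 d1) (Num.min t0 (1 - t0)).
have d20 : 0 < d2 by rewrite !lt_min d00 d10 t00 subr_gt0 t01.
have [d2d0 d2d1 d2t d2t'] : [/\ d2 <= d0, d2 <= d1, d2 <= t0 & d2 <= 1 - t0].
  by rewrite /d2; split; rewrite !ge_min lexx ?orbT.
pose a := d2 / 2; have a0 : 0 < a by rewrite divr_gt0.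
have ad2 : a < d2 by rewrite /a; lra.
have real_disc (t : R) : t0 - a <= t <= t0 + a -> disc t0%:C%C d2 t%:C%C.
  move=> /andP[? ?]; rewrite /disc /= -rmorphB cmod_real ltr_norml.
  by apply/andP; split; lra.
have [r r0 hr] : exists2 r : R, 0 < r & forall y, (dX `&` A) y ->
    disc (G t0%:C%C) r y -> exists2 t, t0 - a <= t <= t0 + a & y = G t%:C%C.
  apply: (path_open_in_line (gam := fun t => G t%:C%C) hl); [lra|lra|..].
  - move=> t /real_disc ht; apply: real_cont; apply: cG.
    exact: disc_sub d2d0 _ ht.
  - move=> t ht; split; last first.
      by apply: hrA; apply: hd1; exact: disc_sub d2d1 _ (real_disc t ht).
    apply: (boundary_dXi XU); apply: (arc_boundary XU hG).
    by case/andP: ht => ? ?; apply/andP; split; lra.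
  - move=> s t /real_disc hs /real_disc ht e.
    have := chart_inj ch (disc_sub d2d0 hs) (disc_sub d2d0 ht) e.
    by move=> [].
have /cont_discP/(_ _ r0)[d3 d30 hd3] := cG _ (disc_center _ d00).
pose d := Num.min a d3.
have dd0 : 0 < d by rewrite lt_min a0.
have [da dd3] : d <= a /\ d <= d3 by rewrite /d; split; rewrite ge_min lexx ?orbT.
have dd2 : d <= d2 by lra.
have inA z : disc t0%:C%C d z -> A (G z).
  by move=> hz; apply/hrA/hd1; apply: (disc_sub _ hz); lra.
have iff z : disc t0%:C%C d z -> dX (G z) <-> Im z = 0.
  move=> hz; split.
    move=> dz; have [||t ht e] := hr (G z).
    - by split=> //; exact: inA.
    - by apply/hd3; apply: (disc_sub dd3 hz).
    have hz0 : disc t0%:C%C d0 z by apply: (disc_sub _ hz); lra.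
    by rewrite (chart_inj ch hz0 (disc_sub d2d0 (real_disc t ht)) e).
  move=> /real_of_Im0 e; move: hz; rewrite e => hz.
  apply: (boundary_dXi XU); apply: (arc_boundary XU hG).
  move: hz; rewrite /disc /= -rmorphB cmod_real ltr_norml => /andP[? ?].
  by apply/andP; split; lra.
have half (sg : R) : `|sg| = 1 -> exists2 P, Xi P & forall z, disc t0%:C%C d z ->
    0 < sg * Im z -> P (G z).
  move=> sg1; pose H := disc t0%:C%C d `&` [set z | 0 < sg * Im z].
  pose z0 : C := Complex t0 (sg * (d / 2)).
  have sg2 : sg * sg = 1.
    by rewrite -expr2 -real_normK ?num_real// sg1 expr1n.
  have Hz0 : H z0.
    split; last by rewrite /= mulrA sg2 mul1r divr_gt0.
    rewrite /disc /= ; apply: (le_lt_trans (cmod_le _)) => /=.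
    by rewrite subrr normr0 add0r oppr0 addr0 normrM sg1 mul1r ger0_norm; lra.
  have HO u : H u -> Omega (G u) /\ ~ dX (G u).
    move=> [hu iu]; split; first by apply: AO; exact: inA.
    by move=> /(iff u hu) iu0; move: iu; rewrite /= iu0 mulr0 ltxx.
  have [OG nG] := HO _ Hz0; have [P XP Pz0] := in_element OG nG.
  exists P; [exact: XP|move=> z hz iz].
  apply: (segment_in_element (g := G) (A := H) _ _ HO XP Pz0).
    by move=> u [hu _]; apply: cG; apply: (disc_sub _ hu); lra.
  move=> s /andP[s0 s1]; split.
    by apply: disc_convex; [exact: (proj1 Hz0)|exact: hz|rewrite s0].
  rewrite /H /= ImD ImM Re_real ImD ImN [Im s%:C%C]/= mul0r addr0.
  rewrite [Im z0]/=.
  rewrite (_ : sg * _ = (1 - s) * (sg * sg * (d / 2)) + s * (sg * Im z));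
    last by ring.
  rewrite sg2 mul1r.
  have d2_gt0 : 0 < d / 2 by rewrite divr_gt0.
  exact: convex_pos.
have [P XP hP] := half 1 (normr1 _).
have [|Q XQ hQ] := half (-1); first by rewrite normrN normr1.
exists d, m, P, Q; split; [| |exact: XP|exact: XQ|].
- by apply: (chart_shrink dd0 _ ch); lra.
- by split; lra.
- move=> z hz; split.
  + by apply: AO; exact: inA.
  + exact: iff.
  + by move=> iz; apply: hP => //; rewrite mul1r.
  + by move=> iz; apply: hQ => //; rewrite mulN1r oppr_gt0.
Qed.

Lemma chart_nbhd G t0 d m P Q z : arc_chart G t0 d m P Q -> disc t0%:C%C d z ->
  exists2 r : R, 0 < r & forall y, disc (G z) r y ->
    exists2 w, disc t0%:C%C d w & G w = y.
Proof.
move=> [[d0 m0 _ _ onto] _ _ _ _] hz.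
have [s s0 hs] := open_square (@open_disc _ t0%:C%C d) hz.
exists (m * s / 2); first by rewrite !mulr_gt0.
move=> y yz; have [w hw <-] := onto z s s0 hs y yz.
by exists w => //; exact: hs.
Qed.

(** The chart covers a neighbourhood of [G z], in which the complement of the
    boundary is contained in [P] and [Q]. *)
Lemma chart_elements G t0 d m P Q W z : arc_chart G t0 d m P Q ->
  disc t0%:C%C d z -> Xi W -> closure W (G z) -> W = P \/ W = Q.
Proof.
move=> hc hz XW cW; have [r r0 hr] := chart_nbhd hc hz.
have [ch _ XP XQ h] := hc.
have [y [Wy ry]] := cW _ (nbhs_disc (G z) r0).
have [w hw e] := hr y ry; have [_ iff hP hQ] := h w hw.
have := element_not_dXi XW Wy; rewrite -e in Wy * => nd.
have [iw|iw|iw] := ltgtP (Im w) 0.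
- by right; apply: (element_eq XW XQ Wy); exact: hQ.
- by left; apply: (element_eq XW XP Wy); exact: hP.
- by exfalso; apply/nd/iff.
Qed.

End LocalStructure.

(** * The jump of a Cauchy integral across an analytic arc *)

Section Jump.
Variable R : realType.
Local Notation C := R[i].
Local Notation mset D := (@measurable _ (measurableTypeR R) D).

Lemma seg_cauchy (a b : R) (kap gam : R -> C) z (q : R) : a <= b -> 0 < q ->
  (forall t, a <= t <= b -> {for t, continuous kap}) ->
  (forall t, a <= t <= b -> {for t, continuous gam}) ->
  (forall t, a <= t <= b -> q <= cmod (gam t - z)) ->
  exists d, cder (fun w => cintegral `[a, b] (fun t => kap t * (gam t - w)^-1)) z d.
Proof.
move=> ab q0 ck cg far.
have mD : mset `[a, b] by exact: measurable_itv.
have [K K0 hK] : exists2 K : R, 0 <= K & forall t, a <= t <= b -> cmod (kap t) <= K.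
  pose g (z : C) := kap (Re z).
  have cgz z' : crect a b 0 0 z' -> {for z', continuous g}.
    move=> [hz _]; have /contR_discP ct := ck _ hz.
    apply/cont_discP => e e0; have [r r0 hr] := ct e e0; exists r => // w wr.
    apply: hr; apply: le_lt_trans wr; rewrite -ReN -ReD; exact: cmod_Re.
  have [M M0 hM] := bounded_rect ab (lexx 0) cgz.
  by exists M => // t ht; apply: (hM (Complex t 0)); split => //=; rewrite lexx.
pose adm (h : R -> C) := forall t, a <= t <= b -> {for t, continuous h}.
pose Lam (h : R -> C) := cintegral `[a, b] (fun t => kap t * h t).
have prod h : adm h -> adm (fun t => kap t * h t).
  move=> ah t ht; exact: (@cvgM C _ _ _ _ _ _ _ (ck t ht) (ah t ht)).
have scal (c : C) h : adm h -> adm (fun t => c * h t).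
  by move=> ah t ht; apply: (@cvgM C _ _ _ (cst c) _ _ _ (@cvg_cst _ _ _ _ _) (ah t ht)).
have int h : adm h -> cinteg `[a, b] h by exact: cont_cinteg.
have kern n w : cmod (w - z) < q / 2 -> adm (fun t => (gam t - w) ^- n).
  move=> wq t ht.
  have far' : q / 2 <= cmod (gam t - w).
    by have := far t ht; have := cmod_triangle w (gam t) z; lra.
  have cf : {for gam t, continuous (fun u : C => (u - w) ^- n)}.
    apply: contV; last first.
      by apply: contX; apply: contB; [exact: cont_id|exact: cont_cst].
    by rewrite expf_neq0//; apply: far_neq0 far'; rewrite divr_gt0.
  exact: (@continuous_comp _ _ _ gam _ t (cg t ht) cf).
exists (Lam (fun t => (gam t - z)^-2)).
apply: (@cder_functional _ _ adm Lam [set t | a <= t <= b] (2 * (K * (b - a)))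
  (fun w t => (gam t - w)^-1) (fun t => (gam t - z)^-2) z (q / 2) (2 / q ^+ 3)).
- by rewrite divr_gt0.
- by rewrite !mulr_ge0// subr_ge0.
- by rewrite divr_ge0// exprn_ge0// ltW.
- move=> c d h l ah al; split.
    move=> t ht; exact: (@cvgD _ R[i]^o _ _ _ _ _ _ _ (scal c h ah t ht) (scal d l al t ht)).
  rewrite /Lam -(cintegralZ c mD (int _ (prod _ ah))).
  rewrite -(cintegralZ d mD (int _ (prod _ al))) -cintegralD.
  + by apply: eq_cintegral => t _; ring.
  + exact: mD.
  + by apply: int; apply: scal; exact: prod.
  + by apply: int; apply: scal; exact: prod.
- move=> h M M0 ah hM; rewrite /Lam.
  apply: (le_trans (cintegral_itv_bound (M := K * M) ab (int _ (prod _ ah)) _)).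
    by move=> t ht; rewrite cmodM; apply: ler_pM; rewrite ?cmod_ge0//; [exact: hK|exact: hM].
  by rewrite le_eqVlt; apply/orP; left; apply/eqP; ring.
- by move=> w /(kern 1%N).
- by apply: kern; rewrite subrr cmod0 divr_gt0.
- by move=> w t wq ht; apply: inv_expansion => //; exact: far.
Qed.

(** The residue of [k / (G - G w)] at the simple zero [w] of the denominator. *)
Lemma chart_residue (G k : C -> C) z0 (d m : R) (x1 x2 y1 y2 : R) w :
  chart G z0 d m -> holomorphic_on (disc z0 d) k ->
  crect x1 x2 y1 y2 `<=` disc z0 d -> orect x1 x2 y1 y2 w ->
  rectint (fun u => k u * derive1 G u * (G u - G w)^-1) x1 x2 y1 y2 =
  twopii * k w.
Proof.
move=> ch hk sub ow; have [d0 m0 hG lip _] := ch.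
have hG' := holo_derive (@open_disc _ z0 d) hG.
have dw : disc z0 d w by apply: sub; exact: orect_crect.
have [r r0 hr] := sub_disc_at dw.
have [g1 hg1 g1E] : exists2 g1, holomorphic_on (disc w r) g1 &
    forall u, disc w r u -> G u - G w = (u - w) * g1 u.
  apply: (@holo_divide _ (fun u => G u - G w)) => //; last by rewrite subrr.
  by apply: holoB; [exact: holoS hr hG|exact: holo_cst].
have far u : disc w r u -> u != w -> m <= cmod (g1 u).
  move=> hu uw; have := lip u w (hr _ hu) dw; rewrite g1E// cmodM mulrC ler_pM2l//.
  by rewrite cmod_gt0 subr_eq0.
have g1w : g1 w != 0.
  apply/eqP => z1; have := holo_cont hg1 (disc_center w r0).
  move/cont_discP => /(_ m m0)[s s0 hs].
  pose u := w + (Num.min r s / 2)%:C%C.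
  have mn0 : 0 < Num.min r s by rewrite lt_min r0.
  have uw : cmod (u - w) = Num.min r s / 2.
    by rewrite /u addrAC subrr add0r cmod_real ger0_norm// ltW// divr_gt0.
  have [hr2 hs2] : Num.min r s <= r /\ Num.min r s <= s.
    by split; rewrite ge_min lexx ?orbT.
  have ur : disc w r u by rewrite /disc /= uw; lra.
  have us : cmod (u - w) < s by rewrite uw; lra.
  have une : u != w by rewrite -subr_eq0 -cmod_gt0 uw divr_gt0.
  by have := hs u us; rewrite z1 subr0 ltNge far.
have g1n u : disc w r u -> g1 u != 0.
  move=> hu; have [->//|uw] := eqVneq u w.
  exact: far_neq0 m0 (far u hu uw).
have dGw : derive1 G w = g1 w.
  have dgw := holo_cder hg1 (disc_center w r0).
  have h1 := cder_near r0 (fun u hu => esym (g1E u hu)) (cderM (cder_sub w w) dgw).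
  have h2 := cderB (holo_cder hG dw) (cder_cst (G w) w).
  by have := cder_unique h2 h1; rewrite subr0 subrr mul0r addr0 mul1r.
have [s1 s10 hs1] := open_square (@open_disc _ w r) (disc_center w r0).
have [s2 s20 hs2] := square_in_orect ow.
pose s := Num.min s1 s2; have s0 : 0 < s by rewrite lt_min s10.
have [ss1 ss2] : s <= s1 /\ s <= s2 by split; rewrite ge_min lexx ?orbT.
have [i1 i2 i3 i4] := hs2 s ss2.
have os := orect_square w s0; have [hx hy] := orect_le os.
have sqr : square w s `<=` disc w r.
  move=> u [/andP[? ?] /andP[? ?]]; apply: hs1.
  by split; apply/andP; split; lra.
rewrite (rectint_annulus i1 hx i2 i3 hy i4); last first.
  move=> u hu no; have du := sub _ hu.
  have ne : G u - G w != 0.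
    rewrite subr_eq0; apply: contra_not_neq no => /(chart_inj ch du dw) ->.
    exact: os.
  eexists; apply: cderM.
    by apply: cderM; [exact: (holo_cder hk du)|exact: (holo_cder hG' du)].
  apply: (cderV (g := fun u => G u - G w)); first exact: ne.
  by apply: cderB; [exact: (holo_cder hG du)|exact: cder_cst].
rewrite (@eq_rectint _ _ _ _ _ hx hy _ (fun u => (k u * derive1 G u * (g1 u)^-1) * (u - w)^-1));
    last first.
  move=> u [hu no]; rewrite g1E; last exact: sqr.
  by rewrite invfM; ring.
rewrite (cauchy_formula (g := fun u => k u * derive1 G u * (g1 u)^-1) os).
  by rewrite dGw -mulrA divff// mulr1.
move=> u /sqr hu; have du := hr _ hu.
eexists; apply: cderM.
  by apply: cderM; [exact: (holo_cder hk du)|exact: (holo_cder hG' du)].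
by apply: cderV; [exact: g1n|exact: (holo_cder hg1 hu)].
Qed.

(** The integral over the arc, pushed to the three lower sides of a rectangle
    below it: holomorphic near the arc, and equal to the integral over the arc
    up to the residue, which is collected exactly below the arc. *)
Section Deformation.
Variables (G k : C -> C) (t0 d m a : R).
Hypothesis ch : chart G t0%:C%C d m.
Hypothesis hk : holomorphic_on (disc t0%:C%C d) k.
Hypotheses (a0 : 0 < a) (ad : 2 * a < d).

Let ker z u := k u * derive1 G u * (G u - z)^-1.

Definition arc_integral z := hor (ker z) 0 (t0 - a) (t0 + a).

Definition deformed z := hor (ker z) (- a) (t0 - a) (t0 + a) +
  Complex 0 1 * (ver (ker z) (t0 + a) (- a) 0 - ver (ker z) (t0 - a) (- a) 0).

Let rect_disc : crect (t0 - a) (t0 + a) (- a) 0 `<=` disc t0%:C%C d.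
Proof.
move=> [x y] [/= /andP[? ?] /andP[? ?]]; rewrite /disc /=.
apply: (le_lt_trans (cmod_le _)) => /=.
have h1 : `|x - t0| <= a by rewrite ler_norml; apply/andP; split; lra.
have h2 : `|y - 0| <= a by rewrite ler_norml; apply/andP; split; lra.
by apply: (le_lt_trans (lerD h1 h2)); have := ad; lra.
Qed.

Let ker_holo z u : disc t0%:C%C d u -> G u != z -> exists e, cder (ker z) u e.
Proof.
have [_ _ hG _ _] := ch; have hG' := holo_derive (@open_disc _ t0%:C%C d) hG.
move=> du ne; eexists; apply: cderM.
  by apply: cderM; [exact: (holo_cder hk du)|exact: (holo_cder hG' du)].
apply: (cderV (g := fun u => G u - z)); first by rewrite subr_eq0.
by apply: cderB; [exact: (holo_cder hG du)|exact: cder_cst].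
Qed.

Lemma rectint_deformed z :
  rectint (ker z) (t0 - a) (t0 + a) (- a) 0 = deformed z - arc_integral z.
Proof. by rewrite /rectint /deformed /arc_integral; ring. Qed.

Lemma arc_integral_above w : disc t0%:C%C d w -> 0 < Im w ->
  arc_integral (G w) = deformed (G w).
Proof.
move=> dw iw; apply/eqP; rewrite eq_sym -subr_eq0 -rectint_deformed; apply/eqP.
have a_gt0 := a0; apply: goursat; [lra|lra|].
move=> u hu; have du := rect_disc hu; apply: ker_holo => //.
apply/eqP => /(chart_inj ch du dw) e; move: hu; rewrite e => -[_ /andP[_ h]].
by move: iw; rewrite ltNge h.
Qed.

Lemma arc_integral_below w : orect (t0 - a) (t0 + a) (- a) 0 w ->
  arc_integral (G w) = deformed (G w) - twopii * k w.
Proof.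
move=> ow; have := chart_residue ch hk rect_disc ow.
by rewrite -/(ker (G w)) rectint_deformed => <-; ring.
Qed.

Lemma deformed_holo : holomorphic_on (disc (G t0%:C%C) (m * a / 2)) deformed.
Proof.
have [d0 m0 hG lip _] := ch; have hG' := holo_derive (@open_disc _ t0%:C%C d) hG.
apply/holoP => z hz.
have q0 : 0 < m * a / 2 by rewrite !mulr_gt0.
have far u : disc t0%:C%C d u -> a <= cmod (u - t0%:C%C) ->
    m * a / 2 <= cmod (G u - z).
  move=> du au; have h1 := lip u t0%:C%C du (disc_center _ d0).
  have h2 : m * a <= m * cmod (u - t0%:C%C) by rewrite ler_pM2l.
  have h3 := cmod_triangle z (G u) (G t0%:C%C).
  by move: hz; rewrite /disc /=; lra.
pose kd u := k u * derive1 G u.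
have ckd u : disc t0%:C%C d u -> {for u, continuous kd}.
  move=> du; apply: contM; [exact: (holo_cont hk du)|exact: (holo_cont hG' du)].
have farR x y : a <= `|x - t0| -> a <= cmod (Complex x y - t0%:C%C).
  by move=> h; apply: (le_trans h); apply: le_trans (cmod_Re _); rewrite ReD ReN.
have farI x y : a <= `|y| -> a <= cmod (Complex x y - t0%:C%C).
  by move=> h; apply: (le_trans h); apply: le_trans (cmod_Im _); rewrite ImD ImN /= subr0.
have cG u : disc t0%:C%C d u -> {for u, continuous G} by exact: holo_cont hG.
have a_gt0 := a0; have hx : t0 - a <= t0 + a by lra.
have hy : - a <= 0 by lra.
have bot x : t0 - a <= x <= t0 + a -> crect (t0 - a) (t0 + a) (- a) 0 (Complex x (- a)).
  by move=> h; split=> //=; rewrite lexx.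
have lft y : - a <= y <= 0 -> crect (t0 - a) (t0 + a) (- a) 0 (Complex (t0 - a) y).
  by move=> h; split=> //=; rewrite lexx.
have rgt y : - a <= y <= 0 -> crect (t0 - a) (t0 + a) (- a) 0 (Complex (t0 + a) y).
  by move=> h; split=> //=; rewrite lexx andbT.
have [e1 h1] : exists e, cder (fun z => hor (ker z) (- a) (t0 - a) (t0 + a)) z e.
  apply: (@seg_cauchy _ _ (fun x => kd (Complex x (- a))) (fun x => G (Complex x (- a)))
    z (m * a / 2) hx q0).
  - by move=> t /bot/rect_disc ht; exact: hor_cont (ckd _ ht).
  - by move=> t /bot/rect_disc ht; exact: hor_cont (cG _ ht).
  - move=> t /bot/rect_disc ht; apply: far => //; apply: farI.
    by rewrite normrN ger0_norm// ltW.
have [e2 h2] : exists e, cder (fun z => ver (ker z) (t0 + a) (- a) 0) z e.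
  apply: (@seg_cauchy _ _ (fun y => kd (Complex (t0 + a) y))
    (fun y => G (Complex (t0 + a) y)) z (m * a / 2) hy q0).
  - by move=> t /rgt/rect_disc ht; exact: ver_cont (ckd _ ht).
  - by move=> t /rgt/rect_disc ht; exact: ver_cont (cG _ ht).
  - move=> t /rgt/rect_disc ht; apply: far => //; apply: farR.
    by rewrite addrAC subrr add0r ger0_norm// ltW.
have [e3 h3] : exists e, cder (fun z => ver (ker z) (t0 - a) (- a) 0) z e.
  apply: (@seg_cauchy _ _ (fun y => kd (Complex (t0 - a) y))
    (fun y => G (Complex (t0 - a) y)) z (m * a / 2) hy q0).
  - by move=> t /lft/rect_disc ht; exact: ver_cont (ckd _ ht).
  - by move=> t /lft/rect_disc ht; exact: ver_cont (cG _ ht).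
  - move=> t /lft/rect_disc ht; apply: far => //; apply: farR.
    by rewrite addrAC subrr add0r normrN ger0_norm// ltW.
eexists; apply: cderD; first exact: h1.
by apply: cderZ; apply: cderB; [exact: h2|exact: h3].
Qed.

End Deformation.

End Jump.

Section ArcSide.
Variables (R : realType) (Omega : set R[i]) (Xi : set (set R[i])).
Local Notation C := R[i].
Variable arcs : set C -> set (C -> C).
Hypothesis part : is_partition Omega Xi arcs.
Local Notation bd := (boundary Omega).
Local Notation dX := (dXi Omega Xi).
Local Notation reg := (regular_points Omega Xi).

(** The point [G z + i s G'(z)] of the normal is [G w] for some [w] within
    [|s| / 2] of [z + i s], hence on the same side of the real axis as [z + i s].
    The constants leave room for this: the error of the linear approximation,
    [m |s| / 16], is less than the radius [m |s| / 8] attained by [G] on the square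
    of half-side [|s| / 4] about [z + i s]. *)
Lemma side_point (G : C -> C) z0 (d m : R) z : chart G z0 d m -> disc z0 d z ->
  exists2 e : R, 0 < e & forall s : R, 0 < `|s| -> `|s| < e ->
    exists2 w, disc z0 d w & G w = G z + Complex 0 s * derive1 G z /\
      cmod (w - (z + Complex 0 s)) <= `|s| / 2.
Proof.
move=> [d0 m0 hG _ onto] dz.
have [q q0 hq] := sub_disc_at dz.
have m16 : 0 < m / 16 by rewrite divr_gt0.
have [r r0 hr] := (cderP _ _ _).1 (holo_cder hG dz) _ m16.
exists (Num.min r (q / 2)); first by rewrite lt_min r0 divr_gt0.
move=> s s0; rewrite lt_min => /andP[sr sq].
have cs : cmod (Complex 0 s) = `|s|.
  have -> : Complex 0 s = Complex 0 1 * s%:C%C :> C by apply: complex_ext => /=; ring.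
  by rewrite cmodM cmod_i mul1r cmod_real.
pose z1 := z + Complex 0 s.
have z1z : z1 - z = Complex 0 s by rewrite /z1 addrAC subrr add0r.
have sub : square z1 (`|s| / 4) `<=` disc z0 d.
  move=> u /square_disc hu; apply: hq; rewrite /disc /=.
  by have := cmod_triangle z1 u z; rewrite z1z cs; lra.
have s4 : 0 < `|s| / 4 by rewrite divr_gt0.
have [|w hw e] := onto z1 _ s4 sub (G z + Complex 0 s * derive1 G z).
  have := hr z1; rewrite z1z cs => /(_ sr) h.
  rewrite cmodBC; rewrite opprD addrA [Complex 0 s * _]mulrC.
  by apply: (le_lt_trans h); nra.
exists w; first exact: sub.
by split=> //; apply: (le_trans (square_disc hw)); lra.
Qed.

Lemma near_right (P : R -> Prop) (e : R) : 0 < e ->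
  (forall s, 0 < s -> s < e -> P s) -> \forall s \near 0^'+, P s.
Proof.
move=> e0 h; apply/nbhs_ballP; exists e => // s se s0; apply: h => //.
have : `|0 - s| < e by [].
by rewrite sub0r normrN => /(le_lt_trans (ler_norm s)).
Qed.

Lemma chart_sides G t0 d m P Q (t : R) : arc_chart Omega Xi G t0 d m P Q ->
  disc t0%:C%C d t%:C%C -> on_left G t P /\ on_right G t Q.
Proof.
move=> hc ht; have [ch _ _ _ h] := hc.
have [e e0 he] := side_point ch ht.
have im w (s : R) : cmod (w - (t%:C%C + Complex 0 s)) <= `|s| / 2 ->
    `|Im w - s| <= `|s| / 2.
  move=> hw; apply: le_trans hw; apply: le_trans (cmod_Im _).
  by rewrite ImD ImN ImD /= add0r.
split; apply: (near_right e0) => s s0 se.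
  have ns : `|s| = s by rewrite ger0_norm// ltW.
  have [||w hw [<- /im]] := he s; rewrite ?ns// ler_norml => /andP[? ?].
  by have [_ _ hP _] := h w hw; apply: hP; lra.
have ns : `|- s| = s by rewrite normrN ger0_norm// ltW.
have [||w hw [e1 /im]] := he (- s); rewrite ?ns// ler_norml => /andP[? ?].
rewrite -mulNr complexN oppr0 -e1.
by have [_ _ _ hQ] := h w hw; apply: hQ; lra.
Qed.

Lemma near_right_ex (P : R -> Prop) : (\forall s \near 0^'+, P s) -> exists s, P s.
Proof.
move=> /nbhs_ballP[e e0 he]; exists (e / 2); apply: he => /=.
  suff : `|0 - e / 2| < e by [].
  by rewrite sub0r normrN gtr0_norm ?divr_gt0//; have : 0 < e by []; lra.
by rewrite divr_gt0.
Qed.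

Lemma orientation_chart G t0 d m P Q (t : R) : arc_chart Omega Xi G t0 d m P Q ->
  P <> Q -> disc t0%:C%C d t%:C%C ->
  orientation G t P Q = 1 /\ orientation G t Q P = -1.
Proof.
move=> hc PQ ht; have [hl hr] := chart_sides hc ht; have [_ _ XP XQ _] := hc.
rewrite /orientation; split.
  by rewrite asboolT.
rewrite asboolF; first by rewrite asboolT.
move=> [hlQ _]; apply: PQ.
have /near_right_ex[s [Ps Qs]] : \forall s \near 0^'+,
    P (G t%:C%C + Complex 0 s * derive1 G t%:C%C) /\
    Q (G t%:C%C + Complex 0 s * derive1 G t%:C%C) by apply: filterI.
exact: (element_eq part XP XQ Ps Qs).
Qed.

Lemma chart_closure G t0 d m P Q (t : R) : arc_chart Omega Xi G t0 d m P Q ->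
  disc t0%:C%C d t%:C%C -> closure P (G t%:C%C) /\ closure Q (G t%:C%C).
Proof.
move=> [[_ _ hG _ _] _ _ _ hz] dt.
have cl (W : set C) (sg : R) : `|sg| = 1 -> (forall u, disc t0%:C%C d u ->
    0 < sg * Im u -> W (G u)) -> closure W (G t%:C%C).
  move=> sg1 hW; apply/closure_discP => e e_gt0.
  have /cont_discP/(_ e e_gt0)[q q0 hq] := holo_cont hG dt.
  have [q' q'0 hq'] := sub_disc_at dt.
  pose n := Num.min q q' / 2.
  have n0 : 0 < n by rewrite divr_gt0// lt_min q0.
  have [nq nq'] : n < q /\ n < q'.
    have [h1 h2] : Num.min q q' <= q /\ Num.min q q' <= q'.
      by split; rewrite ge_min lexx ?orbT.
    by move: n0; rewrite /n; split; lra.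
  pose u := t%:C%C + Complex 0 (sg * n).
  have ut : cmod (u - t%:C%C) = n.
    rewrite /u addrAC subrr add0r.
    have -> : Complex 0 (sg * n) = Complex 0 1 * (sg * n)%:C%C :> C.
      by apply: complex_ext => /=; ring.
    by rewrite cmodM cmod_i mul1r cmod_real normrM sg1 mul1r gtr0_norm.
  exists (G u); last by apply: hq; rewrite ut.
  apply: hW; first by apply: hq'; rewrite /disc /= ut.
  rewrite /u ImD /= add0r mulrA -expr2 -real_normK ?num_real// sg1 expr1n.
  by rewrite mul1r.
split.
  apply: (cl P 1 (normr1 _)) => u hu; rewrite mul1r.
  by have [_ _ h _] := hz u hu.
apply: (cl Q (-1)); first by rewrite normrN normr1.
by move=> u hu; rewrite mulN1r oppr_gt0; have [_ _ _ h] := hz u hu.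
Qed.

Variables (f : set C -> C -> C) (NN : set C -> set C).
Hypothesis NN_open : forall U, Xi U -> open (NN U).
Hypothesis NN_closure : forall U, Xi U -> Omega `&` closure U `<=` NN U.
Hypothesis f_holo : forall U, Xi U -> holomorphic_on (NN U) (f U).

(** The density of the contour integral of the coboundary with respect to the
    parameter of the arc. *)
Definition weight (p : set C * set C) (G : C -> C) (t : R) : C :=
  orientation G t p.1 p.2 * coboundary f p.1 p.2 (G t%:C%C) * derive1 G t%:C%C.

(** The jump formula for the part of the Cauchy-Heine integral carried by the
    piece of one arc [G] of [A] about [t0], for the ordered pair [(A, B)].  Its
    integral has the jump [f A - f B] across the arc, so subtracting it from
    [f A] on one side and [f B] on the other leaves a holomorphic [E].  The last
    three clauses say that this piece is all of the boundary of [A] there, and that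
    only [A] and [B] come near. *)
Lemma arc_side A B G t0 : Xi A -> Xi B -> A <> B -> arcs A G -> 0 < t0 < 1 ->
  derive1 G t0%:C%C != 0 -> reg (G t0%:C%C) ->
  bd A (G t0%:C%C) -> bd B (G t0%:C%C) ->
  exists r a E, [/\ 0 < r, 0 < a, holomorphic_on (disc (G t0%:C%C) r) E
    & [/\ forall z W, disc (G t0%:C%C) r z -> Xi W -> W z ->
        f W z - twopii^-1 * cintegral `[t0 - a, t0 + a]
          (fun t => weight (A, B) G t * (G t%:C%C - z)^-1) = E z,
      forall t, t0 - a <= t <= t0 + a -> common_params Omega Xi A B G t,
      forall H t, arcs A H -> 0 < t < 1 -> disc (G t0%:C%C) r (H t%:C%C) ->
        H = G /\ t0 - a <= t <= t0 + a
      & forall z W, disc (G t0%:C%C) r z -> Xi W -> closure W z -> W = A \/ W = B]].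
Proof.
move=> XA XB AB hG t01 dG rx bA bB.
have [d1 [m [P [Q hc1]]]] := arc_structure part XA hG t01 dG rx.
have [[d10 m0 hG1 _ _] _ XP XQ _] := hc1.
have PQ : (A = P /\ B = Q) \/ (A = Q /\ B = P).
  have cA : closure A (G t0%:C%C) by case: bA => _ [].
  have cB : closure B (G t0%:C%C) by case: bB => _ [].
  have hA := chart_elements part hc1 (disc_center _ d10) XA cA.
  have hB := chart_elements part hc1 (disc_center _ d10) XB cB.
  by case: hA => eA; case: hB => eB; [case: AB; rewrite eA|left|right|case: AB; rewrite eA].
have PneQ : P <> Q by move=> e; apply: AB; case: PQ => -[-> ->].
have [bP bQ] : bd P (G t0%:C%C) /\ bd Q (G t0%:C%C).
  by case: PQ => -[<- <-].
have inN W : Xi W -> bd W (G t0%:C%C) -> exists2 e : R, 0 < e &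
    forall u, disc t0%:C%C e u -> NN W (G u).
  move=> XW [Ox [cW _]].
  have /open_discP/(_ (G t0%:C%C))[|s s0 hs] := NN_open XW.
    by apply: NN_closure.
  have /cont_discP/(_ s s0)[e e0 he] := holo_cont hG1 (disc_center _ d10).
  by exists e => // u /he; exact: hs.
have [e1 e10 he1] := inN P XP bP; have [e2 e20 he2] := inN Q XQ bQ.
have [rr rr0 [_ hrr]] := regular_nbhd rx.
have /cont_discP/(_ rr rr0)[e3 e30 he3] := holo_cont hG1 (disc_center _ d10).
pose d := Num.min (Num.min d1 e3) (Num.min e1 e2).
have d0 : 0 < d by rewrite !lt_min d10 e10 e20 e30.
have [dd1 de1 de2 de3] : [/\ d <= d1, d <= e1, d <= e2 & d <= e3].
  by split; rewrite /d !ge_min lexx ?orbT.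
have hc := arc_chart_shrink d0 dd1 hc1.
have [ch [t0d t0d'] _ _ hz] := hc; have [_ _ hGd lip onto] := ch.
pose k u := f P (G u) - f Q (G u).
have hk : holomorphic_on (disc t0%:C%C d) k.
  apply: holoB.
    apply: (@holo_comp _ _ (NN P) _ _ hGd); last exact: f_holo.
    by move=> _ [u hu <-]; apply: he1; exact: disc_sub de1 _ hu.
  apply: (@holo_comp _ _ (NN Q) _ _ hGd); last exact: f_holo.
  by move=> _ [u hu <-]; apply: he2; exact: disc_sub de2 _ hu.
pose a := d / 4; have a0 : 0 < a by rewrite divr_gt0.
have ad : 2 * a < d by rewrite /a; lra.
have Ereal (t : R) : t0 - a <= t <= t0 + a -> disc t0%:C%C d t%:C%C.
  move=> /andP[? ?]; rewrite /disc /= -rmorphB cmod_real ltr_norml.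
  by apply/andP; split; lra.
have wE t : t0 - a <= t <= t0 + a -> weight (A, B) G t = k t%:C%C * derive1 G t%:C%C.
  move=> /Ereal ht; have [i1 i2] := orientation_chart hc PneQ ht.
  rewrite /weight /k /coboundary /=; case: PQ => -[-> ->].
    by rewrite i1; ring.
  by rewrite i2; ring.
have hpre y : disc (G t0%:C%C) (m * (a / 2) / 2) y ->
    exists2 w, square t0%:C%C (a / 2) w & G w = y.
  apply: onto; first by rewrite divr_gt0.
  by apply: disc_square; lra.
have sqd w : square t0%:C%C (a / 2) w -> disc t0%:C%C d w.
  by move: w; apply: disc_square; lra.
have [rP rP0 hrP] : exists2 e : R, 0 < e & forall y, disc (G t0%:C%C) e y -> NN P y.
  have /open_discP/(_ (G t0%:C%C))[|s s0 hs] := NN_open XP; last by exists s.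
  by apply: NN_closure => //; case: bP => ? [].
pose r := Num.min rP (m * (a / 2) / 2).
have r0 : 0 < r by rewrite lt_min rP0 !mulr_gt0// divr_gt0.
have [rrP rma] : r <= rP /\ r <= m * (a / 2) / 2 by split; rewrite ge_min lexx ?orbT.
exists r, a, (fun z => f P z - twopii^-1 * deformed G k t0 a z).
split; [exact: r0|exact: a0| |].
  apply: holoB.
    by apply: (holoS _ (f_holo XP)) => z hz'; apply: hrP; exact: disc_sub rrP _ hz'.
  apply: holoZ; apply: (holoS _ (deformed_holo ch hk a0 ad)).
  apply: disc_sub; apply: (le_trans rma).
  by rewrite !ler_wpM2r// ?invr_ge0// ler_wpM2l ?ltW//; lra.
split.
- move=> z W hz' XW Wz.
  have [w hw e] := hpre z (disc_sub rma hz'); have dw := sqd w hw.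
  have [OG iff hP hQ] := hz w dw.
  have -> : cintegral `[t0 - a, t0 + a] (fun t => weight (A, B) G t * (G t%:C%C - z)^-1)
      = arc_integral G k t0 a z.
    apply: eq_cintegral => t; rewrite /= in_itv /= => ht.
    by rewrite wE.
  have nd := element_not_dXi part XW Wz; rewrite -e in nd.
  rewrite -e in Wz *.
  have [iw|iw|iw] := ltgtP (Im w) 0; last by exfalso; apply/nd/iff.
    have WQ := element_eq part XW XQ Wz (hQ iw); rewrite WQ.
    rewrite (arc_integral_below ch hk ad); last first.
      case: hw => /andP[/= ? ?] /andP[/= ? ?].
      by split; apply/andP; split; lra.
    rewrite mulrBr mulrA mulVf ?twopii_neq0// mul1r /k; ring.
  have WP := element_eq part XW XP Wz (hP iw); rewrite WP.
  by rewrite (arc_integral_above ch hk a0 ad).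
- move=> t ht; have dt := Ereal t ht.
  have [OG iff hP hQ] := hz _ dt.
  have dXt : dX (G t%:C%C) by apply/iff.
  have [cP cQ] := chart_closure hc dt.
  have bdPQ W : Xi W -> closure W (G t%:C%C) -> bd W (G t%:C%C).
    move=> XW cW; apply: closure_boundary => // Wt.
    exact: (element_not_dXi part XW Wt).
  split.
    by case/andP: ht => ? ?; apply/andP; split; lra.
  split; first split.
  + by apply: hrr => //; apply: he3; exact: disc_sub de3 _ dt.
  + by case: PQ => -[-> _]; apply: bdPQ.
  + by case: PQ => -[_ ->]; apply: bdPQ.
- move=> H t hH ht hHt.
  have [w hw e] := hpre _ (disc_sub rma hHt); have dw := sqd w hw.
  have [OG iff _ _] := hz w dw.
  have ht' : 0 <= t <= 1 by case/andP: ht => /ltW -> /ltW ->.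
  have iw : Im w = 0.
    by apply/iff; rewrite e; apply: (boundary_dXi XA); exact: (arc_boundary part XA hH).
  have we := real_of_Im0 iw; set s := Re w in we.
  have sa : t0 - a <= s <= t0 + a.
    by case: hw => /andP[/= ? ?] _; rewrite /s; apply/andP; split; lra.
  have s01 : 0 < s < 1 by case/andP: sa => ? ?; apply/andP; split; lra.
  rewrite we in e.
  have [HG|HG] := pselect (H = G).
    split=> //; rewrite HG in e hH *.
    have := arc_injective (element_boundary part XA) hG.
    move=> /(_ s t); rewrite !in_itv /= => inj.
    by rewrite -(inj _ _ e)//; case/andP: s01 => /ltW -> /ltW ->.
  exfalso; have GH : G <> H by move=> E; apply: HG.
  apply: (arc_disjoint (element_boundary part XA) hG hH GH _ _ e).
    by rewrite in_itv.
  by rewrite in_itv.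
- move=> z W hz' XW cW; have [w hw e] := hpre z (disc_sub rma hz').
  rewrite -e in cW.
  have := chart_elements part hc (sqd w hw) XW cW.
  by case: PQ => -[-> ->] []; [left|right|right|left].
Qed.

End ArcSide.

(** * The Cauchy-Heine integral as a family functional *)

Section CauchyHeine.
Variables (R : realType) (Omega : set R[i]) (Xi : set (set R[i])).
Local Notation C := R[i].
Local Notation mu := (@lebesgue_measure R).
Local Notation mset D := (@measurable _ (measurableTypeR R) D).
Variable arcs : set C -> set (C -> C).
Hypothesis part : is_partition Omega Xi arcs.
Local Notation bd := (boundary Omega).
Local Notation dX := (dXi Omega Xi).
Local Notation reg := (regular_points Omega Xi).
Variables (f : set C -> C -> C) (NN : set C -> set C).
Hypothesis NN_open : forall U, Xi U -> open (NN U).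
Hypothesis NN_closure : forall U, Xi U -> Omega `&` closure U `<=` NN U.
Hypothesis f_holo : forall U, Xi U -> holomorphic_on (NN U) (f U).
Hypothesis mass_finite : (cauchy_heine_mass Omega Xi arcs f < +oo)%E.

Let P := Xi `*` Xi.
Let A (p : set C * set C) := arcs p.1.
Let dom (p : set C * set C) (G : C -> C) := common_params Omega Xi p.1 p.2 G.
Let W := weight f.
Let g (p : set C * set C) (G : C -> C) (t : R) :=
  cmod (coboundary f p.1 p.2 (G t%:C%C)) * cmod (derive1 G t%:C%C).
Let k0 : C := twopii^-1.
Let gam (G : C -> C) (t : R) := G t%:C%C.

Lemma arc_param_cont U G (t : R) : Xi U -> arcs U G -> 0 <= t <= 1 ->
  {for t, continuous (fun s : R => G s%:C%C)} /\
  {for t, continuous (fun s : R => derive1 G s%:C%C)}.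
Proof.
move=> XU hG ht.
have [B [oB segB hB]] := arc_holomorphic (element_boundary part XU) hG.
have Bt : B t%:C%C by apply: segB; rewrite in_itv.
split; apply: real_cont; first exact: holo_cont hB Bt.
exact: holo_cont (holo_derive oB hB) Bt.
Qed.

Lemma open_param (ga : R -> C) (B : set C) :
  (forall t, 0 < t < 1 -> {for t, continuous ga}) -> open B ->
  mset [set t | 0 < t < 1 /\ B (ga t)].
Proof.
move=> cga oB; apply: open_measurable; rewrite openE => t [/andP[t0 t1] Bt].
apply: filterI; last first.
  by have t01 : 0 < t < 1 by [rewrite t0]; exact: cga t01 _ (open_nbhs_nbhs (conj oB Bt)).
apply/nbhs_ballP; exists (Num.min t (1 - t)); first by rewrite /= lt_min t0 subr_gt0.
move=> s ts; have {ts} : `|t - s| < Num.min t (1 - t) by [].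
rewrite lt_min !ltr_norml => /andP[/andP[? ?] /andP[? ?]].
by apply/andP; split; lra.
Qed.

Lemma arc_open_param U G (B : set C) : Xi U -> arcs U G -> open B ->
  mset [set t | 0 < t < 1 /\ B (G t%:C%C)].
Proof.
move=> XU hG; apply: open_param => t /andP[t0 t1].
by have [|h _] := arc_param_cont XU hG (t := t); first by rewrite !ltW.
Qed.

Let mdom p G : P p -> A p G -> mset (dom p G).
Proof.
case: p => U V [/= XU XV] hG.
(* [dom p G] is cut out by open sets pulled back by the arc: the regular points of
   the boundary are those lying in some open set in which it is a line. *)
pose B := \bigcup_(B in [set B : set C | [/\ open B, B `<=` Omega &
  homeomorphic_to_line (dX `&` B)]]) B.
have oB : open B by apply: bigcup_open => D [].
have -> : dom (U, V) G = ([set t | 0 < t < 1 /\ B (G t%:C%C)] `\`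
    [set t | 0 < t < 1 /\ (~` closure V) (G t%:C%C)]) `\`
    [set t | 0 < t < 1 /\ (interior V) (G t%:C%C)].
  apply/seteqP; split=> [t [ht [[[dx [D [oD DO Dx hl]]] bU] [Ox [cV iV]]]]|].
    split; last by case.
    split; last by case=> _; apply.
    by split=> //; exists D.
  move=> t [[[ht [D [oD DO hl] Dx]] ncV] niV].
  have ht' : 0 <= t <= 1 by case/andP: ht => /ltW -> /ltW ->.
  have bU := arc_boundary part XU hG ht'.
  split=> //; split; first split=> //.
    by split; [exact: (boundary_dXi XU)|exists D].
  have [Ox _] := bU; split=> //; split.
    by apply: contrapT => h; apply: ncV.
  by move=> h; apply: niV.
apply: measurableD; first apply: measurableD.
- exact: (arc_open_param XU hG).
- by apply: (arc_open_param XU hG); apply: closed_openC; exact: closed_closure.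
- by apply: (arc_open_param XU hG); exact: open_interior.
Qed.

Lemma cob_cont U V G (t : R) : Xi U -> Xi V -> arcs U G ->
  common_params Omega Xi U V G t ->
  {for t, continuous (fun s : R => coboundary f U V (G s%:C%C))}.
Proof.
move=> XU XV hG [ht [[_ bU] bV]].
have ht' : 0 <= t <= 1 by case/andP: ht => /ltW -> /ltW ->.
have [B [oB segB hB]] := arc_holomorphic (element_boundary part XU) hG.
have cG : {for t%:C%C, continuous G}.
  by apply: holo_cont hB _; apply: segB; rewrite in_itv.
have fc X : Xi X -> bd X (G t%:C%C) -> {for t%:C%C, continuous (fun u => f X (G u))}.
  move=> XX [Ox [cX _]]; apply: (continuous_comp cG).
  by apply: holo_cont (f_holo XX) _; exact: NN_closure.
apply: (real_cont (G := fun u => coboundary f U V (G u))).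
exact: (contB (fc U XU bU) (fc V XV bV)).
Qed.

Lemma contR_near (h k : R -> C) (t r : R) : 0 < r ->
  (forall s, `|s - t| < r -> h s = k s) -> {for t, continuous k} ->
  {for t, continuous h}.
Proof.
move=> r0 hk /contR_discP ck; apply/contR_discP => e e0.
have [q q0 hq] := ck e e0; exists (Num.min r q); first by rewrite lt_min r0.
move=> s; rewrite lt_min => /andP[sr sq].
by rewrite !hk ?subrr ?normr0//; exact: hq.
Qed.

Lemma contRM (h k : R -> C) (t : R) : {for t, continuous h} ->
  {for t, continuous k} -> {for t, continuous (fun s => h s * k s)}.
Proof. by move=> ch ck; exact: (@cvgM C _ _ _ _ _ _ _ ch ck). Qed.

(** The orientation is locally constant along the arc, by [orientation_chart]. *)
Lemma weight_cont U V G (t : R) : Xi U -> Xi V -> U <> V -> arcs U G ->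
  common_params Omega Xi U V G t -> derive1 G t%:C%C != 0 ->
  {for t, continuous (weight f (U, V) G)}.
Proof.
move=> XU XV UV hG ht dG.
have cc := cob_cont XU XV hG ht.
have [t01 [[rx bU] bV]] := ht.
have ht' : 0 <= t <= 1 by case/andP: t01 => /ltW -> /ltW ->.
have [_ cG'] := arc_param_cont XU hG ht'.
have [d [m [p [q hc]]]] := arc_structure part XU hG t01 dG rx.
have [[d0 _ _ _ _] _ Xp Xq _] := hc.
have [c hcst] : exists c, forall s, `|s - t| < d -> orientation G s U V = c.
  have cU : closure U (G t%:C%C) by case: bU => _ [].
  have cV : closure V (G t%:C%C) by case: bV => _ [].
  have pq : p <> q -> forall s, `|s - t| < d ->
      orientation G s p q = 1 /\ orientation G s q p = -1.
    move=> npq s hs; apply: (orientation_chart part hc npq).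
    by rewrite /disc /= -rmorphB cmod_real.
  have hU := chart_elements part hc (disc_center _ d0) XU cU.
  have hV := chart_elements part hc (disc_center _ d0) XV cV.
  case: hU hV => eU [eV|eV]; rewrite eU eV in UV *; try by case: UV.
    by exists 1 => s /(pq UV)[].
  by exists (-1) => s /(pq (fun e => UV (esym e)))[].
apply: (contR_near d0 (k := fun s => c * coboundary f U V (G s%:C%C) *
  derive1 G s%:C%C)).
  by move=> s hs; rewrite /weight /= hcst.
apply: contRM; last exact: cG'.
apply: contRM; last exact: cc.
exact: cvg_cst.
Qed.

Lemma weight_diag U G (t : R) : weight f (U, U) G t = 0.
Proof. by rewrite /weight /coboundary subrr mulr0 mul0r. Qed.

Let mW p G : P p -> A p G -> cmeas (dom p G) (W p G).
Proof.
case: p => U V hp hG; have [/= XU XV] := hp.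
have mD := mdom hp hG.
have [<-|UV] := pselect (U = V).
  have -> : W (U, U) G = fun=> 0 by apply/funext => t; exact: weight_diag.
  exact: cmeas_cst.
pose act (t : R) := derive1 G t%:C%C != 0.
have -> : W (U, V) G = fun t => if act t then W (U, V) G t else 0.
  apply/funext => t; rewrite /act; case: eqP => //= e.
  by rewrite /W /weight e mulr0.
apply: cmeas_if; [exact: mD| |].
  have -> : dom (U, V) G `&` [set t | act t] = dom (U, V) G `&`
      [set t | 0 < t < 1 /\ (~` [set 0]) (derive1 G t%:C%C)].
    apply/seteqP; split=> t [ht]; rewrite /act /=; first last.
      by case=> _ h; split=> //; apply/eqP.
    by move=> /eqP h; split=> //; split=> //; case: ht.
  apply: measurableI => //; apply: open_param.
    move=> t /andP[t0 t1].
    by have [|_ h] := arc_param_cont XU hG (t := t); first by rewrite !ltW.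
  apply/open_discP => z /= /eqP; rewrite -cmod_gt0 => z0.
  by exists (cmod z) => // w; rewrite /disc /= => zw w0; move: zw;
    rewrite w0 sub0r cmodN ltxx.
by move=> t ht dG; apply: weight_cont.
Qed.

Lemma cmod_contR (h : R -> C) t : {for t, continuous h} ->
  {for t, continuous (fun s => cmod (h s))}.
Proof.
move=> /contR_discP ct; apply/cvgrPdist_lt => e e0; have [r r0 hr] := ct _ e0.
apply/nbhs_ballP; exists r => // s ts; have {ts}sr : `|t - s| < r by [].
rewrite distrC in sr; apply: le_lt_trans (hr s sr).
rewrite ler_norml; apply/andP; split.
  by have := cmod_lower (h s) (h t); lra.
by have := cmod_lower (h t) (h s); rewrite cmodBC; lra.
Qed.

Let mg p G : P p -> A p G ->
  measurable_fun (dom p G : set (measurableTypeR R)) (g p G).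
Proof.
case: p => U V hp hG; have [/= XU XV] := hp.
apply: subspace_continuous_measurable_fun; first exact: mdom.
apply: continuous_in_subspaceT => t; rewrite inE => ht.
have [t01 _] := ht; have ht' : 0 <= t <= 1 by case/andP: t01 => /ltW -> /ltW ->.
have [_ cG'] := arc_param_cont XU hG ht'.
have cc := cob_cont XU XV hG ht.
exact: (@cvgM R _ _ _ _ _ _ _ (cmod_contR cc) (cmod_contR cG')).
Qed.

Let g_ge0 p G t : P p -> A p G -> dom p G t -> 0 <= g p G t.
Proof. by move=> _ _ _; rewrite mulr_ge0 ?cmod_ge0. Qed.

Let Wg p G t : P p -> A p G -> dom p G t -> cmod (W p G t) <= g p G t.
Proof.
move=> _ _ _; rewrite /W /weight !cmodM -mulrA ler_piMl ?mulr_ge0 ?cmod_ge0//.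
rewrite /orientation; case: ifP => _; first by rewrite cmod1.
by case: ifP => _; rewrite ?cmodN ?cmod1 ?cmod0.
Qed.

Let k0_neq0 : k0 != 0. Proof. by rewrite invr_neq0// twopii_neq0. Qed.

Let cmod_k0 : cmod k0 = (2 * pi)^-1.
Proof.
rewrite /k0 cmodV; congr (_^-1).
rewrite /twopii /cmod /= expr0n add0r sqrtr_sqr ger0_norm//.
by rewrite mulr_ge0// pi_ge0.
Qed.

Let mass : (\esum_(p in P) ((cmod k0)%:E *
  (\esum_(G in A p) (\int[mu]_(t in dom p G) (g p G t)%:E))) < +oo)%E.
Proof.
move: mass_finite; rewrite /cauchy_heine_mass cmod_k0 => h.
rewrite ltNge; apply/negP; rewrite leye_eq => /eqP e; move: h.
rewrite (_ : \esum_(p in Xi `*` Xi) _ = +oo%E); last exact: e.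
by rewrite gt0_muley ?lte_fin ?invr_gt0// ltxx.
Qed.

Let lin := functional_linear mdom mW mg g_ge0 Wg k0_neq0 mass.
Local Notation Fam := (family_functional P A dom W k0).
Local Notation kern := (cut_kernel gam).

Let cgam p G t : P p -> A p G -> dom p G t -> {for t, continuous (gam G)}.
Proof.
case: p => U V [/= XU XV] hG [ht _].
by have [|h _] := arc_param_cont XU hG (t := t); first by case/andP: ht => /ltW -> /ltW ->.
Qed.

Lemma cauchy_heine_family z : cauchy_heine_integral Omega Xi arcs f z =
  2^-1 * Fam (kern xpredT 1 z).
Proof.
rewrite /cauchy_heine_integral; apply: (congr1 (fun u : C => 2^-1 * u)).
rewrite /family_functional; apply: eq_csum => -[U V] _.
apply: (congr1 (fun u : C => k0 * u)); rewrite /contour_integral.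
apply: eq_csum => G _; apply: eq_cintegral => t _.
by rewrite /cut_kernel /W /weight /gam /= expr1; ring.
Qed.

Let full_mact p G : P p -> A p G ->
  mset (dom p G `&` [set t | (xpredT : set C * set C * (C -> C) * R -> bool) (p, G, t)]).
Proof.
move=> hp hG; rewrite (_ : [set t | _] = setT) ?setIT; first exact: mdom.
by apply/seteqP; split.
Qed.

Lemma support_dXi x : family_support P A dom x -> dX (gam x.1.2 x.2).
Proof. by case: x => -[p G] t [hp hG [_ [[[dx _] _] _]]]. Qed.

Lemma support_far U z : Xi U -> U z -> exists2 q : R, 0 < q &
  disc z q `<=` U /\
  forall x, family_support P A dom x -> q <= cmod (gam x.1.2 x.2 - z).
Proof.
move=> XU Uz; have [oU _] := element_open part XU.
have /open_discP/(_ z Uz)[q q0 hq] := oU; exists q => //; split=> // x hx.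
rewrite leNgt; apply/negP => h.
exact: (element_not_dXi part XU (hq _ h) (support_dXi hx)).
Qed.

Lemma cauchy_heine_holo U : Xi U ->
  holomorphic_on U (cauchy_heine_integral Omega Xi arcs f).
Proof.
move=> XU; apply/holoP => z Uz; have [q q0 [_ far]] := support_far XU Uz.
have [d hd] := cut_kernel_holo mdom mW mg g_ge0 Wg k0_neq0 mass
  q0 cgam full_mact (fun x hx _ => far x hx).
exists (2^-1 * d); rewrite (_ : cauchy_heine_integral Omega Xi arcs f =
  fun z => 2^-1 * Fam (kern xpredT 1 z)); first exact: cderZ.
by apply/funext => u; exact: cauchy_heine_family.
Qed.

Lemma Fam_eq h h' : (forall p G t, P p -> A p G -> dom p G t ->
    W p G t * h (p, G, t) = W p G t * h' (p, G, t)) -> Fam h = Fam h'.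
Proof.
move=> hh; rewrite /family_functional; apply: eq_csum => p hp.
apply: (congr1 (fun u : C => k0 * u)); apply: eq_csum => G hG.
by apply: eq_cintegral => t ht; exact: hh.
Qed.

Lemma cintegral_restrict (D I : set R) (u : R -> C) : I `<=` D ->
  cintegral D (fun t => if `[< I t >] then u t else 0) = cintegral I u.
Proof.
move=> ID; have DI : D `&` I = I by apply/seteqP; split=> [t []//|t It]; split=> //; exact: ID.
apply: complex_ext; rewrite /cintegral /= -{2}DI Rintegral_mkcondr;
  apply: eq_Rintegral => t _; rewrite patchE.
  by case: asboolP => It; [rewrite mem_set|rewrite memNset].
by case: asboolP => It; [rewrite mem_set|rewrite memNset].
Qed.

Definition window (p0 : set C * set C) (G0 : C -> C) (a b : R)
    (x : set C * set C * (C -> C) * R) : bool :=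
  `[< [/\ x.1.1 = p0, x.1.2 = G0 & a <= x.2 <= b] >].

Lemma Fam_window p0 G0 (a b : R) z : P p0 -> A p0 G0 ->
  (forall t, a <= t <= b -> dom p0 G0 t) ->
  Fam (kern (window p0 G0 a b) 1 z) =
  k0 * cintegral `[a, b] (fun t => W p0 G0 t * (G0 t%:C%C - z)^-1).
Proof.
move=> hp hG hI; rewrite /family_functional.
have zero p G : p <> p0 \/ G <> G0 ->
    cintegral (dom p G) (fun t => W p G t * kern (window p0 G0 a b) 1 z (p, G, t)) = 0.
  move=> ne; rewrite (@eq_cintegral _ _ _ (fun=> 0)).
    by apply: complex_ext; rewrite //= /Rintegral integral0.
  move=> t _; rewrite /cut_kernel /window asboolF ?mulr0//.
  by case=> /= e1 e2 _; case: ne; [rewrite e1|rewrite e2].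
rewrite (csum_single hp); last first.
  move=> p _ pne; rewrite csum0 ?mulr0// => G _; apply: zero; by left.
apply: (congr1 (fun u : C => k0 * u)); rewrite (csum_single (j := G0)); last 2 first.
- exact: hG.
- by move=> G _ Gne; apply: zero; right.
rewrite -[RHS](@cintegral_restrict (dom p0 G0)); last first.
  by move=> t; rewrite /= in_itv /=; exact: hI.
apply: eq_cintegral => t _; rewrite /cut_kernel /window /=.
have -> : `[< [/\ p0 = p0, G0 = G0 & a <= t <= b] >] = `[< `[a, b]%classic t >].
  by apply: asbool_equiv_eq; rewrite /= in_itv /=; split=> [[]//|]; split.
by case: asboolP => _; rewrite ?mulr0// expr1.
Qed.

Lemma window_mact p0 G0 (a b : R) p G : P p -> A p G ->
  mset (dom p G `&` [set t | window p0 G0 a b (p, G, t)]).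
Proof.
have [[-> ->] hp hG|ne hp hG] := pselect (p = p0 /\ G = G0).
  rewrite (_ : [set t | _] = `[a, b]%classic).
    by apply: measurableI; [exact: mdom|exact: measurable_itv].
  apply/seteqP; split=> t /=; rewrite in_itv /= /window.
    by move=> /asboolP[].
  by move=> ht; apply/asboolP.
rewrite (_ : [set t | _] = set0) ?setI0//.
by apply/seteqP; split=> // t /asboolP[/= e1 e2 _]; apply: ne.
Qed.

Lemma outside_mact (D : set C) p G : open D -> P p -> A p G ->
  mset (dom p G `&` [set t | ~~ `[< D (G t%:C%C) >]]).
Proof.
case: p => U V oD hp hG; have [/= XU XV] := hp.
rewrite (_ : _ `&` _ = dom (U, V) G `\` [set t | 0 < t < 1 /\ D (G t%:C%C)]).
  by apply: measurableD; [exact: mdom|exact: (arc_open_param XU hG)].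
apply/seteqP; split=> t [ht] /=; first by move=> /asboolPn nD; split=> // -[].
by move=> nD; split=> //; apply/asboolPn => h; apply: nD; split=> //; case: ht.
Qed.

(** The shape of the left-hand side is that of [functional_linear] applied
    twice. *)
Lemma Fam_sum3 h1 h2 h3 : admissible P A dom h1 -> admissible P A dom h2 ->
  admissible P A dom h3 ->
  Fam (fun y => 1 * (1 * h1 y + 1 * h2 y) + 1 * h3 y) = Fam h1 + Fam h2 + Fam h3.
Proof.
move=> a1 a2 a3; have [a12 l1] := lin 1 1 a1 a2.
have l2 := proj2 (lin 1 1 a12 a3).
have {}l1 := etrans l1 (congr2 (fun u v : C => u + v) (mul1r _) (mul1r _)).
exact: etrans l2 (congr2 (fun u v : C => u + v) (etrans (mul1r _) l1) (mul1r _)).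
Qed.

Local Notation CH := (cauchy_heine_integral Omega Xi arcs f).

Definition locally_extends x := exists (r : R) (E : C -> C),
  [/\ 0 < r, holomorphic_on (disc x r) E &
    forall z U, disc x r z -> Xi U -> U z -> E z = f U z - CH z].

Lemma element_NN U : Xi U -> U `<=` NN U.
Proof.
move=> XU z Uz; apply: NN_closure => //; split; last exact: subset_closure.
exact: (element_sub part XU).
Qed.

Lemma locally_extends_element U x : Xi U -> U x -> locally_extends x.
Proof.
move=> XU Ux; have [oU _] := element_open part XU.
have /open_discP/(_ x Ux)[r r0 hr] := oU.
exists r, (fun z => f U z - CH z); split; first exact: r0.
  apply: holoB; first by apply: (holoS _ (f_holo XU)) => z /hr; exact: element_NN.
  exact: (holoS hr (cauchy_heine_holo XU)).
by move=> z V /hr Uz XV Vz; rewrite (element_eq part XV XU Vz Uz).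
Qed.

Let far_part (act : set C * set C * (C -> C) * R -> bool) x (r : R) z : 0 < r -> disc x (r / 2) z ->
  (forall p G, P p -> A p G -> mset (dom p G `&` [set t | act (p, G, t)])) ->
  (forall y, act y -> ~ disc x r (gam y.1.2 y.2)) ->
  exists d, cder (fun w => Fam (kern act 1 w)) z d.
Proof.
move=> r0 hz mact hact; have q0 : 0 < r / 2 by rewrite divr_gt0.
apply: (cut_kernel_holo mdom mW mg g_ge0 Wg k0_neq0 mass q0 cgam mact).
move=> y _ /hact; rewrite /disc /= => /negP; rewrite -leNgt => h.
by have := cmod_triangle z (gam y.1.2 y.2) x; move: hz; rewrite /disc /=; lra.
Qed.

Definition good_point x := reg x /\ forall U G t, Xi U -> arcs U G ->
  0 <= t <= 1 -> G t%:C%C = x -> 0 < t < 1 /\ derive1 G t%:C%C != 0.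

Lemma good_arc U x : good_point x -> Xi U -> bd U x -> exists G t,
  [/\ arcs U G, 0 < t < 1, derive1 G t%:C%C != 0 & G t%:C%C = x].
Proof.
move=> [rx good] XU bU.
have [|G [t [hG ht e]]] := arc_cover (element_boundary part XU) bU.
  by case=> _; apply.
rewrite in_itv /= in ht; have [t01 dG] := good U G t XU hG ht e.
by exists G, t.
Qed.

(** When a single element [U] lies on both sides, the coboundary along the arc is
    [f U - f U], so the integral has no mass near [x]. *)
Lemma locally_extends_slit U x (r0 : R) : Xi U -> 0 < r0 -> Omega x -> closure U x ->
  (forall y V, disc x r0 y -> Xi V -> closure V y -> V = U) ->
  locally_extends x.
Proof.
move=> XU r00 Ox cU only.
have /open_discP/(_ x)[|rU rU0 hrU] := NN_open XU; first exact: NN_closure.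
pose act (y : set C * set C * (C -> C) * R) := ~~ `[< disc x r0 (gam y.1.2 y.2) >].
exists (Num.min (r0 / 2) rU), (fun z => f U z - 2^-1 * Fam (kern act 1 z)).
have hmin z : disc x (Num.min (r0 / 2) rU) z -> disc x (r0 / 2) z /\ disc x rU z.
  by rewrite /disc /= lt_min => /andP.
split; first by rewrite lt_min rU0 divr_gt0.
  apply: holoB; first by apply: (holoS _ (f_holo XU)) => z /hmin[_ /hrU].
  apply: holoZ; apply/holoP => z /hmin[hz _]; apply: (far_part r00 hz).
    by move=> p G; apply: outside_mact; exact: open_disc.
  by move=> y /asboolPn.
move=> z V /hmin[hz _] XV Vz.
have hz0 : disc x r0 z by apply: (disc_sub _ hz); rewrite ler_pdivrMr//; lra.
rewrite (only z V hz0 XV (subset_closure Vz)) cauchy_heine_family.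
apply: (congr1 (fun u : C => f U z - 2^-1 * u)).
apply: Fam_eq => -[U1 U2] G t [/= X1 X2] hG ht; rewrite /cut_kernel /act /=.
case: asboolP => // hD.
have [_ [[_ [_ [c1 _]]] [_ [c2 _]]]] := ht.
by rewrite (only _ _ hD X1 c1) (only _ _ hD X2 c2) /W weight_diag !mul0r.
Qed.

(** An arc separating [p] from [q] is counted twice, once among the arcs of [p]
    for the pair [(p, q)] and once among those of [q] for [(q, p)], possibly with
    different parametrizations.  Each count has the full jump, by [arc_side], and
    the factor 1/2 in front of the sum averages the two; what remains of the sum
    stays away from [x]. *)
Lemma locally_extends_good x : good_point x -> locally_extends x.
Proof.
move=> hgood; have [rx _] := hgood; have [[U0 XU0 bU0] _] := rx.
have [G0 [t0 [hG0 t001 dG0 e0]]] := good_arc hgood XU0 bU0.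
have rx0 : reg (G0 t0%:C%C) by rewrite e0.
have [d0 [m0 [p [q hc]]]] := arc_structure part XU0 hG0 t001 dG0 rx0.
have [[d00 _ _ _ _] _ Xp Xq _] := hc.
have [r0 r00 hr0] := chart_nbhd hc (disc_center _ d00).
have [cp cq] := chart_closure hc (disc_center _ d00).
rewrite e0 in hr0 cp cq.
have Ox : Omega x by case: bU0.
have bdx W' : Xi W' -> closure W' x -> bd W' x.
  move=> XW cW; apply: closure_boundary => // Wx.
  by apply: (element_not_dXi part XW Wx); case: rx.
have [epq|npq] := pselect (p = q).
  apply: (locally_extends_slit Xp r00 Ox cp) => y V hy XV cV.
  have [w hw e] := hr0 y hy; rewrite -e in cV.
  by have [->|->] := chart_elements part hc hw XV cV.
have bp := bdx p Xp cp; have bq := bdx q Xq cq.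
have [G1 [t1 [hG1 t101 dG1 e1]]] := good_arc hgood Xp bp.
have [G2 [t2 [hG2 t201 dG2 e2]]] := good_arc hgood Xq bq.
have rx1 : reg (G1 t1%:C%C) by rewrite e1.
have rx2 : reg (G2 t2%:C%C) by rewrite e2.
have bp1 : bd p (G1 t1%:C%C) by rewrite e1.
have bq1 : bd q (G1 t1%:C%C) by rewrite e1.
have bp2 : bd p (G2 t2%:C%C) by rewrite e2.
have bq2 : bd q (G2 t2%:C%C) by rewrite e2.
have nqp : q <> p by move=> e; apply: npq.
have [r1 [a1 [E1 [r10 a10 hE1 [j1 i1 only1 el1]]]]] :=
  arc_side part NN_open NN_closure f_holo Xp Xq npq hG1 t101 dG1 rx1 bp1 bq1.
have [r2 [a2 [E2 [r20 a20 hE2 [j2 i2 only2 el2]]]]] :=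
  arc_side part NN_open NN_closure f_holo Xq Xp nqp hG2 t201 dG2 rx2 bq2 bp2.
rewrite e1 in hE1 j1 only1 el1; rewrite e2 in hE2 j2 only2 el2.
pose r := Num.min r1 r2; have r_gt0 : 0 < r by rewrite lt_min r10.
have [rr1 rr2] : r <= r1 /\ r <= r2 by split; rewrite ge_min lexx ?orbT.
have hr2 : r / 2 <= r by lra.
pose chi1 := window (p, q) G1 (t1 - a1) (t1 + a1).
pose chi2 := window (q, p) G2 (t2 - a2) (t2 + a2).
pose act y := [&& ~~ chi1 y, ~~ chi2 y & ~~ `[< disc x r (gam y.1.2 y.2) >]].
have mact p' G' : P p' -> A p' G' -> mset (dom p' G' `&` [set t | act (p', G', t)]).
  move=> hp hG.
  have -> : dom p' G' `&` [set t | act (p', G', t)] =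
     ((dom p' G' `&` [set t | ~~ `[< disc x r (G' t%:C%C) >]]) `\`
       (dom p' G' `&` [set t | chi1 (p', G', t)])) `\`
       (dom p' G' `&` [set t | chi2 (p', G', t)]).
    apply/seteqP; split=> t; rewrite /act /=.
      move=> [ht /and3P[n1 n2 n3]]; split; first split=> //.
        by case=> _ h; move: n1; rewrite h.
      by case=> _ h; move: n2; rewrite h.
    move=> [[[ht n3] n1] n2]; split=> //; apply/and3P; split=> //.
      by apply/negP => h; apply: n1.
    by apply/negP => h; apply: n2.
  apply: measurableD; first apply: measurableD.
  - by apply: outside_mact => //; exact: open_disc.
  - exact: window_mact.
  - exact: window_mact.
exists (r / 2), (fun z => 2^-1 * (E1 z + E2 z - Fam (kern act 1 z))).
split; first by rewrite divr_gt0.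
  apply: holoZ; apply: holoB.
    apply: holoD.
      by apply: (holoS _ hE1); apply: disc_sub; lra.
    by apply: (holoS _ hE2); apply: disc_sub; lra.
  apply/holoP => z hz; apply: (far_part r_gt0 hz mact) => y.
  by case/and3P=> _ _ /asboolPn.
move=> z V hz XV Vz.
have hz1 : disc x r1 z by apply: (disc_sub _ hz); lra.
have hz2 : disc x r2 z by apply: (disc_sub _ hz); lra.
rewrite -(j1 z V hz1 XV Vz) -(j2 z V hz2 XV Vz).
have [s s0 [_ far]] := support_far XV Vz.
have adm (act' : set C * set C * (C -> C) * R -> bool) : (forall p G, P p -> A p G ->
    mset (dom p G `&` [set t | act' (p, G, t)])) ->
    admissible P A dom (kern act' 1 z).
  move=> ma; apply: (cut_kernel_admissible mdom s0 cgam ma (fun x hx _ => far x hx)).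
  by rewrite subrr cmod0 divr_gt0.
have ad0 := adm act mact.
have ad1 := adm chi1 (@window_mact _ _ _ _).
have ad2 := adm chi2 (@window_mact _ _ _ _).
have full : Fam (kern xpredT 1 z) =
    Fam (kern act 1 z) + Fam (kern chi1 1 z) + Fam (kern chi2 1 z).
  transitivity (Fam (fun y => 1 * (1 * kern act 1 z y + 1 * kern chi1 1 z y) +
      1 * kern chi2 1 z y)); last exact: Fam_sum3 ad0 ad1 ad2.
  apply: Fam_eq => -[U1 U2] H t [/= X1 X2] hH ht.
  have [t01 [[_ [_ [c1 _]]] [_ [c2 _]]]] := ht.
  rewrite /cut_kernel /act.
  case: (boolP (chi1 (U1, U2, H, t))) => [h1|h1] /=.
    have -> : chi2 (U1, U2, H, t) = false.
      apply/negP => h2; move: h1 h2 => /asboolP[/= [e3 e4] _ _] /asboolP[/= [e5 _] _ _].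
      by apply: npq; rewrite -e3 e5.
    by rewrite mulr0 add0r !mul1r addr0.
  case: (boolP (chi2 (U1, U2, H, t))) => [h2|h2] /=.
    by rewrite !mulr0 !add0r mulr0 add0r !mul1r.
  case: asboolP => hD /=; last by rewrite !mulr0 !addr0 !mul1r.
  have hD1 := disc_sub rr1 hD; have hD2 := disc_sub rr2 hD.
  rewrite /= /gam /= in hD1 hD2.
  have [e3|e3] := el1 _ _ hD1 X1 c1; have [e4|e4] := el1 _ _ hD1 X2 c2.
  - by rewrite e3 e4 /W weight_diag !mul0r.
  - rewrite e3 in hH; have [eH ha] := only1 H t hH t01 hD1.
    by move/negP: h1; case; apply/asboolP; rewrite /= e3 e4.
  - rewrite e3 in hH; have [eH ha] := only2 H t hH t01 hD2.
    by move/negP: h2; case; apply/asboolP; rewrite /= e3 e4.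
  - by rewrite e3 e4 /W weight_diag !mul0r.
rewrite cauchy_heine_family full.
rewrite (@Fam_window (p, q) G1 (t1 - a1) (t1 + a1) z (conj Xp Xq) hG1 i1).
rewrite (@Fam_window (q, p) G2 (t2 - a2) (t2 + a2) z (conj Xq Xp) hG2 i2).
by rewrite /W -/k0; field.
Qed.

End CauchyHeine.

(** * Gluing, and removal of the isolated exceptional points *)

Section Gluing.
Variables (R : realType) (Omega : set R[i]) (Xi : set (set R[i])).
Local Notation C := R[i].
Variable arcs : set C -> set (C -> C).
Hypothesis Omega_open : open Omega.
Hypothesis part : is_partition Omega Xi arcs.
Local Notation bd := (boundary Omega).
Local Notation dX := (dXi Omega Xi).
Local Notation reg := (regular_points Omega Xi).
Local Notation sing := (singular_points Omega Xi).
Variables (f : set C -> C -> C) (NN : set C -> set C).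
Hypothesis NN_open : forall U, Xi U -> open (NN U).
Hypothesis NN_closure : forall U, Xi U -> Omega `&` closure U `<=` NN U.
Hypothesis f_holo : forall U, Xi U -> holomorphic_on (NN U) (f U).
Hypothesis mass_finite : (cauchy_heine_mass Omega Xi arcs f < +oo)%E.
Local Notation CH := (cauchy_heine_integral Omega Xi arcs f).
Local Notation LE := (locally_extends Omega Xi arcs f).
Variable B : R.
Hypothesis fCH_bounded : forall U z, Xi U -> U z -> cmod (f U z - CH z) <= B.

Lemma elements_dense x (r : R) : Omega x -> 0 < r ->
  exists U z, [/\ Xi U, U z & cmod (z - x) < r].
Proof.
move=> Ox r0; have /seteqP[_ /(_ x Ox)[U XU [_ cU]]] := element_cover part.
by have /closure_discP/(_ r r0)[z Uz zr] := cU; exists U, z.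
Qed.

Lemma cont_eq_dense (g h : C -> C) x : {for x, continuous g} ->
  {for x, continuous h} ->
  (forall r : R, 0 < r -> exists2 z, cmod (z - x) < r & g z = h z) -> g x = h x.
Proof.
move=> /cont_discP cg /cont_discP ch hd.
apply/eqP; rewrite -subr_eq0 -cmod_eq0 eq_le cmod_ge0 andbT.
apply/ler_addgt0Pr => e e0; rewrite add0r; have e2 : 0 < e / 2 by rewrite divr_gt0.
have [r1 r10 h1] := cg _ e2; have [r2 r20 h2] := ch _ e2.
have [|z] := hd (Num.min r1 r2); first by rewrite lt_min r10.
rewrite lt_min => /andP[/h1 hz1 /h2 hz2] e1.
rewrite e1 in hz1; have := cmod_triangle (h z) (g x) (h x).
by rewrite (cmodBC (g x) (h z)); lra.
Qed.

Lemma cont_bound_dense (g : C -> C) x (M : R) : {for x, continuous g} ->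
  (forall r : R, 0 < r -> exists2 z, cmod (z - x) < r & cmod (g z) <= M) ->
  cmod (g x) <= M.
Proof.
move=> /cont_discP cg hd; apply/ler_addgt0Pr => e e0.
have [r r0 h] := cg _ e0; have [z /h hz hM] := hd r r0.
by have := cmod_lower (g x) (g z); rewrite cmodBC; lra.
Qed.

Lemma glue_extensions (A : set C) : open A -> A `<=` Omega ->
  (forall x, A x -> LE x) ->
  exists E, [/\ holomorphic_on A E,
    forall z U, A z -> Xi U -> U z -> E z = f U z - CH z &
    forall z, A z -> cmod (E z) <= B].
Proof.
move=> oA AO hLE.
have step x : exists c : R * (C -> C), A x ->
    [/\ 0 < c.1, holomorphic_on (disc x c.1) c.2 &
    forall z U, disc x c.1 z -> Xi U -> U z -> c.2 z = f U z - CH z].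
  have [Ax|nA] := pselect (A x); last by exists (0, id).
  by have [r [E hE]] := hLE x Ax; exists (r, E).
have [c hc] := choice step.
(* The diagonal value is the glued function; two local extensions agree where
   both are defined because the elements are dense. *)
pose H x := (c x).2 x.
have agree x y : A x -> A y -> disc x (c x).1 y -> (c x).2 y = H y.
  move=> Ax Ay xy; have [rx0 hx ex] := hc x Ax; have [ry0 hy ey] := hc y Ay.
  have [q q0 hq] := sub_disc_at xy.
  apply: (@cont_eq_dense (c x).2 (c y).2 y).
  - exact: holo_cont hx xy.
  - exact: holo_cont hy (disc_center y ry0).
  - move=> r r0.
    have [|U [z [XU Uz]]] := @elements_dense y (Num.min r (Num.min q (c y).1)) (AO y Ay).
      by rewrite !lt_min r0 q0.
    rewrite !lt_min => /andP[zr /andP[zq zy]]; exists z => //.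
    by rewrite (ex z U _ XU Uz)//; [rewrite (ey z U)|exact: hq].
have cH x : A x -> cder H x (derive1 (c x).2 x).
  move=> Ax; have [rx0 hx _] := hc x Ax.
  have /open_discP/(_ x Ax)[q q0 hq] := oA.
  apply: (@cder_near _ (c x).2 _ _ _ (Num.min (c x).1 q)).
  - by rewrite lt_min rx0.
  - move=> y; rewrite /disc /= lt_min => /andP[xy yq].
    by apply: agree => //; exact: hq.
  - exact: (holo_cder hx (disc_center x rx0)).
have HE z U : A z -> Xi U -> U z -> H z = f U z - CH z.
  move=> Az XU Uz; have [rz0 _ ez] := hc z Az.
  by rewrite /H (ez z U)//; exact: disc_center.
exists H; split.
- by apply/holoP => x Ax; eexists; exact: cH.
- exact: HE.
- move=> z Az; apply: cont_bound_dense; first exact: cder_cont (cH z Az).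
  move=> r r0; have /open_discP/(_ z Az)[q q0 hq] := oA.
  have [|U [w [XU Uw]]] := @elements_dense z (Num.min r q) (AO z Az).
    by rewrite lt_min r0.
  rewrite lt_min => /andP[wr wq]; exists w => //.
  by rewrite (HE w U)//; [exact: fCH_bounded|exact: hq].
Qed.

(** Off [x] the local extensions glue to a function bounded by [B], which makes
    the singularity at [x] removable. *)
Lemma locally_extends_punctured x (r : R) : 0 < r -> disc x r `<=` Omega ->
  (forall y, disc x r y -> y <> x -> LE y) -> LE x.
Proof.
move=> r0 rO hLE.
have [[U XU Ux]|nU] := pselect (exists2 U, Xi U & U x).
  exact: (locally_extends_element part NN_closure f_holo mass_finite XU Ux).
pose A : set C := disc x r `\ x.
have oA : open A.
  apply/open_discP => y [yr yx]; have [q q0 hq] := sub_disc_at yr.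
  have yx0 : 0 < cmod (x - y).
    by rewrite cmod_gt0 subr_eq0; apply/eqP => e; apply: yx; rewrite /= e.
  exists (Num.min q (cmod (x - y))); first by rewrite lt_min q0.
  move=> z; rewrite /disc /= lt_min => /andP[/hq zr zy]; split=> //= e.
  by move: zy; rewrite e ltxx.
have [|y [yr yx]|E [hE eE bE]] := glue_extensions oA.
- by move=> y [/rO].
- exact: (hLE y yr yx).
have [|G hG GE] := removable r0 hE (M := B).
  by move=> z zr zx; apply: bE; split=> //; exact/eqP.
exists r, G; split; [exact: r0|exact: hG|].
move=> z U zr XU Uz.
have zx : z <> x by move=> e; apply: nU; exists U => //; rewrite -e.
rewrite GE//; last exact/eqP.
by apply: eE => //; split.
Qed.

Lemma finite_radius (T : choiceType) (F : set T) (P : T -> R -> Prop) :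
  finite_set F -> (forall i (r s : R), s <= r -> P i r -> P i s) ->
  (forall i, F i -> exists2 r : R, 0 < r & P i r) ->
  exists2 r : R, 0 < r & forall i, F i -> P i r.
Proof.
move=> /finite_seqP[s ->] mono; elim: s => [|i s IH] h.
  by exists 1 => // i; rewrite /= in_nil.
have [r1 r10 h1] := h i (mem_head i s).
have [|r2 r20 h2] := IH; first by move=> j js; apply: h; rewrite /= in_cons js orbT.
exists (Num.min r1 r2); first by rewrite lt_min r10.
move=> j; rewrite /= in_cons => /orP[/eqP ->|js].
  by apply: mono h1; rewrite ge_min lexx.
by apply: mono (h2 j js); rewrite ge_min lexx orbT.
Qed.

(** Were the critical points of an arc infinitely many, they would accumulate,
    and the arc would be constant there. *)
Lemma finite_critical U G : Xi U -> arcs U G ->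
  finite_set [set t : R | 0 <= t <= 1 /\ derive1 G t%:C%C = 0].
Proof.
move=> XU hG; apply: contrapT => infZ; set Z := [set t : R | _] in infZ.
have [D [oD segD hD]] := arc_holomorphic (element_boundary part XU) hG.
have bZ : bounded_set Z.
  exists 1; split; first exact: num_real.
  move=> M M1 t [/andP[t0 t1] _]; rewrite /= ger0_norm//.
  exact: (le_trans t1 (ltW M1)).
have [t ht] := infinite_bounded_limit_point_nonempty infZ bZ.
have acc (e : R) : 0 < e -> exists s, [/\ s != t, Z s & `|s - t| < e].
  move=> e0; have [s [st Zs ts]] := ht _ (nbhsx_ballx t e e0).
  exists s; split=> //; have : `|t - s| < e by [].
  by rewrite distrC.
have t01 : 0 <= t <= 1.
  apply/andP; split; rewrite leNgt; apply/negP => lt.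
    have [|s [_ [/andP[s0 s1] _]]] := acc (- t); first by rewrite oppr_gt0.
    by rewrite ltr_norml => /andP[? ?]; lra.
  have [|s [_ [/andP[s0 s1] _]]] := acc (t - 1); first by rewrite subr_gt0.
  by rewrite ltr_norml => /andP[? ?]; lra.
have Dt : D t%:C%C by apply: segD; rewrite in_itv.
have /open_discP/(_ _ Dt)[r r0 hr] := oD.
have [|s s0 hs] := zeros_isolated r0 (holoS hr (holo_derive oD hD)).
  move=> e e0; have [s [st [_ Zs] se]] := acc e e0.
  exists s%:C%C; split=> //; last by rewrite -rmorphB cmod_real.
  by apply: contra_neq st => -[].
pose q := Num.min r s / 2.
have [rs0 hq1 hq2] : [/\ 0 < Num.min r s, Num.min r s <= r & Num.min r s <= s].
  by split; [rewrite lt_min r0|rewrite ge_min lexx|rewrite ge_min lexx orbT].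
have q0 : 0 < q by rewrite divr_gt0.
have hqr : disc t%:C%C q `<=` D.
  by move=> z hz; apply: hr; apply: disc_sub hz; rewrite /q; lra.
have const z : disc t%:C%C q z -> G z = G t%:C%C.
  move=> hz; apply/eqP; rewrite -subr_eq0 -cmod_eq0 eq_le cmod_ge0 andbT.
  rewrite -[leRHS](mul0r (cmod (z - t%:C%C))).
  apply: (mean_value_ineq (holoS hqr hD) _ hz (disc_center _ q0)) => u hu.
  by rewrite hs ?cmod0//; apply: disc_sub hu; rewrite /q; lra.
have [u [u01 ut uq]] : exists u : R, [/\ 0 <= u <= 1, u <> t & `|u - t| < q].
  case/andP: t01 => t0 t1.
  have [h|h] := leP t (1 / 2).
    pose v := Num.min (q / 2) (1 / 2).
    have [v0 vq v2] : [/\ 0 < v, v <= q / 2 & v <= 1 / 2].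
      by split; [rewrite lt_min !divr_gt0|rewrite ge_min lexx|rewrite ge_min lexx orbT].
    exists (t + v); rewrite addrAC subrr add0r gtr0_norm//.
    by split; [apply/andP; split; lra|move=> e; lra|lra].
  pose v := Num.min (q / 2) (1 / 2).
  have [v0 vq v2] : [/\ 0 < v, v <= q / 2 & v <= 1 / 2].
    by split; [rewrite lt_min !divr_gt0|rewrite ge_min lexx|rewrite ge_min lexx orbT].
  exists (t - v); rewrite addrAC subrr add0r normrN gtr0_norm//.
  by split; [apply/andP; split; lra|move=> e; lra|lra].
apply: ut; apply: (arc_injective (element_boundary part XU) hG); rewrite ?in_itv//=.
by apply: const; rewrite /disc /= -rmorphB cmod_real.
Qed.

Definition arc_exception U y := exists G t,
  [/\ arcs U G, 0 <= t <= 1, G t%:C%C = y & ~ (0 < t < 1 /\ derive1 G t%:C%C != 0)].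

(** Finitely many arcs of [U] come near [x], each with two ends and finitely many
    critical points. *)
Lemma finite_exceptions U x : Xi U -> reg x ->
  exists2 r : R, 0 < r & finite_set [set y | disc x r y /\ arc_exception U y].
Proof.
move=> XU rx; have [dx _] := rx.
have ba := element_boundary part XU.
have Ox : Omega x by case: dx => V _ [].
have [cU|ncU] := pselect (closure U x); last first.
  have : nbhs x (~` closure U).
    by apply: open_nbhs_nbhs; split=> //; apply: closed_openC; exact: closed_closure.
  move=> /nbhs_discP[r r0 hr]; exists r => //.
  rewrite (_ : [set y | _] = set0); first exact: finite_set0.
  apply/seteqP; split=> // y [/hr nc [G [t [hG ht e _]]]]; apply: nc.
  have [_ [cy _]] := arc_boundary part XU hG ht; rewrite e in cy; exact: cy.
have bU : bd U x.
  by apply: closure_boundary => // Ux; exact: (element_not_dXi part XU Ux).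
have [|D /nbhs_discP[r r0 hr] fin] := arc_locally_finite ba bU.
  by case=> _; apply.
exists r => //.
pose S := [set G | arcs U G /\ exists2 t, t \in `[0, 1] & D (G t%:C%C)].
pose bad (G : C -> C) := [set 0; 1] `|` [set t : R | 0 <= t <= 1 /\ derive1 G t%:C%C = 0].
apply: (@sub_finite_set _ _ (\bigcup_(G in S) ((fun t : R => G t%:C%C) @` bad G))).
  move=> y [/hr Dy [G [t [hG ht e ng]]]]; exists G.
    by split=> //; exists t; rewrite ?in_itv ?e.
  exists t => //; have [dG|dG] := eqVneq (derive1 G t%:C%C) 0; first by right.
  left; have [->|t0] := eqVneq t 0; first by left.
  have [->|t1] := eqVneq t 1; first by right.
  exfalso; apply: ng; split=> //; case/andP: ht => h0 h1.
  by rewrite !lt_neqAle h0 h1 eq_sym t0 t1.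
apply: bigcup_finite => // G [hG _]; apply: finite_image.
rewrite finite_setU; split; last exact: (finite_critical XU hG).
by rewrite finite_setU; split; exact: finite_set1.
Qed.

Lemma good_near_regular x : reg x -> exists2 r : R, 0 < r &
  disc x r `<=` Omega /\ forall y, disc x r y -> y <> x -> dX y ->
    good_point Omega Xi arcs y.
Proof.
move=> rx; have [dx _] := rx; have Ox : Omega x by case: dx => V _ [].
have [r1 r10 [hO hreg]] := regular_nbhd rx.
have [D /nbhs_discP[r2 r20 hr2] finF] := element_locally_finite part Ox.
set F := [set U | _] in finF.
have [r3 r30 h3] : exists2 r : R, 0 < r & forall U, F U ->
    finite_set [set y | disc x r y /\ arc_exception U y].
  apply: (finite_radius finF).
    move=> U r s sr; apply: sub_finite_set => y [hy he]; split=> //.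
    exact: disc_sub sr _ hy.
  by move=> U [XU _]; exact: finite_exceptions.
have finB : finite_set (\bigcup_(U in F) [set y | disc x r3 y /\ arc_exception U y]).
  exact: bigcup_finite.
have [r4 r40 h4] : exists2 r : R, 0 < r & forall y,
    (\bigcup_(U in F) [set y | disc x r3 y /\ arc_exception U y]) y ->
    (disc x r y -> y = x).
  apply: (finite_radius (P := fun y r => disc x r y -> y = x) finB).
    by move=> y r s sr h hy; apply: h; exact: disc_sub sr _ hy.
  move=> y _; have [->|yx] := eqVneq y x; first by exists 1.
  exists (cmod (y - x)); first by rewrite cmod_gt0 subr_eq0.
  by rewrite /disc /= ltxx.
exists (Num.min (Num.min r1 r2) (Num.min r3 r4)); first by rewrite !lt_min r10 r20 r30.
have hmin y : disc x (Num.min (Num.min r1 r2) (Num.min r3 r4)) y ->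
    [/\ disc x r1 y, disc x r2 y, disc x r3 y & disc x r4 y].
  by rewrite /disc /= !lt_min => /andP[/andP[? ?] /andP[? ?]].
split; first by move=> y /hmin[/hO].
move=> y /hmin[y1 y2 y3 y4] yx dy; split; first exact: hreg.
move=> U G t XU hG ht e; apply: contrapT => ng; apply: yx; apply: h4 => //.
exists U; last by split=> //; exists G, t.
split=> //; have [_ [cU _]] := arc_boundary part XU hG ht; rewrite e in cU.
have [z [Uz yz]] := cU _ (open_nbhs_nbhs (conj (@open_disc _ x r2) y2)).
by exists z; split=> //; exact: hr2.
Qed.

Lemma locally_extends_off x : Omega x -> ~ dX x -> LE x.
Proof.
move=> Ox nd; have [U XU Ux] := in_element part Ox nd.
exact: (locally_extends_element part NN_closure f_holo mass_finite XU Ux).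
Qed.

Lemma locally_extends_regular x : reg x -> LE x.
Proof.
move=> /good_near_regular[r r0 [rO hr]].
apply: (locally_extends_punctured r0 rO) => y yr yx.
have [dy|ndy] := pselect (dX y); last by apply: locally_extends_off => //; exact: rO.
exact: (locally_extends_good part NN_open NN_closure f_holo mass_finite (hr y yr yx dy)).
Qed.

Hypothesis sing_isolated : sing `<=` isolated sing.

Lemma locally_extends_everywhere x : Omega x -> LE x.
Proof.
move=> Ox; have [dx|ndx] := pselect (dX x); last exact: locally_extends_off.
have [rx|nrx] := pselect (reg x); first exact: locally_extends_regular.
have sx : sing x by [].
have [_ [D /nbhs_discP[r1 r10 hr1] eD]] := sing_isolated sx.
have /open_discP/(_ x Ox)[r2 r20 hr2] := Omega_open.
apply: (@locally_extends_punctured x (Num.min r1 r2)).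
- by rewrite lt_min r10.
- by move=> y; rewrite /disc /= lt_min => /andP[_ /hr2].
move=> y; rewrite /disc /= lt_min => /andP[/hr1 Dy /hr2 Oy] yx.
have [dy|ndy] := pselect (dX y); last exact: locally_extends_off.
have [ry|nry] := pselect (reg y); first exact: locally_extends_regular.
exfalso; apply: yx; have : (D `&` sing) y by [].
by rewrite eD.
Qed.

Lemma cauchy_heine_difference : exists H, [/\ holomorphic_on Omega H,
  forall z U, Omega z -> Xi U -> U z -> H z = f U z - CH z &
  forall z, Omega z -> cmod (H z) <= B].
Proof.
by apply: glue_extensions => // x; exact: locally_extends_everywhere.
Qed.

End Gluing.

(** * The maximum principle for the difference *)

Section BoundarySuprema.
Variables (R : realType) (Omega : set R[i]) (Xi : set (set R[i])).
Local Notation C := R[i].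
Variable arcs : set C -> set (C -> C).

Lemma lt_pinfty_bound (x : \bar R) : (x < +oo)%E -> exists M : R, (x <= M%:E)%E.
Proof.
case: x => [r _|//|_]; first by exists r.
by exists 0; exact: leNye.
Qed.

Lemma cochain_abs_ge (g : set C -> C -> C) U z : Xi U -> closure U z ->
  ((cmod (g U z))%:E <= cochain_abs Xi g z)%E.
Proof. by move=> XU cU; apply: ereal_sup_ubound; exists U. Qed.

Lemma sup_domain_ge (g : set C -> C -> C) U z : Omega z -> Xi U -> closure U z ->
  ((cmod (g U z))%:E <= sup_domain Omega Xi g)%E.
Proof.
move=> Oz XU cU; apply: (le_trans (cochain_abs_ge g XU cU)).
by apply: ereal_sup_ubound; exists z.
Qed.

(** A continuation is determined by continuity alone, the points of [U] being
    dense near [z]. *)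
Lemma analytic_continuation_eq U g (A : set C) h z : open A -> A z ->
  closure U z -> holomorphic_on A h -> {in A `&` U, h =1 g} ->
  analytic_continuation U g z = h z.
Proof.
move=> oA Az cU hA hg; rewrite /analytic_continuation.
set S := [set v | _].
have Sh : S (h z) by exists A, h.
have [A' [h' [oA' A'z hA' hg' ->]]] := xgetI 0 Sh.
have /open_discP/(_ z Az)[r r0 hr] := oA.
have /open_discP/(_ z A'z)[r' r'0 hr'] := oA'.
apply: (cont_eq_dense (holo_cont hA' A'z) (holo_cont hA Az)) => s s0.
have [|w Uw] := (closure_discP _ _).1 cU (Num.min s (Num.min r r')).
  by rewrite !lt_min s0 r0.
rewrite !lt_min => /andP[ws /andP[wr wr']]; exists w => //.
rewrite hg'; first by rewrite hg// inE; split=> //; exact: hr.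
by rewrite inE; split=> //; exact: hr'.
Qed.

Lemma sup_boundary_near (g : set C -> C -> C) (H : C -> C) xi (M : R) :
  (forall z, Omega z -> exists U, [/\ Xi U, closure U z & g U z = H z]) ->
  (closure Omega `\` Omega) xi -> (sup_boundary Omega Xi g <= M%:E)%E ->
  forall e, 0 < e -> exists2 V : set C, nbhs xi V &
    forall z, V z -> Omega z -> cmod (H z) <= M + e.
Proof.
move=> gH hxi hM e e0.
have : (limf_esup (cochain_abs Xi g) (within Omega (nbhs xi)) < (M + e)%:E)%E.
  apply: (@le_lt_trans _ _ (sup_boundary Omega Xi g)).
    by apply: ereal_sup_ubound; exists xi.
  by apply: (le_lt_trans hM); rewrite lte_fin ltrDl.
move=> /ereal_inf_lt[_ [V hV <-] lt].
exists [set z | Omega z -> V z] => // z Vz Oz.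
have [U [XU cU e1]] := gH z Oz; rewrite -lee_fin -e1.
apply: le_trans (ltW lt); apply: (le_trans (cochain_abs_ge g XU cU)).
by apply: ereal_sup_ubound; exists z => //; exact: Vz.
Qed.

Lemma sup_boundary_ge0 (g : set C -> C -> C) :
  (forall z, Omega z -> exists2 U, Xi U & closure U z) ->
  (closure Omega `\` Omega) !=set0 -> (0 <= sup_boundary Omega Xi g)%E.
Proof.
move=> hU [xi hxi].
apply: (@le_trans _ _ (limf_esup (cochain_abs Xi g) (within Omega (nbhs xi)))).
  apply: le_ereal_inf_tmp => _ [V hV <-].
  have [cO _] := hxi; have [z [Oz Vz]] := cO _ hV.
  have [U XU cU] := hU z Oz.
  apply: (@le_trans _ _ (cmod (g U z))%:E); first by rewrite lee_fin cmod_ge0.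
  apply: (le_trans (cochain_abs_ge g XU cU)).
  by apply: ereal_sup_ubound; exists z => //; exact: Vz.
by apply: ereal_sup_ubound; exists xi.
Qed.

Lemma sup_boundary_perturb (g h : set C -> C -> C) (s : R) :
  (forall z U, Omega z -> Xi U -> closure U z -> cmod (g U z) <= cmod (h U z) + s) ->
  (sup_boundary Omega Xi g <= sup_boundary Omega Xi h + s%:E)%E.
Proof.
move=> gh; apply: ge_ereal_sup => _ [xi hxi <-].
apply: (@le_trans _ _ (limf_esup (cochain_abs Xi h) (within Omega (nbhs xi)) + s%:E)).
  rewrite -leeBlDr//; apply: le_ereal_inf_tmp => _ [V hV <-].
  rewrite leeBlDr//.
  apply: (@le_trans _ _ (ereal_sup [set cochain_abs Xi g x | x in V `&` Omega])).
    apply: ereal_inf_lbound; exists (V `&` Omega) => //.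
    move: hV; rewrite /within /=; apply: filterS => z hz Oz; split=> //.
    exact: hz.
  apply: ge_ereal_sup => _ [z [Vz Oz] <-].
  apply: ge_ereal_sup => _ [U [XU cU] <-].
  apply: (@le_trans _ _ ((cmod (h U z))%:E + s%:E)%E).
    by rewrite -EFinD lee_fin; exact: gh.
  rewrite leeD2rE//; apply: (le_trans (cochain_abs_ge h XU cU)).
  by apply: ereal_sup_ubound; exists z.
by rewrite leeD2rE//; apply: ereal_sup_ubound; exists xi.
Qed.

End BoundarySuprema.

Theorem corollary2 (R : realType) (Omega : set R[i]) (Xi : set (set R[i]))
    (arcs : set R[i] -> set (R[i] -> R[i]))
    (eps0 : R) (N : R -> set R[i] -> set R[i]) (eps : R)
    (f : set R[i] -> R[i] -> R[i]) (rho : R[i] -> R[i])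
    (Omega_open : open Omega) (Omega_connected : connected Omega)
    (Omega_nonempty : Omega !=set0)
    (Xi_partition : is_partition Omega Xi arcs)
    (Xi_regular : is_regular_partition Omega Xi)
    (N_nbhd : generalized_neighbourhood Omega Xi eps0 N)
    (N_regular : regular_neighbourhood Omega Xi eps0 N)
    (f_cochain : is_cochain Xi eps0 N eps f)
    (f_bounded : bounded_cochain Xi N eps f)
    (mass_finite : (cauchy_heine_mass Omega Xi arcs f < +oo)%E)
    (coboundary_bounded : forall U V, Xi U -> Xi V ->
      exists (e M : R), 0 < e <= eps /\
        forall z, N e U z -> N e V z -> cmod (coboundary f U V z) <= M)
    (bounded_near_singular : forall s, singular_points Omega Xi s ->
      exists2 X : set R[i], nbhs s X & forall W, Xi W ->
        exists M : R, forall z, X z -> N eps W z -> cmod (f W z) <= M)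
    (rho_biholomorphic : biholomorphic (@half_plane R) Omega rho)
    (rho_boundary : boundary_on_imaginary_axis Omega rho)
    (f_bounded_Omega : (sup_domain Omega Xi f < +oo)%E)
    (Cf_bounded_Omega :
      (sup_domain Omega Xi (cauchy_heine Omega Xi arcs f) < +oo)%E) :
  let Cf := cauchy_heine Omega Xi arcs f in
  let f_Cf := fun U z => f U z - Cf U z in
  (sup_domain Omega Xi f <= sup_boundary Omega Xi f_Cf + sup_domain Omega Xi Cf)%E /\
  (sup_boundary Omega Xi f_Cf + sup_domain Omega Xi Cf
    <= sup_boundary Omega Xi f + 2%:E * sup_domain Omega Xi Cf)%E.
Proof.
move=> Cf f_Cf.
have [eps01 f_holo] := f_cochain.
have NO U : Xi U -> [/\ open (N eps U), N eps U `<=` Omega &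
    Omega `&` closure U `<=` N eps U] by exact: (nbhd_open N_nbhd).
have N_open U : Xi U -> open (N eps U) by move=> /NO[].
have N_closure U : Xi U -> Omega `&` closure U `<=` N eps U by move=> /NO[].
have cover z : Omega z -> exists2 U, Xi U & closure U z.
  move=> Oz; have /seteqP[_ /(_ z Oz)[U XU [_ cU]]] := element_cover Xi_partition.
  by exists U.
have [Bf hBf] := lt_pinfty_bound f_bounded_Omega.
have [s hs] : exists s : R, sup_domain Omega Xi Cf = s%:E.
  move: Cf_bounded_Omega; rewrite -/Cf; have [z Oz] := Omega_nonempty.
  have [U XU cU] := cover z Oz.
  have := sup_domain_ge Cf Oz XU cU.
  by case: (sup_domain Omega Xi Cf) => [s _ _|//|//]; exists s.
have Cf_le U z : Omega z -> Xi U -> closure U z -> cmod (Cf U z) <= s.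
  by move=> Oz XU cU; rewrite -lee_fin -hs; exact: sup_domain_ge.
have s0 : 0 <= s.
  have [z Oz] := Omega_nonempty; have [U XU cU] := cover z Oz.
  by apply: le_trans (Cf_le U z Oz XU cU); exact: cmod_ge0.
have f_le U z : Omega z -> Xi U -> closure U z -> cmod (f U z) <= Bf.
  by move=> Oz XU cU; rewrite -lee_fin; apply: le_trans hBf; exact: sup_domain_ge.
(* The components of the transform on the elements are the integral itself, so
   the two boundedness hypotheses bound the difference there. *)
have bounded U z : Xi U -> U z ->
    cmod (f U z - cauchy_heine_integral Omega Xi arcs f z) <= Bf + s.
  move=> XU Uz; have Oz := element_sub Xi_partition XU Uz.
  have cU := subset_closure Uz.
  apply: (le_trans (cmodB _ _)); apply: lerD; first exact: f_le.
  have := Cf_le U z Oz XU cU; rewrite /Cf /cauchy_heine.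
  by rewrite mem_set.
have [H [hH HE HB]] := cauchy_heine_difference Omega_open Xi_partition N_open
  N_closure f_holo mass_finite bounded (singular_isolated Xi_regular).
(* The continuation of the integral from [U] to a boundary point is [f U - H],
   which is holomorphic on the neighbourhood of the closure where [f U] is. *)
have diff U z : Omega z -> Xi U -> closure U z -> f_Cf U z = H z.
  move=> Oz XU cU; rewrite /f_Cf /Cf /cauchy_heine.
  have [Uz|nUz] := pselect (U z); first by rewrite mem_set//= -HE.
  rewrite memNset//=.
  rewrite (@analytic_continuation_eq _ U _ (N eps U) (fun z => f U z - H z)) ; [ring| | | | |].
  - exact: N_open.
  - exact: N_closure.
  - exact: cU.
  - apply: holoB; first exact: f_holo.
    by apply: (holoS _ hH); have [] := NO U XU.
  - move=> w; rewrite inE => -[_ Uw].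
    by rewrite (HE w U (element_sub Xi_partition XU Uw) XU Uw); ring.
have [rho_holo rho_im [sigma [sigma_holo sigma_im _ rhoK]]] := rho_biholomorphic.
have [rho_cont rho_axis] := rho_boundary.
have bd_axis (y : R) : (closure Omega `\` Omega) (rho (Complex 0 y)).
  by rewrite -rho_axis; exists (Complex 0 y).
have M_ge0 : (0 <= sup_boundary Omega Xi f_Cf)%E.
  by apply: sup_boundary_ge0 => //; exists (rho (Complex 0 0)).
have H_le z : Omega z -> ((cmod (H z))%:E <= sup_boundary Omega Xi f_Cf)%E.
  case eM : (sup_boundary Omega Xi f_Cf) => [M| |]; last 2 first.
  - by move=> _; rewrite leey.
  - by move: M_ge0; rewrite eM.
  move=> Oz; rewrite lee_fin; rewrite eM lee_fin in M_ge0.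
  have rhoz : rho (sigma z) = z by apply: rhoK; rewrite inE.
  rewrite -rhoz.
  apply: (@phragmen_lindelof _ (fun w => H (rho w)) (Bf + s) M).
  - exact: holo_comp rho_holo rho_im hH.
  - by move=> w hw; apply: HB; apply: rho_im; exists w.
  - exact: M_ge0.
  - move=> y e e0.
    have gH w : Omega w -> exists U, [/\ Xi U, closure U w & f_Cf U w = H w].
      by move=> Ow; have [U XU cU] := cover w Ow; exists U; split;
        [exact: XU|exact: cU|exact: diff].
    have leM : (sup_boundary Omega Xi f_Cf <= M%:E)%E by rewrite eM.
    have [V hV HV] := sup_boundary_near gH (bd_axis y) leM e0.
    have Ky : closed_half_plane (Complex 0 y : R[i]) by rewrite /closed_half_plane /=.
    have := (subspace_continuousP _ _).1 rho_cont _ Ky.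
    move=> /(_ V hV); rewrite /= /within /= nbhs_simpl /= => /nbhs_discP[r r0 hr].
    exists r => // w hw wr; apply: HV; last by apply: rho_im; exists w.
    by apply: hr => //; exact: ltW.
  - by apply: sigma_im; exists z.
split.
  apply: ge_ereal_sup => _ [z Oz <-]; apply: ge_ereal_sup => _ [U [XU cU] <-].
  apply: (@le_trans _ _ ((cmod (H z))%:E + (cmod (Cf U z))%:E)%E).
    rewrite -EFinD lee_fin -(diff U z Oz XU cU).
    by rewrite -{1}(subrK (Cf U z) (f U z)); exact: cmodD.
  by apply: leeD; [exact: H_le|exact: sup_domain_ge].
rewrite hs.
have le : (sup_boundary Omega Xi f_Cf <= sup_boundary Omega Xi f + s%:E)%E.
  apply: sup_boundary_perturb => z U Oz XU cU.
  by apply: (le_trans (cmodB _ _)); apply: lerD => //; exact: Cf_le.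
apply: (le_trans (leeD2r _ le)).
rewrite -addeA -EFinD -EFinM; apply: leeD2l.
by rewrite lee_fin mulr_natl mulr2n.
Qed.
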